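(* Let $d\ge 2$. Let $\mathcal{C}_n^A$ be the dual Weyl cone of type $A_{n-1}$ built from exchangeable random vectors in $\mathbb{R}^d$ that are almost surely in type $A$ general position, and let $\mathcal{C}_n^B$ be the dual Weyl cone of type $B_n$ built from symmetrically exchangeable random vectors in $\mathbb{R}^d$ that are almost surely in type $B$ general position. The expected conic intrinsic volumes are $$\mathbb{E}\,\upsilon_d(\mathcal{C}_n^A)=\frac{D^A(n,d)-D^A(n,d-1)}{2D^A(n,d)},\qquad \mathbb{E}\,\upsilon_j(\mathcal{C}_n^A)=\genfrac{[}{]}{0pt}{}{n}{n-j}\frac{1}{D^A(n,d)},\quad j=0,\ldots,d-1,$$ $$\mathbb{E}\,\upsilon_d(\mathcal{C}_n^B)=\frac{D^B(n,d)-D^B(n,d-1)}{2D^B(n,d)},\qquad \mathbb{E}\,\upsilon_j(\mathcal{C}_n^B)=\frac{B[n,n-j]}{D^B(n,d)},\quad j=0,\ldots,d-1.$$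
   Context: Type $A$ general position: $y_1,\ldots,y_n\in\mathbb{R}^d$ with $n\ge d+1$ such that for every permutation $\sigma$ of $\{1,\ldots,n\}$ any $d$ of the vectors $y_{\sigma(1)}-y_{\sigma(2)},\ldots,y_{\sigma(n-1)}-y_{\sigma(n)}$ are linearly independent. Type $B$ general position: $y_1,\ldots,y_n\in\mathbb{R}^d$ with $n\ge d$ such that for every $\varepsilon\in\{\pm1\}^n$ and every permutation $\sigma$ of $\{1,\ldots,n\}$ any $d$ of the vectors $\varepsilon_1y_{\sigma(1)}-\varepsilon_2y_{\sigma(2)},\ldots,\varepsilon_{n-1}y_{\sigma(n-1)}-\varepsilon_ny_{\sigma(n)},\,\varepsilon_ny_{\sigma(n)}$ are linearly independent. Random vectors $Y_1,\ldots,Y_n$ are exchangeable if $(Y_1,\ldots,Y_n)$ has the same distribution as $(Y_{\sigma(1)},\ldots,Y_{\sigma(n)})$ for every permutation $\sigma$, and symmetrically exchangeable if it has the same distribution as $(\varepsilon_1Y_{\sigma(1)},\ldots,\varepsilon_nY_{\sigma(n)})$ for every permutation $\sigma$ and every $\varepsilon\in\{\pm1\}^n$. $\operatorname{pos}\{x_1,\ldots,x_m\}=\{\sum_i\lambda_ix_i:\lambda_i\ge0\}$. The dual Weyl cone $\mathcal{C}_n^A$ is the random cone whose distribution is that of $\operatorname{pos}\{Y_1-Y_2,\ldots,Y_{n-1}-Y_n\}$ conditioned on the event that this positive hull is not equal to $\mathbb{R}^d$ (with $Y_i$ exchangeable and a.s. in type $A$ general position). The dual Weyl cone $\mathcal{C}_n^B$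 is the random cone whose distribution is that of $\operatorname{pos}\{Y_1-Y_2,\ldots,Y_{n-1}-Y_n,Y_n\}$ conditioned on the event that this positive hull is not equal to $\mathbb{R}^d$ (with $Y_i$ symmetrically exchangeable and a.s. in type $B$ general position). Conic intrinsic volumes: for a polyhedral cone $C\subset\mathbb{R}^d$ let $\Pi_C(x)$ be the unique point of $C$ closest to $x\in\mathbb{R}^d$, and let $\mathcal{F}_j(C)$ be the set of $j$-dimensional faces of $C$ (faces are obtained by replacing some, possibly none, of the half-spaces defining $C$ by their boundaries). Then $\upsilon_j(C):=\sum_{F\in\mathcal{F}_j(C)}\mathbb{P}(\Pi_C(g)\in\operatorname{relint}F)$, $j=0,\ldots,d$, where $g$ is a standard Gaussian vector in $\mathbb{R}^d$ and $\operatorname{relint}F$ is the interior of $F$ relative to its linear hull. $\genfrac{[}{]}{0pt}{}{n}{k}$ and $B[n,k]$ are defined by $t(t+1)\cdots(t+n-1)=\sum_{k=1}^n\genfrac{[}{]}{0pt}{}{n}{k}t^k$ and $(t+1)(t+3)\cdots(t+2n-1)=\sum_{k=0}^nB[n,k]t^k$, and are zero for $k$ outside $\{1,\ldots,n\}$, resp. $\{0,\ldots,n\}$. Put $D^A(m,k):=2\sum_{i\ge0}\genfrac{[}{]}{0pt}{}{m}{m-k+1+2i}$ and $D^B(m,k):=2\sum_{i\ge0}B[m,m-k+1+2i]$. *)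

(* Defs.v *)
From HB Require Import structures.
From mathcomp Require Import all_boot all_order all_algebra all_fingroup.
From mathcomp Require Import all_classical all_reals all_analysis.

Set Implicit Arguments.
Unset Strict Implicit.
Unset Printing Implicit Defensive.

Import Order.TTheory GRing.Theory Num.Theory.
Import numFieldNormedType.Exports.

Local Open Scope classical_set_scope.
Local Open Scope ring_scope.

Section combinatorial_numbers.

(* t(t+1)...(t+n-1) and (t+1)(t+3)...(t+2n-1) *)
Definition polyA (n : nat) : {poly nat} := \prod_(i < n) ('X + (i : nat)%:P).

Definition polyB (n : nat) : {poly nat} :=
  \prod_(i < n) ('X + (i.*2.+1)%:P).

Definition stirlingA (n k : nat) : nat := ((polyA n)`_k)%R.

Definition stirlingB (n k : nat) : nat := ((polyB n)`_k)%R.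

(* The index m.+1 - k + i.*2 is m - k + 1 + 2i without truncation as soon as
   k <= m.+1; the omitted terms (i > m) all vanish in that range. *)
Definition DA (m k : nat) : nat :=
  (2 * \sum_(i < m.+1) stirlingA m (m.+1 - k + i.*2))%N.

Definition DB (m k : nat) : nat :=
  (2 * \sum_(i < m.+1) stirlingB m (m.+1 - k + i.*2))%N.

End combinatorial_numbers.

Section cones.
Context {R : realType} {d : nat}.
Implicit Types (C F : set 'rV[R]_d) (x : 'rV[R]_d).

Definition dot (x y : 'rV[R]_d) : R := \sum_k x 0 k * y 0 k.

(* The norm of the library on 'rV[R]_d is the sup norm. *)
Definition enorm x : R := Num.sqrt (dot x x).

Definition pos (I : finType) (x : I -> 'rV[R]_d) : set 'rV[R]_d :=
  [set v | exists2 l : I -> R, forall i, 0 <= l i & v = \sum_i l i *: x i].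

Definition linhull F : set 'rV[R]_d :=
  smallest [set A | exists V : {vspace 'rV[R]_d}, A = [set` V]] F.

Definition has_dim F (j : nat) : Prop :=
  exists2 V : {vspace 'rV[R]_d}, linhull F = [set` V] & \dim V = j.

Definition relint F : set 'rV[R]_d :=
  [set x | F x /\ within (linhull F) (nbhs x) F].

(* C is presented as a finite intersection of half-spaces, some of which are
   then replaced by their boundaries; C = setT is the case m = 0. *)
Definition is_face C F : Prop :=
  exists (m : nat) (u : 'I_m -> 'rV[R]_d) (J : {set 'I_m}),
    [/\ forall i, u i != 0,
        C = [set x | forall i, 0 <= dot (u i) x] &
        F = [set x | forall i,
               if i \in J then dot (u i) x = 0 else 0 <= dot (u i) x]].

Definition faces (j : nat) C : set (set 'rV[R]_d) :=
  [set F | is_face C F /\ has_dim F j].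

Definition cone_proj C x : 'rV[R]_d :=
  get [set y | C y /\ forall z, C z -> enorm (x - y) <= enorm (x - z)].

End cones.

Section gaussian.
Context {R : realType}.
Local Open Scope ereal_scope.

(* Law on R^d of d independent standard normal variables. *)
Fixpoint gauss (d : nat) : set (d.-tuple (measurableTypeR R)) -> \bar R :=
  match d with
  | 0 => \d_ [tuple]
  | d'.+1 => pushforward (normal_prob 0 1 \x @gauss d')
               (fun p => [the d'.+1.-tuple (measurableTypeR R) of p.1 :: p.2])
  end.

Definition row_of_tuple (d : nat) (x : d.-tuple (measurableTypeR R)) :
  'rV[R]_d := (\row_k tnth x k)%R.

Definition intrinsic_volume (d j : nat) (C : set 'rV[R]_d) : \bar R :=
  \esum_(F in faces j C)
    gauss [set x | relint F (cone_proj C (row_of_tuple x))].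

End gaussian.

Section general_position.
Context {R : realType} {d n : nat}.
Implicit Types y : 'I_n -> 'rV[R]_d.

(* y_1 - y_2, ..., y_{n-1} - y_n; below n.-1 the cyclic successor ordS is the
   plain successor. *)
Definition genA y (i : 'I_n.-1) : 'rV[R]_d :=
  let k := widen_ord (leq_pred n) i in y k - y (ordS k).

(* y_1 - y_2, ..., y_{n-1} - y_n, y_n *)
Definition genB y (k : 'I_n) : 'rV[R]_d :=
  if k.+1 == n then y k else y k - y (ordS k).

Definition any_d_free (m : nat) (x : 'I_m -> 'rV[R]_d) : Prop :=
  forall J : {set 'I_m}, #|J| = d -> free [seq x i | i in J].

Definition signed_perm y (e : 'I_n -> bool) (s : 'S_n) (i : 'I_n) : 'rV[R]_d :=
  (-1) ^+ e i *: y (s i).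

Definition gen_posA y : Prop :=
  (d < n)%N /\ forall s : 'S_n, any_d_free (genA (y \o s)).

Definition gen_posB y : Prop :=
  (d <= n)%N /\ forall (e : 'I_n -> bool) (s : 'S_n),
    any_d_free (genB (signed_perm y e s)).

End general_position.

Section random_vectors.
Context {disp : measure_display} {T : measurableType disp} {R : realType}.
Context (P : probability T R) {d n : nat}.
Implicit Types (X Y : T -> 'I_n -> 'rV[R]_d) (C : T -> set 'rV[R]_d).
Local Open Scope ereal_scope.

Definition random_vectors Y : Prop := forall i k,
  measurable_fun [set: T] (fun w => Y w i ord0 k : measurableTypeR R).

Definition joint_tuple Y (w : T) : n.-tuple (d.-tuple (measurableTypeR R)) :=
  [tuple [tuple Y w i ord0 k | k < d] | i < n].

Definition same_distribution X Y : Prop :=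
  forall A : set (n.-tuple (d.-tuple (measurableTypeR R))), measurable A ->
    P (joint_tuple X @^-1` A) = P (joint_tuple Y @^-1` A).

Definition exchangeable Y : Prop :=
  forall s : 'S_n, same_distribution Y (fun w => Y w \o s).

Definition symmetrically_exchangeable Y : Prop :=
  forall (e : 'I_n -> bool) (s : 'S_n),
    same_distribution Y (fun w => signed_perm (Y w) e s).

Definition cond_prob (E : set T) : set T -> \bar R :=
  fun A => P (A `&` E) * ((fine (P E))^-1)%:E.

(* Under the conditional probability given [C <> R^d], the random cone C has
   the conditional distribution of C, so this is the expected j-th conic
   intrinsic volume of a random cone with that distribution. *)
Definition expected_volume_proper C (j : nat) : \bar R :=
  \int[cond_prob [set w | C w <> setT]]_w intrinsic_volume j (C w).

Definition E_volume_A Y (j : nat) : \bar R :=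
  expected_volume_proper (fun w => pos (genA (Y w))) j.

Definition E_volume_B Y (j : nat) : \bar R :=
  expected_volume_proper (fun w => pos (genB (Y w))) j.

End random_vectors.

(* Main.v *)
Require Import Defs.
From HB Require Import structures.
From mathcomp Require Import all_boot all_order all_algebra all_fingroup.
From mathcomp Require Import all_classical all_reals all_analysis.
From mathcomp Require Import measurable_realfun ring lra zify.

Set Implicit Arguments.
Unset Strict Implicit.
Unset Printing Implicit Defensive.

Import Order.TTheory GRing.Theory Num.Theory.
Import numFieldNormedType.Exports.

Local Open Scope classical_set_scope.
Local Open Scope ring_scope.

(** Let vectors in general position be permuted in all ways (type A), or permuted
and multiplied by signs in all ways (type B). This gives one cone for every
element of a finite reflection group, and by (symmetric) exchangeability all these
cones have the law of the given random cone. Expectations are therefore averages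
over the group, and these averages turn out not to depend on the vectors:

- for almost every z and every j < d, the number of cones of the family whose
  point nearest to z lies in the relative interior of a j-face is the number c_j
  of group elements w with rank (1 - w) = j (generic_face_count);
- the number of cones different from R^d is the number D d determined by D 0 = 0
  and D (k+1) + D k = 2 (c_0 + ... + c_k) (proper_count).

Integrating the first count over a Gaussian z shows that the expectation of the
j-th intrinsic volume, over the event that the cone is proper, is c_j / |G|, and
the second shows that this event has probability D d / |G|; conditioning divides
one by the other. For j = d one counts the proper cones none of whose lower faces
catches z, that is D d - (c_0 + ... + c_(d-1)) = (D d - D (d-1)) / 2.

The first count rests on a theorem of Waldspurger: if xi and xi' lie in one open
chamber and xi - xi w = xi' - xi' w', then w = w' (waldspurger_inj). The cone of
a label v is the image, under the linear map Y given by the vectors, of the dual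
of the chamber of v. Given w, one projects z to the image of 1 - w under Y, and a
perturbation of the solution xi - xi w by vectors fixed by w moves xi into a
chamber v for which the solution is optimal over the whole dual cone as well
(linked_exists). As the optimal point over the dual cone is unique, Waldspurger's
theorem makes w |-> v injective, hence bijective, and the roots of v that carry
the optimal point form a basis of the image of 1 - w (linked_rank).

The second count is an induction on d along a generic projection R^(k+1) -> R^k
with kernel spanned by z: the projected cone is proper exactly when the cone is
proper and contains neither z nor - z, and a proper cone that misses z has a
unique lower face catching z.

The numbers c_j are computed by writing every element of the next larger group
uniquely as an element of the group times the identity or a reflection moving the
last coordinate; each such reflection raises the rank by one
(label_rank_countS). This gives the products that define the Stirling numbers.

What remains is to identify the intrinsic volumes with Gaussian measures of cells
(intrinsic_volume_low, intrinsic_volume_top), and to check that the cells and the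
event that a cone is proper depend measurably on the vectors
(hits_polynomialP, measurable_proper). *)

(** * The dot product *)

Section DotProduct.
Context {R : realType} {n : nat}.
Implicit Types x y z : 'rV[R]_n.

Lemma dotE x y : dot x y = (x *m y^T) 0 0.
Proof. by rewrite /dot mxE; apply: eq_bigr => k _; rewrite mxE. Qed.

Lemma dotC x y : dot x y = dot y x.
Proof. by apply: eq_bigr => k _; rewrite mulrC. Qed.

Lemma dotDl x y z : dot (x + y) z = dot x z + dot y z.
Proof. by rewrite !dotE mulmxDl mxE. Qed.

Lemma dotZl a x y : dot (a *: x) y = a * dot x y.
Proof. by rewrite !dotE -scalemxAl mxE. Qed.

Lemma dotNl x y : dot (- x) y = - dot x y.
Proof. by rewrite -scaleN1r dotZl mulN1r. Qed.

Lemma dotBl x y z : dot (x - y) z = dot x z - dot y z.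
Proof. by rewrite dotDl dotNl. Qed.

Lemma dot0l x : dot 0 x = 0.
Proof. by rewrite -(scale0r 0) dotZl mul0r. Qed.

Lemma dot_suml (I : Type) (r : seq I) (P : pred I) (F : I -> 'rV[R]_n) y :
  dot (\sum_(i <- r | P i) F i) y = \sum_(i <- r | P i) dot (F i) y.
Proof.
by apply: (big_morph (dot^~ y)) => [a b|]; rewrite ?dotDl ?dot0l.
Qed.

Lemma dotDr x y z : dot x (y + z) = dot x y + dot x z.
Proof. by rewrite dotC dotDl !(dotC x). Qed.

Lemma dotZr a x y : dot x (a *: y) = a * dot x y.
Proof. by rewrite dotC dotZl (dotC y). Qed.

Lemma dotNr x y : dot x (- y) = - dot x y.
Proof. by rewrite dotC dotNl (dotC y). Qed.

Lemma dotBr x y z : dot x (y - z) = dot x y - dot x z.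
Proof. by rewrite dotDr dotNr. Qed.

Lemma dot0r x : dot x 0 = 0.
Proof. by rewrite dotC dot0l. Qed.

Lemma dot_sumr (I : Type) (r : seq I) (P : pred I) (F : I -> 'rV[R]_n) y :
  dot y (\sum_(i <- r | P i) F i) = \sum_(i <- r | P i) dot y (F i).
Proof. by rewrite dotC dot_suml; apply: eq_bigr => i _; rewrite dotC. Qed.

Lemma dot_ge0 x : 0 <= dot x x.
Proof. by apply: sumr_ge0 => k _; rewrite -expr2 sqr_ge0. Qed.

Lemma dot_eq0 x : (dot x x == 0) = (x == 0).
Proof.
apply/idP/eqP => [|->]; last by rewrite dot0l.
rewrite psumr_eq0 => [/allP x0|k _]; last by rewrite -expr2 sqr_ge0.
apply/rowP => k; rewrite mxE; apply/eqP.
by have := x0 k (mem_index_enum k); rewrite mulf_eq0 orbb.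
Qed.

Lemma dot_gt0 x : (0 < dot x x) = (x != 0).
Proof. by rewrite lt_def dot_eq0 dot_ge0 andbT. Qed.

Lemma dot_eq0P x : dot x x = 0 -> x = 0.
Proof. by move/eqP; rewrite dot_eq0 => /eqP. Qed.

Lemma mulmx_tr_eq0 x y : (x *m y^T == 0) = (dot x y == 0).
Proof.
rewrite dotE; apply/eqP/eqP => [->|xy0]; first by rewrite mxE.
by apply/rowP => i; rewrite ord1 xy0 mxE.
Qed.

Lemma dot_delta x k : dot x (delta_mx 0 k) = x 0 k.
Proof.
rewrite /dot (bigD1 k)//= big1 => [|i ik]; rewrite !mxE.
  by rewrite !eqxx mulr1 addr0.
by rewrite eqxx (negPf ik) mulr0.
Qed.

Lemma dotB_expand x y : dot (x - y) (x - y) = dot x x - 2 * dot x y + dot y y.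
Proof. by rewrite dotBl !dotBr (dotC y x); ring. Qed.

End DotProduct.

Section MatrixDot.
Context {R : realType}.

Lemma dot_mulmx n p (x : 'rV[R]_n) (A : 'M[R]_(n, p)) y :
  dot (x *m A) y = dot x (y *m A^T).
Proof. by rewrite !dotE trmx_mul trmxK mulmxA. Qed.

Lemma mulmx_tr0P n p (x : 'rV[R]_n) (A : 'M[R]_(p, n)) :
  (forall y : 'rV[R]_p, dot x (y *m A) = 0) <-> x *m A^T = 0.
Proof.
split=> [xA|xA0 y]; last by rewrite dotC dot_mulmx xA0 dot0r.
by apply: dot_eq0P; rewrite dot_mulmx trmxK.
Qed.

(** Normal equations of a least squares problem: the Gram matrix has the same
row space as the transpose, because u A A^T = 0 forces |u A|^2 = 0. *)
Lemma least_squares n p (A : 'M[R]_(p, n)) :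
  exists L : 'M[R]_(n, p), forall z : 'rV[R]_n, (z - z *m L *m A) *m A^T = 0.
Proof.
have sub : (A^T <= A *m A^T)%MS.
  rewrite submxE; apply/eqP.
  have gram : (cokermx (A *m A^T))^T *m A *m A^T = 0.
    apply: trmx_inj; rewrite -mulmxA trmx_mul trmxK trmx0 trmx_mul trmxK.
    exact: mulmx_coker.
  apply: trmx_inj; rewrite [LHS]trmx_mul trmxK trmx0.
  apply/row_matrixP => i; rewrite row_mul row0; apply: dot_eq0P.
  by rewrite dot_mulmx -row_mul -row_mul gram row0 dot0r.
have [L LE] := submxP sub.
by exists L => z; rewrite mulmxBl -!mulmxA -LE subrr.
Qed.

(** A row space is its own double orthogonal complement. *)
Lemma annihilatorP n p q (A : 'M[R]_(p, n)) (z : 'M[R]_(q, n)) :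
  z *m (kermx A^T)^T = 0 -> (z <= A)%MS.
Proof.
move=> zK; rewrite submxE; apply/eqP.
have /submxP[B BE] : ((cokermx A)^T <= kermx A^T)%MS.
  by apply/sub_kermxP; rewrite -trmx_mul mulmx_coker trmx0.
by rewrite -[cokermx A]trmxK BE trmx_mul mulmxA zK mul0mx.
Qed.

End MatrixDot.

(** * Signs and generic vectors *)

Section Perturbation.
Context {R : realType}.

(** Genericity and dominance are open conditions on finitely many signs; this is
the form in which openness is used. *)
Lemma sg_perturb (I : finType) (p q : I -> R) :
  exists2 e, 0 < e & forall i, p i != 0 -> Num.sg (p i + e * q i) = Num.sg (p i).
Proof.
have den i : 0 < 1 + `|q i| by rewrite ltr_wpDr.
have bound i : exists2 e, 0 < e & forall e', 0 < e' <= e -> p i != 0 ->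
    Num.sg (p i + e' * q i) = Num.sg (p i).
  have [p0|p0] := eqVneq (p i) 0; first by exists 1.
  exists (`|p i| / (1 + `|q i|)); first by rewrite divr_gt0 ?normr_gt0.
  move=> e /andP[e0]; rewrite ler_pdivlMr// => el _.
  have lt : `|e * q i| < `|p i|.
    rewrite normrM (gtr0_norm e0); apply: lt_le_trans el.
    by rewrite ltr_pM2l// ltrDr.
  move: lt; rewrite ltr_norml => /andP[lo hi].
  have [p_lt|p_gt|/eqP] := ltgtP (p i) 0; last by rewrite (negPf p0).
    by rewrite (ltr0_norm p_lt) in hi; rewrite !ltr0_sg//; lra.
  by rewrite (gtr0_norm p_gt) in lo; rewrite !gtr0_sg//; lra.
have [b b0 bP] : exists2 b : I -> R, (forall i, 0 < b i) &
    forall i e', 0 < e' <= b i -> p i != 0 ->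
    Num.sg (p i + e' * q i) = Num.sg (p i).
  pose b i := sval (cid2 (bound i)).
  by exists b => i; rewrite /b; case: cid2.
suff [e e0 eb] : exists2 e, 0 < e & forall i, e <= b i.
  by exists e => // i; apply: bP; rewrite e0 eb.
exists (\big[Num.min/1]_i b i).
  by elim/big_ind: _ => // x y x0 y0; rewrite lt_min x0.
by move=> i; rewrite (bigD1 i)//= ge_min lexx.
Qed.

End Perturbation.

(** Exceptional sets are confined to hyperplanes through the origin, so that generic
properties are stable under finite conjunction, have witnesses, and hold Gauss
almost surely. *)
Definition generic {R : realType} {n} (Q : 'rV[R]_n -> Prop) :=
  exists2 s : seq 'rV[R]_n, 0 \notin s &
    forall x, (forall a, a \in s -> dot a x != 0) -> Q x.

Section Generic.
Context {R : realType} {n : nat}.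
Implicit Types Q : 'rV[R]_n -> Prop.

Lemma generic_sub Q Q' : (forall x, Q x -> Q' x) -> generic Q -> generic Q'.
Proof. by move=> QQ' [s s0 sQ]; exists s => // x /sQ/QQ'. Qed.

Lemma genericT Q : (forall x, Q x) -> generic Q.
Proof. by move=> Qx; exists [::]. Qed.

Lemma generic_and Q Q' : generic Q -> generic Q' -> generic (fun x => Q x /\ Q' x).
Proof.
move=> [s s0 sQ] [s' s0' sQ']; exists (s ++ s').
  by rewrite mem_cat negb_or s0.
by move=> x xs; split; [apply: sQ|apply: sQ'] => a a_in; apply: xs;
  rewrite mem_cat a_in ?orbT.
Qed.

Lemma generic_hyperplane (a : 'rV[R]_n) : a != 0 -> generic (fun x => dot a x != 0).
Proof. by move=> a0; exists [:: a] => [|x]; [rewrite inE eq_sym|apply; rewrite inE]. Qed.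

Lemma generic_forall (I : finType) (Q : I -> 'rV[R]_n -> Prop) :
  (forall i, generic (Q i)) -> generic (fun x => forall i, Q i x).
Proof.
move=> QI.
suff : generic (fun x => forall i, i \in enum I -> Q i x).
  by apply: generic_sub => x xQ i; apply: xQ; rewrite mem_enum.
elim: (enum I) => [|i s IH]; first exact: genericT.
apply: generic_sub (generic_and (QI i) IH) => x [xi xs] j.
by rewrite inE => /predU1P[->|/xs].
Qed.

Lemma generic_impl (P : Prop) Q : (P -> generic Q) -> generic (fun x => P -> Q x).
Proof.
move=> PQ; have [/PQ|nP] := pselect P; first by apply: generic_sub => x ? _.
exact: genericT.
Qed.

Lemma generic_ex Q : generic Q -> exists x, Q x.
Proof.
move=> [s s0 sQ].
suff [x xs] : exists x, forall a, a \in s -> dot a x != 0 by exists x; apply: sQ.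
elim: s s0 {sQ} => [|a s IH]; first by exists 0.
rewrite inE negb_or eq_sym => /andP[a0 /IH[x xs]].
have [ax|ax] := eqVneq (dot a x) 0; last first.
  by exists x => b; rewrite inE => /predU1P[->|/xs].
have [e e0 eP] := sg_perturb (fun b : seq_sub s => dot (val b) x)
  (fun b => dot (val b) a).
exists (x + e *: a) => b; rewrite inE => /predU1P[->|bs].
  by rewrite dotDr ax add0r dotZr mulf_neq0 ?dot_eq0// gt_eqF.
have := eP (SeqSub bs) (xs b bs); rewrite /= dotDr dotZr => sgE.
by rewrite -sgr_eq0 sgE sgr_eq0 xs.
Qed.

Lemma generic_notin p (A : 'M[R]_(p, n)) : (\rank A < n)%N ->
  generic (fun x => ~~ (x <= A)%MS).
Proof.
move=> rA; have : kermx A^T != 0.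
  by rewrite -mxrank_eq0 mxrank_ker mxrank_tr subn_eq0 -ltnNge.
case/rowV0Pn => a /sub_kermxP aA a0.
apply: generic_sub (generic_hyperplane a0) => x.
apply: contra => /submxP[l ->].
by rewrite dotC dot_mulmx aA dot0r.
Qed.

End Generic.

(** * Chamber systems and the face count *)

Section Chambers.
Context {R : realType} {n m : nat} {Om : finType}.
Variables (M : Om -> 'M[R]_n) (alpha : Om -> 'I_m -> 'rV[R]_n).

Definition dominant (v : Om) (xi : 'rV[R]_n) := forall i, 0 < dot xi (alpha v i).

(** What is needed of a finite reflection group: alpha v are the simple roots of
the chamber of v, the chambers cover the complement of the walls, and for xi in a
chamber xi - xi w lies in the dual cone of that chamber and vanishes only for
w = 1. The dimensions n and m may differ, as the roots of type A span a
hyperplane only. *)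
Record chamber_system : Prop := ChamberSystem {
  cs_orth : forall w, M w *m (M w)^T = 1%:M;
  cs_inj : injective M;
  cs_div : forall w w', exists w'', M w'' = M w *m (M w')^T;
  cs_free : forall v (l : 'I_m -> R),
    \sum_i l i *: alpha v i = 0 -> forall i, l i = 0;
  cs_sort : forall xi, (forall v i, dot xi (alpha v i) != 0) ->
    exists v, dominant v xi;
  cs_descent : forall v w xi, dominant v xi ->
    exists2 l : 'I_m -> R, forall i, 0 <= l i &
      xi - xi *m M w = \sum_i l i *: alpha v i;
  cs_regular : forall v w xi, dominant v xi -> xi *m M w = xi -> M w = 1%:M }.

End Chambers.

Definition lexsg {R : realType} (a b c e : R) : R :=
  if a != 0 then Num.sg a else if b != 0 then Num.sg b
  else if c != 0 then Num.sg c else Num.sg e.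

(** For A >> B >> C >> 1 the sign of a linear combination is that of its first
nonzero entry. *)
Lemma lex_perturb (R : realType) (I : finType) (a b c e : I -> R) :
  exists A B C, forall i,
    Num.sg (A * a i + B * b i + C * c i + e i) = lexsg (a i) (b i) (c i) (e i).
Proof.
have [e3 e30 E3] := sg_perturb c e.
have [e2 e20 E2] := sg_perturb b (fun i => c i + e3 * e i).
have [e1 e10 E1] := sg_perturb a (fun i => b i + e2 * (c i + e3 * e i)).
exists (e1 * e2 * e3)^-1, (e2 * e3)^-1, e3^-1 => i.
have -> : (e1 * e2 * e3)^-1 * a i + (e2 * e3)^-1 * b i + e3^-1 * c i + e i =
    (e1 * e2 * e3)^-1 * (a i + e1 * (b i + e2 * (c i + e3 * e i))).
  by field; rewrite !gt_eqF.
have sgM k y : 0 < k -> Num.sg (k * y) = Num.sg y :> R.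
  by move=> k0; rewrite sgrM gtr0_sg// mul1r.
rewrite sgM ?invr_gt0 ?mulr_gt0// /lexsg.
have [a0|/E1//] := eqVneq (a i) 0; rewrite a0 add0r sgM//.
have [b0|/E2//] := eqVneq (b i) 0; rewrite b0 add0r sgM//.
by have [c0|/E3//] := eqVneq (c i) 0; rewrite c0 add0r sgM.
Qed.

Section OrthogonalFixedSpace.
Context {R : realType} {n : nat} (M : 'M[R]_n).
Hypothesis orthM : M *m M^T = 1%:M.

(** M and its inverse have the same fixed vectors. *)
Lemma fixed_trP (f : 'rV[R]_n) : f *m (1%:M - M) = 0 <-> f *m (1%:M - M)^T = 0.
Proof.
rewrite [(_ - _)^T]linearB/= trmx1 !mulmxBr !mulmx1; split=> /eqP; rewrite subr_eq0 => /eqP fM.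
  by rewrite [in X in _ - X]fM -mulmxA orthM mulmx1 subrr.
by rewrite [in X in _ - X]fM -mulmxA (mulmx1C orthM) mulmx1 subrr.
Qed.

End OrthogonalFixedSpace.

Section TwoLevelProjection.
Context {R : realType} {n d : nat}.
Variables (D : 'M[R]_n) (Y : 'M[R]_(n, d)).

(** Optimality conditions for minimising over im D first the distance from c Y to x
and then the distance from c to g. The second target is needed because Y has a
kernel; mu is the multiplier of the constraint that c Y stays fixed. *)
Definition two_level (x : 'rV[R]_d) (g c : 'rV[R]_n) :=
  (x - c *m Y) *m Y^T *m D^T = 0 /\
  exists mu : 'rV[R]_d, (g - c + mu *m Y^T) *m D^T = 0.

(** Least squares for c Y, followed by a correction within the kernel of Y; what
matters later is that the solution is linear in the pair (x, g). *)
Lemma two_level_solvable : exists (P : 'M[R]_(d, n)) (Q : 'M[R]_n),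
  forall x g, two_level x g ((x *m P + g *m Q) *m D).
Proof.
have [L1 L1P] := least_squares (D *m Y).
move KE : (kermx (D *m Y)) => K.
have KDY : K *m (D *m Y) = 0 by rewrite -KE mulmx_ker.
have [L2 L2P] := least_squares (K *m D).
exists (L1 - L1 *m D *m L2 *m K), (L2 *m K) => x g.
set c := _ *m D.
have cE : c = x *m L1 *m D + (g - x *m L1 *m D) *m L2 *m (K *m D).
  by rewrite /c mulmxBr mulmxDl !mulmxBl !mulmxA [RHS]addrA [RHS]addrAC.
split.
  have -> : c *m Y = x *m L1 *m (D *m Y).
    by rewrite cE mulmxDl -!mulmxA KDY !mulmx0 addr0.
  by rewrite -mulmxA -trmx_mul L1P.
have : (g - c) *m D^T *m K^T = 0.
  by rewrite -mulmxA -trmx_mul cE opprD addrA L2P.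
rewrite -KE -[D *m Y]trmxK => /annihilatorP/submxP[mu muE].
exists (- mu); rewrite mulmxDl muE trmx_mul mulmxA mulNmx mulNmx addrC.
by rewrite addNr.
Qed.

Lemma two_level_uniq x g xi xi' :
  two_level x g (xi *m D) -> two_level x g (xi' *m D) -> xi *m D = xi' *m D.
Proof.
move=> [r0 [mu s0]] [r0' [mu' s0']].
pose z := (xi - xi') *m D.
have zY : z *m Y = 0.
  apply: dot_eq0P; rewrite dot_mulmx dotC.
  rewrite {2}/z -[(xi - xi') *m D]/(_ *m D) [dot _ (_ *m D)]dotC dot_mulmx.
  suff -> : z *m Y *m Y^T *m D^T = 0 by rewrite dot0r.
  have -> : z *m Y = (x - xi' *m D *m Y) - (x - xi *m D *m Y).
    rewrite /z !mulmxBl; move: (xi *m D *m Y) (xi' *m D *m Y) => a b.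
    by apply/rowP => i; rewrite !mxE; ring.
  by rewrite mulmxBl mulmxBl r0' r0 subrr.
apply/eqP; rewrite -subr_eq0 -mulmxBl -/z -dot_eq0; apply/eqP.
have : dot ((g - xi *m D + mu *m Y^T) - (g - xi' *m D + mu' *m Y^T)) z = 0.
  by rewrite /z dotC dot_mulmx mulmxBl s0 s0' subrr dot0r.
have -> : (g - xi *m D + mu *m Y^T) - (g - xi' *m D + mu' *m Y^T) =
   (mu - mu') *m Y^T - z.
  rewrite /z !mulmxBl; move: (xi *m D) (xi' *m D) (_ *m _) (_ *m _) => a b c e.
  by apply/rowP => i; rewrite !mxE; ring.
rewrite dotBl dot_mulmx trmxK zY dot0r sub0r => /eqP; rewrite oppr_eq0.
by move/eqP.
Qed.

End TwoLevelProjection.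

(** The point of the cone nearest to z lies in the relative interior of the subcone
of J. Strictness off J makes J unique and the condition open. *)
Definition hits {R : realType} {d m : nat} (x : 'I_m -> 'rV[R]_d)
    (J : {set 'I_m}) (z : 'rV[R]_d) : Prop :=
  exists2 l : 'I_m -> R, forall i, i \in J -> 0 < l i &
    let p := \sum_(i in J) l i *: x i in
    (forall i, i \in J -> dot (z - p) (x i) = 0) /\
    (forall i, i \notin J -> dot (z - p) (x i) < 0).

Definition indep {R : realType} {d m : nat} (x : 'I_m -> 'rV[R]_d)
    (J : {set 'I_m}) : Prop :=
  forall l : 'I_m -> R, \sum_(i in J) l i *: x i = 0 ->
    forall i, i \in J -> l i = 0.

Section Waldspurger.
Context {R : realType} {n m : nat} {Om : finType}.
Context {M : Om -> 'M[R]_n} {alpha : Om -> 'I_m -> 'rV[R]_n}.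
Hypothesis csM : chamber_system M alpha.

Local Notation dom := (dominant alpha).
Local Notation D w := (1%:M - M w).

Lemma mulmx_defect (xi : 'rV[R]_n) w : xi *m D w = xi - xi *m M w.
Proof. by rewrite mulmxBr mulmx1. Qed.

Lemma dominant_add v (xi eta : 'rV[R]_n) : dom v xi ->
  exists2 e, 0 < e & dom v (xi + e *: eta).
Proof.
move=> xid.
have [e e0 eP] := sg_perturb (fun i => dot xi (alpha v i))
  (fun i => dot eta (alpha v i)).
exists e => // i; rewrite -sgr_cp0 dotDl dotZl eP ?sgr_cp0//.
by rewrite gt_eqF.
Qed.

(** Waldspurger's argument: as w and w' are isometries, u = w w'^-1 satisfies
<xi - xi u, xi'> = 0. But xi - xi u is a nonnegative combination of roots, on
which xi' is positive, so xi u = xi. *)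
Lemma waldspurger_inj v w w' xi xi' : dom v xi -> dom v xi' ->
  xi *m D w = xi' *m D w' -> w = w'.
Proof.
rewrite !mulmx_defect => xid xid' eqc; apply: (cs_inj csM).
have isom u (y : 'rV[R]_n) : dot (y *m M u) (y *m M u) = dot y y.
  by rewrite dot_mulmx -mulmxA (cs_orth csM) mulmx1.
have eqn : xi - xi' = xi *m M w - xi' *m M w'.
  apply/eqP; rewrite subr_eq addrAC eq_sym subr_eq; apply/eqP.
  move/eqP: eqc; rewrite subr_eq => /eqP eqc.
  rewrite [in RHS]eqc; move: (xi *m M w) (xi' *m M w') => a b.
  by apply/rowP => i; rewrite !mxE; ring.
have eqd : dot xi xi' = dot (xi *m M w) (xi' *m M w').
  have : dot (xi - xi') (xi - xi') =
      dot (xi *m M w - xi' *m M w') (xi *m M w - xi' *m M w') by rewrite eqn.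
  by rewrite !dotB_expand !isom; lra.
have [u uE] := cs_div csM w w'.
have {}eqd : dot (xi - xi *m M u) xi' = 0.
  by rewrite dotBl eqd uE mulmxA [X in _ - X]dot_mulmx trmxK subrr.
have [l l0 lE] := cs_descent csM u xid.
have lz i : l i = 0.
  move: eqd; rewrite lE dot_suml => /eqP; rewrite psumr_eq0 => [/allP|j _].
    move=> /(_ i (mem_index_enum i)); rewrite dotZl mulf_eq0 => /orP[/eqP//|].
    by rewrite dotC gt_eqF.
  by rewrite dotZl mulr_ge0// dotC ltW.
have : M u = 1%:M.
  apply: (cs_regular csM xid); apply/esym/eqP; rewrite -subr_eq0 lE.
  by rewrite big1// => i _; rewrite lz scale0r.
rewrite uE => /(congr1 (mulmx^~ (M w'))).
by rewrite -mulmxA (mulmx1C (cs_orth csM w')) mulmx1 mul1mx.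
Qed.

(** The roots outside im (1 - w) are those that do not annihilate the fixed space of
w, so a generic fixed vector separates them from 0. *)
Lemma fixed_separating w : exists t : 'rV[R]_n, t *m (D w)^T = 0 /\
  forall v i, ~~ (alpha v i <= D w)%MS -> dot t (alpha v i) != 0.
Proof.
pose K := kermx (D w)^T.
have gen : generic (fun z : 'rV[R]_n => forall p : Om * 'I_m,
    ~~ (alpha p.1 p.2 <= D w)%MS -> dot (alpha p.1 p.2 *m K^T) z != 0).
  apply: generic_forall => -[v i] /=; apply: generic_impl => nD.
  apply: generic_hyperplane; apply: contra nD => /eqP.
  exact: annihilatorP.
have [z zP] := generic_ex gen; exists (z *m K); split.
  by rewrite -mulmxA mulmx_ker mulmx0.
by move=> v i /(zP (v, i)) /= h; rewrite dot_mulmx dotC.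
Qed.

Section Target.
Context {d : nat} (Y : 'M[R]_(n, d)).
Local Notation X v := (fun i => alpha v i *m Y).

(** Optimality conditions for the two-level problem over the dual cone of the
chamber of v instead of a linear space. *)
Definition lex_projection (x : 'rV[R]_d) (g : 'rV[R]_n) v (c : 'rV[R]_n) :=
  let r := (x - c *m Y) *m Y^T in
  (exists2 l : 'I_m -> R, forall i, 0 <= l i & c = \sum_i l i *: alpha v i) /\
  [/\ forall i, dot r (alpha v i) <= 0, dot r c = 0 &
    exists mu : 'rV[R]_d, let s := g - c + mu *m Y^T in
      (forall i, dot r (alpha v i) = 0 -> dot s (alpha v i) <= 0) /\
      dot s c = 0].

(** Lifts vary, but the point of the image cone nearest to x is unique. *)
Lemma lex_projection_image (x : 'rV[R]_d) g v c c' (l' : 'I_m -> R) :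
  lex_projection x g v c ->
  (forall i, 0 <= l' i) -> c' = \sum_i l' i *: alpha v i ->
  let r' := (x - c' *m Y) *m Y^T in
  (forall i, dot r' (alpha v i) <= 0) -> dot r' c' = 0 -> c *m Y = c' *m Y.
Proof.
move=> [[l l0 lE] [rle rc _]] l'0 l'E r' r'le r'c'.
apply/eqP; rewrite -subr_eq0 -mulmxBl -dot_eq0 eq_le dot_ge0 andbT.
have neg (q e : 'rV[R]_n) (k : 'I_m -> R) : (forall i, 0 <= k i) ->
    (forall i, dot q (alpha v i) <= 0) -> e = \sum_i k i *: alpha v i ->
    dot q e <= 0.
  move=> k0 qle ->; rewrite dot_sumr; apply: sumr_le0 => i _.
  by rewrite dotZr mulr_ge0_le0.
have rc' := neg _ _ _ l'0 rle l'E; have r'c := neg _ _ _ l0 r'le lE.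
have -> : dot ((c - c') *m Y) ((c - c') *m Y) =
    dot (r' - (x - c *m Y) *m Y^T) (c - c').
  rewrite [LHS]dot_mulmx [LHS]dotC; congr (dot _ _).
  rewrite /r' -!mulmxBl; congr (_ *m _).
  rewrite mulmxBl; move: (c *m Y) (c' *m Y) => a b.
  by apply/rowP => i; rewrite !mxE; ring.
by rewrite dotBl !dotBr; lra.
Qed.

Lemma lex_projection_uniq x g v c c' :
  lex_projection x g v c -> lex_projection x g v c' -> c = c'.
Proof.
move=> lp lp'.
have [[l' l'0 l'E] [r'le r'c [mu' [s'le s'c]]]] := lp'.
have eqY := lex_projection_image lp l'0 l'E r'le r'c.
have [[l l0 lE] [rle rc [mu [sle sc]]]] := lp.
rewrite -eqY in r'le r'c s'le.
apply/eqP; rewrite -subr_eq0 -dot_eq0 eq_le dot_ge0 andbT.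
have neg (q e : 'rV[R]_n) (k : 'I_m -> R) : (forall i, 0 <= k i) ->
    (forall i, dot ((x - c *m Y) *m Y^T) (alpha v i) = 0 ->
      dot q (alpha v i) <= 0) ->
    e = \sum_i k i *: alpha v i -> dot ((x - c *m Y) *m Y^T) e = 0 ->
    dot q e <= 0.
  move=> k0 qle eE; rewrite eE dot_sumr => /eqP.
  rewrite -oppr_eq0 -sumrN psumr_eq0 => [/allP z|i _]; last first.
    by rewrite oppr_ge0 dotZr mulr_ge0_le0.
  rewrite dot_sumr; apply: sumr_le0 => i _; rewrite dotZr.
  have := z i (mem_index_enum i); rewrite oppr_eq0 dotZr mulf_eq0.
  by move=> /orP[/eqP->|/eqP/qle]; [rewrite mul0r|apply: mulr_ge0_le0].
have sc' := neg _ _ _ l'0 sle l'E r'c; have s'c' := neg _ _ _ l0 s'le lE rc.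
have : dot ((g - c' + mu' *m Y^T) - (g - c + mu *m Y^T)) (c - c') <= 0.
  by rewrite dotBl !dotBr; lra.
have -> : (g - c' + mu' *m Y^T) - (g - c + mu *m Y^T) =
    (mu' - mu) *m Y^T + (c - c').
  rewrite mulmxBl; move: (mu *m _) (mu' *m _) => a b.
  by apply/rowP => i; rewrite !mxE; ring.
rewrite dotDl dot_mulmx trmxK mulmxBl eqY subrr dot0r add0r.
by [].
Qed.

End Target.
End Waldspurger.

Section Bijection.
Context {R : realType} {n m : nat} {Om : finType}.
Context {M : Om -> 'M[R]_n} {alpha : Om -> 'I_m -> 'rV[R]_n}.
Hypothesis csM : chamber_system M alpha.
Context {d : nat} (Y : 'M[R]_(n, d)).

Local Notation dom := (dominant alpha).
Local Notation D w := (1%:M - M w).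
Local Notation X v := (fun i => alpha v i *m Y).

Lemma alpha_neq0 v i : alpha v i != 0.
Proof.
apply/eqP => a0; have : (1 : R) <> 0 by apply/eqP; rewrite oner_eq0.
apply; have free := cs_free csM (v := v) (l := fun j => (j == i)%:R).
rewrite -[RHS](free _ i) ?eqxx// big1// => j _.
by case: eqP => [->|_]; rewrite ?a0 ?scaler0 ?scale0r.
Qed.

Lemma alpha_coef_uniq v (l l' : 'I_m -> R) :
  \sum_i l i *: alpha v i = \sum_i l' i *: alpha v i -> forall i, l i = l' i.
Proof.
move=> ll' i; apply/eqP; rewrite -subr_eq0; apply/eqP.
apply: (cs_free csM (v := v) (l := fun i => l i - l' i)).
by under eq_bigr do rewrite scalerBl; rewrite sumrB ll' subrr.
Qed.

(** A relation between group elements and chambers that turns out to be the graph of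
a bijection; the last two clauses are those that determine the rank of 1 - w. *)
Definition linked (x : 'rV[R]_d) (g : 'rV[R]_n) w v :=
  exists xi, [/\ dom v xi, lex_projection (alpha := alpha) Y x g v (xi *m D w),
    (x - xi *m D w *m Y) *m Y^T *m (D w)^T = 0 &
    forall l : 'I_m -> R, xi *m D w = \sum_i l i *: alpha v i ->
      forall i, l i != 0 -> (alpha v i <= D w)%MS].

Lemma linked_inj x g w w' v : linked x g w v -> linked x g w' v -> w = w'.
Proof.
move=> [xi [xid lp _ _]] [xi' [xid' lp' _ _]].
exact: (waldspurger_inj csM xid xid' (lex_projection_uniq lp lp')).
Qed.

(** The vectors r, s and t are fixed by w, so adding multiples of them to xi0 does
not change c. The multiples are chosen so that membership in a chamber is decided
by r, then s, then t, then xi0: the chamber reached is one for which r and s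
satisfy the optimality conditions, and t removes from the support of c the roots
outside im (1 - w). *)
Lemma linked_exists x g w (xi0 : 'rV[R]_n) :
  two_level (D w) Y x g (xi0 *m D w) ->
  (forall v i, (alpha v i <= D w)%MS -> dot xi0 (alpha v i) != 0) ->
  exists v, linked x g w v.
Proof.
set c := xi0 *m D w => -[]; set r := (x - c *m Y) *m Y^T => rD [mu].
set s := g - c + mu *m Y^T => sD xi0_reg.
have [t [tD t_sep]] := fixed_separating (M := M) (alpha := alpha) w.
have [A [B [C sgE]]] := lex_perturb (fun p : Om * 'I_m => - dot r (alpha p.1 p.2))
  (fun p => - dot s (alpha p.1 p.2)) (fun p => dot t (alpha p.1 p.2))
  (fun p => dot xi0 (alpha p.1 p.2)).
pose xi := - A *: r + - B *: s + C *: t + xi0.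
have {}sgE v i : Num.sg (dot xi (alpha v i)) =
    lexsg (- dot r (alpha v i)) (- dot s (alpha v i))
      (dot t (alpha v i)) (dot xi0 (alpha v i)).
  rewrite -(sgE (v, i)) /= /xi 3!dotDl 3!dotZl; congr Num.sg.
  by rewrite !mulNr !mulrN.
have [v v_dom] : exists v, dom v xi.
  apply: (cs_sort csM) => v i; rewrite -sgr_eq0 sgE /lexsg.
  case: ifPn => [|_]; first by rewrite sgr_eq0.
  case: ifPn => [|_]; first by rewrite sgr_eq0.
  case: ifPn => [|/negPn/eqP t0]; first by rewrite sgr_eq0.
  rewrite sgr_eq0 xi0_reg//; apply/negPn/negP => /t_sep.
  by rewrite t0 eqxx.
have sg1 i : lexsg (- dot r (alpha v i)) (- dot s (alpha v i))
      (dot t (alpha v i)) (dot xi0 (alpha v i)) = 1.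
  by rewrite -sgE gtr0_sg.
have r_le i : dot r (alpha v i) <= 0.
  have := sg1 i; rewrite /lexsg oppr_eq0.
  by case: eqVneq => [->//|_] /eqP; rewrite sgr_cp0 oppr_gt0 => /ltW.
have s_le i : dot r (alpha v i) = 0 -> dot s (alpha v i) <= 0.
  move=> r0; have := sg1 i; rewrite /lexsg r0 oppr0 eqxx /= oppr_eq0.
  by case: eqVneq => [->//|_] /eqP; rewrite sgr_cp0 oppr_gt0 => /ltW.
have t_ge i : dot r (alpha v i) = 0 -> dot s (alpha v i) = 0 ->
    0 <= dot t (alpha v i).
  move=> r0 s0; have := sg1 i; rewrite /lexsg r0 s0 oppr0 eqxx /=.
  by case: eqVneq => [->//|_] /eqP; rewrite sgr_cp0 => /ltW.
have killD (f : 'rV[R]_n) : f *m (D w)^T = 0 -> f *m D w = 0.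
  by move=> fD; apply/(fixed_trP (cs_orth csM w)).
have xiD : xi *m D w = c.
  have scaled k (f : 'rV[R]_n) : f *m (D w)^T = 0 -> (k *: f) *m D w = 0.
    by move=> fD; rewrite -scalemxAl killD// scaler0.
  by rewrite /xi 3!mulmxDl !scaled// !add0r.
have dotc (f : 'rV[R]_n) : f *m (D w)^T = 0 -> dot f c = 0.
  by move=> f0; rewrite dotC dot_mulmx f0 dot0r.
have [l l0] := cs_descent csM w v_dom; rewrite -mulmx_defect xiD => cE.
have sum0 (q : 'rV[R]_n) (k : 'I_m -> R) :
    q *m (D w)^T = 0 -> (forall i, 0 <= k i) -> c = \sum_i k i *: alpha v i ->
    (forall i, k i != 0 -> dot q (alpha v i) <= 0) ->
    forall i, k i != 0 -> dot q (alpha v i) = 0.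
  move=> qD k0 kE qle i ki.
  have := dotc _ qD; rewrite kE dot_sumr => /eqP.
  rewrite -oppr_eq0 -sumrN psumr_eq0 => [/allP|j _].
    move=> /(_ i (mem_index_enum i)); rewrite oppr_eq0 dotZr mulf_eq0.
    by rewrite (negPf ki) => /eqP.
  rewrite oppr_ge0 dotZr; have [->|kj] := eqVneq (k j) 0.
    by rewrite mul0r.
  by rewrite mulr_ge0_le0// qle.
exists v, xi; rewrite xiD; split => //.
  split; first by exists l.
  split => //; first exact: dotc.
  by exists mu; split => //; apply: dotc.
move=> k kE.
have kl := alpha_coef_uniq (etrans (esym kE) cE).
have k0 i : 0 <= k i by rewrite kl.
have r0 := sum0 r k rD k0 kE (fun i _ => r_le i).
have s0 := sum0 s k sD k0 kE (fun i ki => s_le i (r0 i ki)).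
move=> i ki; apply/negPn/negP => /t_sep/eqP; apply; apply/eqP.
rewrite -oppr_eq0 -dotNl; apply/eqP; apply: (sum0 (- t) k) => //.
  by rewrite mulNmx tD oppr0.
by move=> j kj; rewrite dotNl oppr_le0 t_ge ?r0 ?s0.
Qed.

(** Uniqueness of the projection of x identifies the support of c with J. Every
eta - eta w with eta dominant is orthogonal to the residual, hence supported on J
too, and the dominant eta span the space; so im (1 - w) is spanned by the roots
of J. *)
Lemma linked_rank x g w v (J : {set 'I_m}) :
  linked x g w v -> indep (X v) J -> hits (X v) J x -> \rank (D w) = #|J|.
Proof.
move=> [xi [v_dom lp rD supp]] ind [l' l'0 [l'J l'nJ]].
pose l i := if i \in J then l' i else 0.
pose c' := \sum_i l i *: alpha v i.
have c'Y : c' *m Y = \sum_(i in J) l' i *: (alpha v i *m Y).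
  rewrite /c' mulmx_suml [RHS]big_mkcond; apply: eq_bigr => i _.
  by rewrite /l; case: ifP => _; rewrite -?scalemxAl ?scale0r ?mul0mx.
set r' := (x - c' *m Y) *m Y^T.
have r'E i : dot r' (alpha v i) = dot (x - c' *m Y) (alpha v i *m Y).
  by rewrite /r' dot_mulmx trmxK.
rewrite -c'Y in l'J l'nJ.
have r'le i : dot r' (alpha v i) <= 0.
  by rewrite r'E; have [iJ|iJ] := boolP (i \in J); [rewrite l'J|rewrite ltW ?l'nJ].
have l_ge0 i : 0 <= l i by rewrite /l; case: ifP => // /l'0/ltW.
have r'c' : dot r' c' = 0.
  rewrite dot_sumr big1// => i _; rewrite dotZr r'E /l.
  by case: ifP => [/l'J->|_]; rewrite ?mulr0 ?mul0r.
have cY := lex_projection_image lp l_ge0 (erefl c') r'le r'c'.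
have [[k k0 kE] [_ rc _]] := lp.
have supportJ (q : 'I_m -> R) : (forall i, 0 <= q i) ->
    dot r' (\sum_i q i *: alpha v i) = 0 -> forall i, i \notin J -> q i = 0.
  move=> q0 /eqP; rewrite dot_sumr -oppr_eq0 -sumrN psumr_eq0 => [/allP z i iJ|i _].
    have := z i (mem_index_enum i); rewrite oppr_eq0 dotZr mulf_eq0 r'E.
    by rewrite (lt_eqF (l'nJ _ iJ)) orbF => /eqP.
  by rewrite oppr_ge0 dotZr mulr_ge0_le0.
rewrite cY -/r' in rc.
have kJ := supportJ k k0 (etrans (congr1 (fun q => dot r' q) (esym kE)) rc).
have kl i : i \in J -> k i = l i.
  move=> iJ; apply/eqP; rewrite -subr_eq0; apply/eqP.
  apply: (ind (fun i => k i - l i)) iJ.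
  have : (xi *m D w - c') *m Y = 0 by rewrite mulmxBl cY subrr.
  rewrite kE -sumrB mulmx_suml (bigID (mem J))/= [Z in _ + Z]big1 => [|b bJ].
    rewrite addr0 => zE; rewrite -[RHS]zE; apply: eq_bigr => b _.
    by rewrite -scalerBl -scalemxAl.
  by rewrite kJ// /l (negPf bJ) subrr mul0mx.
have aJ i : i \in J -> (alpha v i <= D w)%MS.
  by move=> iJ; apply: (supp k kE); rewrite kl// /l iJ gt_eqF ?l'0.
pose B := \matrix_(i < m) alpha v i.
have Bfree : row_free B.
  apply: inj_row_free => z; rewrite mulmx_sum_row => z0.
  apply/rowP => i; rewrite mxE; apply: (cs_free csM (v := v) (l := fun i => z 0 i)).
  by rewrite -[RHS]z0; apply: eq_bigr => j _; rewrite rowK.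
pose S := rowsub (fun a : 'I_#|J| => enum_val a) (1%:M : 'M[R]_m).
have Sfree : row_free S.
  apply/row_freeP; exists S^T; apply/matrixP => a b; rewrite !mxE.
  rewrite (bigD1 (enum_val a))//= big1 => [|i ia]; rewrite !mxE.
    by rewrite eqxx mul1r addr0 (inj_eq enum_val_inj) eq_sym.
  by rewrite eq_sym (negPf ia) mul0r.
have rowSB a : row a (S *m B) = alpha v (enum_val a).
  rewrite row_mul; apply/rowP => b; rewrite !mxE (bigD1 (enum_val a))//=.
  rewrite big1 => [|i ia]; rewrite !mxE; first by rewrite eqxx mul1r addr0.
  by rewrite eq_sym (negPf ia) mul0r.
have SBD : (S *m B :=: D w)%MS.
  apply/eqmxP/andP; split; apply/row_subP => a.
    by rewrite rowSB aJ// enum_valP.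
  have spanD eta : dom v eta -> (eta *m D w <= S *m B)%MS.
    move=> eta_dom; have [q q0 qE] := cs_descent csM w eta_dom.
    rewrite mulmx_defect qE.
    have qJ : forall i, i \notin J -> q i = 0.
      apply: supportJ => //; rewrite -qE -mulmx_defect dotC dot_mulmx.
      by rewrite /r' -cY rD dot0r.
    rewrite (bigID (mem J))/= [Z in _ + Z]big1 => [|i /qJ->]; last by rewrite scale0r.
    rewrite addr0; apply: summx_sub => i iJ; apply: scalemx_sub.
    by rewrite -(enum_rankK_in iJ iJ) -rowSB row_sub.
  have [e e0 de] := dominant_add (delta_mx 0 a) v_dom.
  have -> : row a (D w) = e^-1 *: ((xi + e *: delta_mx 0 a) *m D w - xi *m D w).
    by rewrite -mulmxBl [xi + _]addrC addrK -scalemxAl scalerA mulVf ?gt_eqF// scale1r rowE.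
  by rewrite scalemx_sub// addmx_sub ?eqmx_opp ?spanD.
by rewrite -SBD mxrankMfree//; apply/eqP.
Qed.

(** The solution xi0 is linear in (x, g). A root in im (1 - w) cannot annihilate it
identically: with the root itself as target the solution would be orthogonal to
the root, though it differs from the root by a vector fixed by w. So a generic x
with a small generic g avoids all walls of roots in im (1 - w). *)
Lemma generic_regular_target : generic (fun x : 'rV[R]_d =>
  exists g : 'rV[R]_n, forall w, exists2 xi0, two_level (D w) Y x g (xi0 *m D w) &
    forall v i, (alpha v i <= D w)%MS -> dot xi0 (alpha v i) != 0).
Proof.
have /choice[PQ PQP] w : exists PQ : 'M[R]_(d, n) * 'M[R]_n, forall x g,
    two_level (D w) Y x g ((x *m PQ.1 + g *m PQ.2) *m D w).
  by have [P [Q PQP]] := two_level_solvable (D w) Y; exists (P, Q).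
pose a w v i := alpha v i *m (PQ w).1^T; pose b w v i := alpha v i *m (PQ w).2^T.
have ab w v i : (alpha v i <= D w)%MS -> (a w v i != 0) || (b w v i != 0).
  move=> aD; rewrite -negb_and; apply/negP => /andP[/eqP a0 /eqP b0].
  set y := alpha v i in aD.
  have {}a0 : y *m (PQ w).1^T = 0 by exact: a0.
  have {}b0 : y *m (PQ w).2^T = 0 by exact: b0.
  have sol := PQP w (y *m D w *m Y) (y *m D w).
  have sol' : two_level (D w) Y (y *m D w *m Y) (y *m D w) (y *m D w).
    split; first by rewrite subrr !mul0mx.
    by exists 0; rewrite subrr mul0mx addr0 mul0mx.
  have := two_level_uniq sol sol'; set xi := _ + _ => xiD.
  have : dot (xi - y) y = 0.
    have [z zE] := submxP aD; rewrite [Z in dot _ Z]zE dotC dot_mulmx.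
    have -> : (xi - y) *m (D w)^T = 0; last by rewrite dot0r.
    by apply/(fixed_trP (cs_orth csM w)); rewrite mulmxBl xiD subrr.
  rewrite dotBl /xi dotDl (dot_mulmx _ (PQ w).1) (dot_mulmx _ (PQ w).2) a0 b0 !dot0r.
  rewrite add0r sub0r => /eqP; rewrite oppr_eq0 dot_eq0.
  by rewrite (negPf (alpha_neq0 v i)).
have gx : generic (fun x : 'rV[R]_d => forall p : Om * Om * 'I_m,
    a p.1.1 p.1.2 p.2 != 0 -> dot (a p.1.1 p.1.2 p.2) x != 0).
  by apply: generic_forall => p; apply: generic_impl; apply: generic_hyperplane.
apply: generic_sub gx => x xP.
have [g0 g0P] : exists g0 : 'rV[R]_n, forall p : Om * Om * 'I_m,
    b p.1.1 p.1.2 p.2 != 0 -> dot (b p.1.1 p.1.2 p.2) g0 != 0.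
  apply: generic_ex; apply: generic_forall => p; apply: generic_impl.
  exact: generic_hyperplane.
have [e e0 eP] := sg_perturb
  (fun p : Om * Om * 'I_m => dot x (a p.1.1 p.1.2 p.2))
  (fun p => dot g0 (b p.1.1 p.1.2 p.2)).
exists (e *: g0) => w; exists (x *m (PQ w).1 + (e *: g0) *m (PQ w).2) => //.
move=> v i aD; rewrite dotDl !dot_mulmx -/(a w v i) -/(b w v i) dotZl.
have [x0|x0] := eqVneq (dot x (a w v i)) 0; last first.
  by rewrite -sgr_eq0 (eP (w, v, i))// sgr_eq0.
have b0 : b w v i != 0.
  have [a0|a0] := eqVneq (a w v i) 0; last by have := xP (w, v, i) a0; rewrite dotC x0 eqxx.
  by have := ab w v i aD; rewrite a0 eqxx.
rewrite x0 add0r mulf_neq0//; first by rewrite gt_eqF.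
by rewrite dotC; apply: (g0P (w, v, i)).
Qed.

(** Linking w to v is injective, hence a bijection of the finite set of labels;
it matches the size of the face of the cone of v that x projects to with the
rank of 1 - w. *)
Lemma generic_face_count :
  (forall v (J : {set 'I_m}), (#|J| < d)%N -> indep (X v) J) ->
  generic (fun x => forall v, pos (X v) x \/
    exists2 J : {set 'I_m}, (#|J| < d)%N & hits (X v) J x) ->
  generic (fun x => forall j, (j < d)%N ->
    #|[pred v | `[< exists2 J : {set 'I_m}, #|J| = j & hits (X v) J x >] ]| =
    #|[pred w | \rank (D w) == j]|).
Proof.
move=> ind dich.
have low : generic (fun x : 'rV[R]_d => forall w, (\rank (D w) < d)%N ->
    ~~ (x <= D w *m Y)%MS).
  apply: generic_forall => w; apply: generic_impl => rD.
  by apply: generic_notin; apply: leq_ltn_trans rD; apply: mxrankM_maxl.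
apply: generic_sub (generic_and generic_regular_target (generic_and dich low)).
move=> x [[g gP] [{}dich {}low]] j jd.
have /choice[phi phiP] w : exists v, linked x g w v.
  by have [xi0 tl reg] := gP w; apply: linked_exists tl reg.
have phi_inj : injective phi.
  by move=> w w' eq; apply: (linked_inj (phiP w)); rewrite eq.
have rankE w : (\rank (D w) == j) =
    `[< exists2 J : {set 'I_m}, #|J| = j & hits (X (phi w)) J x >].
  apply/eqP/asboolP => [rj|[J Jj hJ]]; last first.
    rewrite -Jj; apply: (linked_rank (phiP w)) hJ.
    by apply: ind; rewrite Jj.
  have [[l l0 xE]|[J Jd hJ]] := dich (phi w); last first.
    by exists J => //; rewrite -rj (linked_rank (phiP w) (ind _ _ Jd) hJ).
  have [xi [_ lp _ _]] := phiP w.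
  have x_image : (\sum_i l i *: alpha (phi w) i) *m Y = x.
    by rewrite mulmx_suml xE; apply: eq_bigr => i _; rewrite scalemxAl.
  have := lex_projection_image lp l0 (erefl _).
  rewrite x_image subrr mul0mx => cY.
  have := low w; rewrite rj => /(_ jd)/negP[].
  rewrite -cY; first by rewrite -mulmxA submxMl.
    by move=> i; rewrite dot0l.
  by rewrite dot0l.
rewrite -(fintype.card_image phi_inj [pred w | \rank (D w) == j]).
apply: eq_card => v; rewrite inE; apply/idP/fintype.imageP => [vJ|[w wj ->]].
  have /codomP[w wE] : v \in codom phi by rewrite (inj_card_onto phi_inj).
  by exists w => //; rewrite inE rankE -wE.
by rewrite inE in wj; rewrite -rankE.
Qed.

End Bijection.

(** * Finitely generated cones *)

Section FinitelyGeneratedCones.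
Context {R : realType} {d : nat}.
Implicit Types (u v z p : 'rV[R]_d).

Lemma pos_gen m (x : 'I_m -> 'rV[R]_d) i : pos x (x i).
Proof.
exists (fun j => (j == i)%:R) => [j|]; first by rewrite ler0n.
rewrite (bigD1 i)//= eqxx scale1r big1 ?addr0// => j /negPf->.
by rewrite scale0r.
Qed.

Lemma pos_add m (x : 'I_m -> 'rV[R]_d) p q : pos x p -> pos x q -> pos x (p + q).
Proof.
move=> [l l0 ->] [k k0 ->]; exists (fun i => l i + k i) => [i|].
  by rewrite addr_ge0.
by rewrite -big_split; apply: eq_bigr => i _; rewrite scalerDl.
Qed.

Lemma pos_scale m (x : 'I_m -> 'rV[R]_d) a p : 0 <= a -> pos x p -> pos x (a *: p).
Proof.
move=> a0 [l l0 ->]; exists (fun i => a * l i) => [i|]; first by rewrite mulr_ge0.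
by rewrite scaler_sumr; apply: eq_bigr => i _; rewrite scalerA.
Qed.

Lemma pos_dot_ge0 m (x : 'I_m -> 'rV[R]_d) u p :
  (forall i, 0 <= dot u (x i)) -> pos x p -> 0 <= dot u p.
Proof.
move=> ux [l l0 ->]; rewrite dot_sumr sumr_ge0// => i _.
by rewrite dotZr mulr_ge0.
Qed.

(** Fourier-Motzkin elimination of the coefficient of one generator x0. *)
Definition eliminate (x0 : 'rV[R]_d) (s : seq 'rV[R]_d) : seq 'rV[R]_d :=
  [seq u <- s | 0 <= dot u x0] ++
  [seq dot u x0 *: w - dot w x0 *: u | u <- [seq u <- s | 0 < dot u x0],
     w <- [seq w <- s | dot w x0 < 0]].

Lemma eliminateP x0 s v :
  (exists2 t, 0 <= t & forall u, u \in s -> 0 <= dot u (v - t *: x0)) <->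
  (forall u, u \in eliminate x0 s -> 0 <= dot u v).
Proof.
split=> [[t t0 ts] u|elim_s].
  rewrite mem_cat mem_filter => /orP[/andP[ux /ts]|].
    by rewrite dotBr dotZr subr_ge0; apply: le_trans; rewrite mulr_ge0.
  move=> /allpairsP[[a b]]/=; rewrite !mem_filter.
  move=> [/andP[ax /ts ta] /andP[bx /ts tb] ->].
  move: ta tb; rewrite !dotBr !dotBl !dotZr !dotZl.
  by nra.
pose t := \big[Num.max/0]_(w <- [seq w <- s | dot w x0 < 0]) (dot w v / dot w x0).
have t_ge w : w \in s -> dot w x0 < 0 -> dot w v / dot w x0 <= t.
  move=> ws wx; rewrite /t.
  pose F u := dot u v / dot u x0; rewrite -[leLHS]/(F w).
  by apply: le_bigmax_seq => //; rewrite mem_filter wx.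
have t0 : 0 <= t by rewrite /t; elim/big_rec: _ => // w y _ y0; rewrite le_max y0 orbT.
have t_le b : 0 <= b -> (forall w, w \in s -> dot w x0 < 0 ->
    dot w v / dot w x0 <= b) -> t <= b.
  move=> b0 bw; rewrite /t big_filter big_seq_cond.
  elim/big_ind: _ => // [y z yb zb|w /andP[ws wx]]; first by rewrite ge_max yb zb.
  exact: bw.
exists t => // u us; rewrite dotBr dotZr subr_ge0.
have [ux|ux|ux] := ltgtP (dot u x0) 0.
- by rewrite -ler_ndivrMr// t_ge.
- rewrite -ler_pdivlMr// t_le//.
    by rewrite divr_ge0 ?(ltW ux)// elim_s// mem_cat mem_filter (ltW ux) us.
  move=> w ws wx; rewrite ler_pdivlMr// mulrAC ler_ndivrMr//.
  have := elim_s (dot u x0 *: w - dot w x0 *: u).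
  rewrite mem_cat; set b := (X in _ || X); have -> : b.
    by apply/allpairsP; exists (u, w); rewrite !mem_filter/= us ux ws wx.
  by rewrite orbT => /(_ isT); rewrite dotBl !dotZl; lra.
- by rewrite ux mulr0 elim_s// mem_cat mem_filter ux lexx us.
Qed.

Lemma pos_recl m (x : 'I_m.+1 -> 'rV[R]_d) v :
  pos x v <-> exists2 t, 0 <= t & pos (x \o lift ord0) (v - t *: x ord0).
Proof.
split=> [[l l0 ->]|[t t0 [l l0 vE]]].
  exists (l ord0) => //; exists (l \o lift ord0) => [i|]; first exact: l0.
  by rewrite big_ord_recl addrC addKr.
exists (fun i => if unlift ord0 i is Some j then l j else t) => [i|].
  by case: unliftP.
rewrite big_ord_recl unlift_none; under eq_bigr do rewrite liftK.
by rewrite -vE addrC subrK.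
Qed.

Lemma pos_halfspaces_seq m (x : 'I_m -> 'rV[R]_d) : exists s : seq 'rV[R]_d,
  forall v, pos x v <-> forall u, u \in s -> 0 <= dot u v.
Proof.
elim: m x => [|m IH] x.
  exists ([seq delta_mx 0 k | k <- enum 'I_d] ++
          [seq - delta_mx 0 k | k <- enum 'I_d]) => v; split.
    by move=> [l _ ->] u _; rewrite big_ord0 dot0r.
  move=> sv; exists (fun=> 0) => //; rewrite big_ord0; apply/rowP => k.
  rewrite mxE; apply/eqP; rewrite eq_le -oppr_ge0 -dot_delta dotC -dotNl.
  by rewrite !sv// mem_cat (map_f _ (mem_enum _ k)) ?orbT.
have [s sP] := IH (x \o lift ord0).
exists (eliminate (x ord0) s) => v; rewrite -eliminateP pos_recl.
by split=> -[t t0 h]; exists t => //; apply/sP.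
Qed.

(** Weyl's theorem, by eliminating the generators one after the other. *)
Lemma pos_halfspaces m (x : 'I_m -> 'rV[R]_d) :
  exists k (u : 'I_k -> 'rV[R]_d), (forall i, u i != 0) /\
    pos x = [set v | forall i, 0 <= dot (u i) v].
Proof.
have [s sP] := pos_halfspaces_seq x.
pose s' := [seq u <- s | u != 0].
exists (size s'), (tnth (in_tuple s')); split=> [i|].
  by have := mem_tnth i (in_tuple s'); rewrite mem_filter => /andP[].
apply/seteqP; split=> v /=.
  move/sP => sv i; apply: sv.
  by have := mem_tnth i (in_tuple s'); rewrite mem_filter => /andP[].
move=> sv; apply/sP => u us; have [->|u0] := eqVneq u 0; first by rewrite dot0l.
have /tnthP[i ->] : u \in in_tuple s' by rewrite mem_filter u0.
exact: sv.
Qed.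

Lemma farkas m (x : 'I_m -> 'rV[R]_d) v : ~ pos x v ->
  exists2 u, forall i, 0 <= dot u (x i) & dot u v < 0.
Proof.
have [s sP] := pos_halfspaces_seq x => nv.
have [u us uv] : exists2 u, u \in s & ~ 0 <= dot u v.
  by apply: contrapT => h; apply/nv/sP => u us; apply: contrapT => uv; apply: h; exists u.
exists u => [i|]; first by have /sP := pos_gen x i; apply.
by rewrite ltNge; apply/negP.
Qed.

Lemma supporting m (x : 'I_m -> 'rV[R]_d) : pos x <> setT ->
  exists2 u, u != 0 & forall i, 0 <= dot u (x i).
Proof.
move=> nT; have [v nv] : exists v, ~ pos x v.
  by apply: contrapT => h; apply: nT; apply/seteqP; split => // v _;
    apply: contrapT => nv; apply: h; exists v.
have [u ux uv] := farkas nv; exists u => //.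
by apply: contraTneq uv => ->; rewrite dot0l ltxx.
Qed.

Lemma pos_neqT m (x : 'I_m -> 'rV[R]_d) u : u != 0 ->
  (forall i, 0 <= dot u (x i)) -> pos x <> setT.
Proof.
move=> u0 ux xT; have : pos x (- u) by rewrite xT.
move=> /(pos_dot_ge0 ux); rewrite dotNr oppr_ge0 leNgt => /negP; apply.
by rewrite dot_gt0.
Qed.

End FinitelyGeneratedCones.

Section SpanProjection.
Context {R : realType} {d m : nat} (x : 'I_m -> 'rV[R]_d).

Lemma span_projection (J : {set 'I_m}) (z : 'rV[R]_d) : exists q : 'I_m -> R,
  forall i, i \in J -> dot (z - \sum_(i in J) q i *: x i) (x i) = 0.
Proof.
pose A : 'M[R]_(m, d) := \matrix_i (if i \in J then x i else 0).
have [L LP] := least_squares A; pose l := z *m L.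
exists (fun i => l 0 i) => i iJ.
have <- : l *m A = \sum_(i in J) l 0 i *: x i.
  rewrite mulmx_sum_row [RHS]big_mkcond; apply: eq_bigr => k _.
  by rewrite rowK; case: ifP => // _; rewrite scaler0.
have /mulmx_tr0P/(_ (delta_mx 0 i)) := LP z.
by rewrite -rowE rowK iJ.
Qed.

Lemma indep_sub (J K : {set 'I_m}) : J \subset K -> indep x K -> indep x J.
Proof.
move=> JK xK l lJ i iJ.
have := xK (fun i => if i \in J then l i else 0) _ i (fintype.subsetP JK _ iJ).
rewrite iJ; apply; rewrite -[RHS]lJ [LHS]big_mkcond [RHS]big_mkcond.
apply: eq_bigr => k _; have [kJ|kJ] := boolP (k \in J).
  by rewrite (fintype.subsetP JK _ kJ).
by rewrite scale0r; case: ifP.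
Qed.

(** Gram-Schmidt; the last clause keeps the residual within the span. *)
Lemma indep_residual (J : {set 'I_m}) i : i \in J -> indep x J ->
  exists2 b : 'rV[R]_d, b != 0 &
    (forall k, k \in J -> k != i -> dot b (x k) = 0) /\
    exists q : 'I_m -> R, b = x i - \sum_(k in J :\ i) q k *: x k.
Proof.
move=> iJ xJ; have [q qP] := span_projection (J :\ i) (x i).
exists (x i - \sum_(k in J :\ i) q k *: x k); last first.
  by split=> [k kJ ki|]; [rewrite qP// !inE ki|exists q].
apply/eqP => b0; suff : (1 : R) = 0 by apply/eqP; rewrite oner_eq0.
have := xJ (fun k => if k == i then 1 else - q k) _ i iJ; rewrite eqxx; apply.
rewrite (big_setD1 i iJ)/= eqxx scale1r -[RHS]b0; congr (_ + _).
rewrite -sumrN; apply: eq_bigr => k; rewrite !inE => /andP[/negPf-> _].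
by rewrite scaleNr.
Qed.

Lemma indep_dual (J : {set 'I_m}) i : i \in J -> indep x J ->
  exists b : 'rV[R]_d, (forall k, k \in J -> dot b (x k) = (k == i)%:R) /\
    exists q : 'I_m -> R, b = \sum_(k in J) q k *: x k.
Proof.
move=> iJ xJ; have [b b0 [borth [q bE]]] := indep_residual iJ xJ.
have bi : dot b (x i) = dot b b.
  rewrite [Z in _ = dot b Z]bE dotBr dot_sumr big1 ?subr0//.
  by move=> k; rewrite !inE => /andP[ki kJ]; rewrite dotZr borth ?mulr0.
exists ((dot b b)^-1 *: b); split=> [k kJ|].
  rewrite dotZl; case: eqVneq => [->|ki]; last by rewrite borth ?mulr0.
  by rewrite bi mulVf// dot_eq0.
exists (fun k => (dot b b)^-1 * (if k == i then 1 else - q k)).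
rewrite (big_setD1 i iJ)/= eqxx mulr1 bE scalerBr; congr (_ + _).
rewrite scaler_sumr -sumrN; apply: eq_bigr => k; rewrite !inE => /andP[/negPf-> _].
by rewrite mulrN scaleNr scalerA.
Qed.

Lemma indep_coordinates (J : {set 'I_m}) : indep x J ->
  exists b : 'I_m -> 'rV[R]_d,
    (forall (l : 'I_m -> R) i, i \in J -> dot (b i) (\sum_(k in J) l k *: x k) = l i) /\
    forall i, i \in J -> exists q : 'I_m -> R, b i = \sum_(k in J) q k *: x k.
Proof.
move=> xJ; have /choice[b bP] (i : 'I_m) : exists b : 'rV[R]_d, i \in J ->
    (forall k, k \in J -> dot b (x k) = (k == i)%:R) /\
    exists q : 'I_m -> R, b = \sum_(k in J) q k *: x k.
  have [iJ|_] := boolP (i \in J); last by exists 0.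
  by have [b [bJ bq]] := indep_dual iJ xJ; exists b.
exists b; split=> [l i iJ|i /bP[]//]; have [bi _] := bP i iJ.
rewrite dot_sumr (big_setD1 i iJ)/= dotZr bi// eqxx mulr1.
rewrite big1 ?addr0// => k; rewrite !inE => /andP[/negPf ki kJ].
by rewrite dotZr bi// ki mulr0.
Qed.

End SpanProjection.

Section NearestPoint.
Context {R : realType} {d m : nat} (x : 'I_m -> 'rV[R]_d).
Implicit Types (p z y : 'rV[R]_d).

(** Moreau's characterisation of the nearest point of a cone. *)
Definition is_projection z p := [/\ pos x p,
  forall i, dot (z - p) (x i) <= 0 & dot (z - p) p = 0].

Lemma is_projection_nearest z p y : is_projection z p -> pos x y ->
  dot (z - p) (z - p) + dot (y - p) (y - p) <= dot (z - y) (z - y).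
Proof.
move=> [px xp pp] xy.
have zy : dot (z - p) y <= 0.
  have [l l0 ->] := xy; rewrite dot_sumr sumr_le0// => i _.
  by rewrite dotZr mulr_ge0_le0.
have -> : z - y = (z - p) - (y - p).
  by apply/rowP => k; rewrite !mxE; ring.
rewrite [leRHS]dotB_expand (dotBr (z - p) y p) pp subr0 lerD2r.
lra.
Qed.

Lemma is_projection_uniq z p q : is_projection z p -> is_projection z q -> p = q.
Proof.
move=> zp zq; apply/eqP; rewrite -subr_eq0 -dot_eq0 eq_le dot_ge0 andbT.
have [xp _ _] := zp; have [xq _ _] := zq.
have := is_projection_nearest zp xq; have := is_projection_nearest zq xp.
have := dot_ge0 (q - p); lra.
Qed.

(** Moving from a point of the cone towards the projection to the span of its
generators decreases the distance to z until a coefficient vanishes, so some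
face span already realises the minimum. *)
Lemma nearest_candidate z : exists2 p, pos x p &
  forall y, pos x y -> dot (z - p) (z - p) <= dot (z - y) (z - y).
Proof.
have /choice[q qP] (J : {set 'I_m}) : exists q : 'I_m -> R,
    forall i, i \in J -> dot (z - \sum_(i in J) q i *: x i) (x i) = 0.
  exact: span_projection.
pose p (J : {set 'I_m}) := \sum_(i in J) q J i *: x i.
pose good (J : {set 'I_m}) := [forall (i | i \in J), 0 <= q J i].
have good_pos J : good J -> pos x (p J).
  move=> /'forall_implyP gJ; exists (fun i => if i \in J then q J i else 0) => [i|].
    by case: ifP => // /gJ.
  rewrite /p big_mkcond; apply: eq_bigr => i _.
  by case: ifP => //; rewrite scale0r.
have near k (l : 'I_m -> R) : (forall i, 0 <= l i) ->
    (#|[set i | l i != 0%R]%SET| <= k)%N ->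
    exists2 J, good J & dot (z - p J) (z - p J) <=
      dot (z - \sum_i l i *: x i) (z - \sum_i l i *: x i).
  elim: k l => [|k IH] l l0 lk.
    exists finset.set0; first by apply/'forall_implyP => i; rewrite inE.
    rewrite /p big_set0 [in leRHS]big1// => i _.
    move: lk; rewrite leqn0 cards_eq0 => /eqP/setP/(_ i).
    by rewrite !inE => /negbFE/eqP->; rewrite scale0r.
  set J := [set i | l i != 0%R]%SET in lk.
  set y := \sum_i _; have yE : y = \sum_(i in J) l i *: x i.
    rewrite /y [RHS]big_mkcond; apply: eq_bigr => i _; rewrite inE.
    by case: eqVneq => //= ->; rewrite scale0r.
  have pyth t : dot (z - (y + t *: (p J - y))) (z - (y + t *: (p J - y))) =
      dot (z - p J) (z - p J) + (1 - t) ^+ 2 * dot (p J - y) (p J - y).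
    have -> : z - (y + t *: (p J - y)) = (z - p J) - ((t - 1) *: (p J - y)).
      by apply/rowP => i; rewrite !mxE; ring.
    rewrite dotB_expand dotZr dotZl dotZr.
    have -> : dot (z - p J) (p J - y) = 0.
      rewrite yE -sumrB dot_sumr big1// => i iJ.
      by rewrite -scalerBl dotZr qP// mulr0.
    ring.
  have [gJ|] := boolP (good J).
    exists J => //; have := pyth 0; rewrite scale0r addr0 => ->.
    by rewrite lerDl mulr_ge0 ?sqr_ge0 ?dot_ge0.
  rewrite negb_forall => /existsP[i1]; rewrite negb_imply => /andP[i1J q1].
  pose rho i := l i / (l i - q J i).
  have i1P : (i1 \in J) && (q J i1 < 0) by rewrite i1J ltNge.
  have [i0 /andP[i0J q0] i0min] := @arg_minP _ _ _ i1 
    (fun i => (i \in J) && (q J i < 0)) rho i1P.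
  have li0 i : i \in J -> 0 < l i by rewrite inE lt_def l0 andbT.
  pose t := rho i0.
  have den i : i \in J -> q J i < 0 -> 0 < l i - q J i.
    by move=> iJ qi; rewrite subr_gt0 (lt_trans qi)// li0.
  have t0 : 0 <= t by rewrite divr_ge0// ltW ?den.
  have t1 : t <= 1 by rewrite ler_pdivrMr ?den// mul1r lerBrDr gerDl ltW.
  pose l' i := if i \in J then l i + t * (q J i - l i) else 0.
  have l'0 i : 0 <= l' i.
    rewrite /l'; case: ifP => // iJ; have [qi|qi] := leP 0 (q J i).
      have := li0 _ iJ; nra.
    have := i0min i; rewrite iJ qi => /(_ isT).
    rewrite -/t /rho ler_pdivlMr ?den//; lra.
  have y'E : \sum_i l' i *: x i = y + t *: (p J - y).
    rewrite yE /p -sumrB scaler_sumr -big_split [RHS]big_mkcond/=.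
    apply: eq_bigr => i _; rewrite /l'; case: ifP; rewrite ?scale0r// => _.
    by rewrite scalerDl -scalerBl scalerA.
  have [|J' gJ' le'] := IH l' l'0.
    have : [set i | l' i != 0%R]%SET \proper J.
      apply/properP; split.
        by apply/fintype.subsetP => i; rewrite inE /l'; case: ifP; rewrite ?eqxx.
      exists i0 => //; rewrite inE /l' i0J negbK /t /rho.
      have := den i0 i0J q0 => /lt0r_neq0 dn; apply/eqP; field.
      exact: dn.
    by move/proper_card => lt; rewrite -ltnS (leq_trans lt).
  exists J' => //; apply: le_trans le' _; rewrite y'E pyth.
  have := pyth 0; rewrite scale0r addr0 => ->; rewrite lerD2l.
  by rewrite ler_wpM2r ?dot_ge0// subr0 expr1n expr_le1// ?subr_ge0// gerBl.
have g0 : good finset.set0 by apply/'forall_implyP => i; rewrite inE.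
have [J gJ Jmin] := @arg_minP _ _ _ (finset.set0 : {set 'I_m}) good
  (fun J => dot (z - p J) (z - p J)) g0.
exists (p J); first exact: good_pos.
move=> y [l l0 ->]; have [J' gJ' le'] := near _ l l0 (leqnn _).
exact: le_trans (Jmin _ gJ') le'.
Qed.

Lemma projection_exists z : exists p, is_projection z p.
Proof.
have [p xp pmin] := nearest_candidate z; exists p.
have neg y e : 0 < e -> (forall t, 0 < t <= e -> pos x (p + t *: y)) ->
    dot (z - p) y <= 0.
  move=> e0 te; rewrite leNgt; apply/negP => zy.
  set a := dot (z - p) y in zy; set b := dot y y.
  have b0 : 0 <= b := dot_ge0 y.
  pose t := Num.min e (a / (b + 1)).
  have t0 : 0 < t by rewrite lt_min e0 divr_gt0 ?ltr_wpDl.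
  have := pmin _ (te t _); rewrite t0 ge_min lexx => /(_ isT).
  have -> : z - (p + t *: y) = (z - p) - t *: y by rewrite opprD addrA.
  rewrite [leRHS]dotB_expand !dotZr dotZl -/a -/b.
  have tb : t * (b + 1) <= a by rewrite -ler_pdivlMr ?ltr_wpDl// ge_min lexx orbT.
  by nra.
split=> // [i|].
  apply: (neg _ 1) => // t /andP[t0 _]; apply: pos_add => //.
  by apply: pos_scale (pos_gen _ _); rewrite ltW.
apply/eqP; rewrite eq_le; apply/andP; split.
  apply: (neg _ 1) => // t /andP[t0 _]; apply: pos_add => //.
  by apply: pos_scale; rewrite ?ltW.
rewrite -oppr_le0 -dotNr; apply: (neg _ 1) => // t /andP[t0 t1].
rewrite scalerN -[X in X - _]scale1r -scalerBl.
by apply: pos_scale; rewrite ?subr_ge0.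
Qed.

Lemma cone_projP z : is_projection z (cone_proj (pos x) z).
Proof.
have [p zp] := projection_exists z; have [xp _ _] := zp.
suff -> : cone_proj (pos x) z = p by [].
apply: get_unique => [|y [xy ymin]].
  split=> // y xy; rewrite /enorm ler_wsqrtr//.
  by have := is_projection_nearest zp xy; have := dot_ge0 (y - p); lra.
have := ymin p xp; rewrite /enorm ler_sqrt ?dot_ge0// => le.
apply/eqP; rewrite -subr_eq0 -dot_eq0 eq_le dot_ge0 andbT.
by have := is_projection_nearest zp xy; lra.
Qed.

Lemma cone_proj_eq z p : is_projection z p -> cone_proj (pos x) z = p.
Proof. exact/is_projection_uniq/cone_projP. Qed.

End NearestPoint.

(** * Faces of cones in general position *)

Section Neighbourhoods.
Context {R : realType} {d : nat}.
Implicit Types (v w b : 'rV[R]_d).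

Lemma nbhs_ray (A : set 'rV[R]_d) v w : nbhs v A -> exists2 t, 0 < t & A (v + t *: w).
Proof.
case/nbhs_ballP => e /= e0 eA.
have [t t0 tP] : exists2 t, 0 < t & forall k, t * `|w 0 k| < e.
  have B0 : 0 < 1 + \sum_k `|w 0 k| by rewrite ltr_wpDr// sumr_ge0.
  exists (e / (1 + \sum_k `|w 0 k|)); first by rewrite divr_gt0.
  move=> k; rewrite mulrAC ltr_pdivrMr// ltr_pM2l// (bigD1 k)//= addrCA.
  by rewrite ltrDl ltr_wpDr// sumr_ge0.
exists t => //; apply: eA; split=> // i k; rewrite ord1 !mxE /ball/= opprD addNKr.
by rewrite normrN normrM gtr0_norm.
Qed.

Lemma nbhs_halfspace b v : 0 < dot b v -> nbhs v [set y | 0 < dot b y].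
Proof.
move=> bv; apply/nbhs_ballP.
have B0 : 0 < 1 + \sum_k `|b 0 k| by rewrite ltr_wpDr// sumr_ge0.
exists (dot b v / (1 + \sum_k `|b 0 k|)) => /=; first by rewrite divr_gt0.
move=> y vy /=; set e := _ / _ in vy.
have yk k : `|v 0 k - y 0 k| <= e by have := vy.2 0 k; rewrite /ball/= => /ltW.
have -> : dot b y = dot b v - dot b (v - y) by rewrite dotBr; ring.
rewrite subr_gt0; apply: (@le_lt_trans _ _ (\sum_k `|b 0 k| * e)).
  rewrite /dot; apply: ler_sum => k _; apply: le_trans (ler_norm _) _.
  by rewrite normrM ler_wpM2l// !mxE yk.
rewrite -mulr_suml /e mulrCA gtr_pMr// ltr_pdivrMr// mul1r ltrDr.
by rewrite ltr01.
Qed.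

End Neighbourhoods.

Section Faces.
Context {R : realType} {d m : nat} (x : 'I_m -> 'rV[R]_d).
Implicit Types (v w z p : 'rV[R]_d) (J K : {set 'I_m}).

Definition subcone J : set 'rV[R]_d :=
  [set v | exists2 l : 'I_m -> R, forall i, i \in J -> 0 <= l i &
    v = \sum_(i in J) l i *: x i].

(** J is the full set of generators on a face, so that subcone J is that face and
determines J. *)
Definition exposed J := exists w, (forall i, i \in J -> dot w (x i) = 0) /\
  (forall i, i \notin J -> 0 < dot w (x i)).

Lemma subcone_pos J v : subcone J v -> pos x v.
Proof.
move=> [l l0 ->]; exists (fun i => if i \in J then l i else 0) => [i|].
  by case: ifP => // /l0.
by rewrite [LHS]big_mkcond; apply: eq_bigr => i _; case: ifP; rewrite ?scale0r.
Qed.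

Lemma pos_annihilated w v : (forall i, 0 <= dot w (x i)) ->
  (pos x v /\ dot w v = 0) <-> subcone [set i | dot w (x i) == 0]%SET v.
Proof.
move=> w0; split=> [[[l l0 vE] wv]|v_in]; last first.
  split; first exact: subcone_pos v_in.
  have [l _ ->] := v_in; rewrite dot_sumr big1// => i; rewrite inE => /eqP wi.
  by rewrite dotZr wi mulr0.
exists l => //; rewrite vE [RHS]big_mkcond; apply: eq_bigr => i _; rewrite inE.
case: eqVneq => // wi; move/eqP: wv; rewrite vE dot_sumr psumr_eq0 => [/allP z|k _].
  have := z i (mem_index_enum i); rewrite dotZr mulf_eq0 (negPf wi) orbF.
  by move=> /eqP->; rewrite scale0r.
by rewrite dotZr mulr_ge0.
Qed.

(** A face is cut out by the sum w of the functionals that vanish on it. *)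
Lemma is_face_subcone F : is_face (pos x) F ->
  exists2 w, forall i, 0 <= dot w (x i) &
    F = subcone [set i | dot w (x i) == 0]%SET.
Proof.
move=> [k [u [J [_ posE ->]]]].
have posP v : pos x v <-> forall i, 0 <= dot (u i) v by rewrite posE.
pose w := \sum_(i in J) u i.
have w0 i : 0 <= dot w (x i).
  by rewrite dot_suml sumr_ge0// => j _; have /posP := pos_gen x i; apply.
exists w => //; apply/seteqP; split=> v /=.
  move=> vF; apply/(pos_annihilated _ w0); split.
    by apply/posP => i; have := vF i; case: ifP => // _ ->.
  by rewrite dot_suml big1// => i iJ; have := vF i; rewrite iJ.
move/(pos_annihilated _ w0) => [/posP vpos /eqP].
rewrite dot_suml psumr_eq0 => [/allP z i|//].
case: ifP => // iJ; apply/eqP.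
by have := z i (mem_index_enum i); rewrite iJ.
Qed.

Lemma subcone_is_face w : w != 0 -> (forall i, 0 <= dot w (x i)) ->
  is_face (pos x) (subcone [set i | dot w (x i) == 0]%SET).
Proof.
move=> wn0 w0; have [k [u [un0 posE]]] := pos_halfspaces x.
have posP v : pos x v <-> forall i, 0 <= dot (u i) v by rewrite posE.
pose u' (i : 'I_k.+1) := if unlift ord0 i is Some j then u j else w.
have u'0 : u' ord0 = w by rewrite /u' unlift_none.
have u'S j : u' (lift ord0 j) = u j by rewrite /u' liftK.
have posP' v : pos x v <-> forall i, 0 <= dot (u' i) v.
  split=> [xv i|h]; last by apply/posP => i; rewrite -u'S.
  case: (unliftP ord0 i) => [j ->|->]; first by rewrite u'S; have /posP := xv; apply.
  by rewrite u'0 (pos_dot_ge0 w0).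
exists k.+1, u', [set ord0]%SET; split.
- by move=> i; case: (unliftP ord0 i) => [j ->|->]; rewrite ?u'S ?u'0.
- by apply/seteqP; split=> v /= /posP'.
apply/seteqP; split=> v /=.
  move/(pos_annihilated _ w0) => [/posP' vpos wv] i; rewrite inE.
  by case: eqP => [->|//]; rewrite u'0.
move=> vF; apply/(pos_annihilated _ w0); split.
  by apply/posP' => i; have := vF i; case: ifP => // _ ->.
by have := vF ord0; rewrite inE eqxx u'0.
Qed.

Lemma pos_is_face : is_face (pos x) (pos x).
Proof.
have [k [u [un0 posE]]] := pos_halfspaces x.
exists k, u, finset.set0; split => //; rewrite posE.
by apply/seteqP; split=> v h i; have := h i; rewrite inE.
Qed.

Lemma exposed_subcone_gen J i : exposed J -> subcone J (x i) -> i \in J.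
Proof.
move=> [w [wJ wnJ]] [l _ xE]; apply/negPn/negP => /wnJ.
rewrite xE dot_sumr big1 ?ltxx// => k kJ.
by rewrite dotZr wJ// mulr0.
Qed.

Lemma subcone_gen J i : i \in J -> subcone J (x i).
Proof.
move=> iJ; exists (fun j => (j == i)%:R) => [j _|]; first by rewrite ler0n.
rewrite (big_setD1 i iJ)/= eqxx scale1r big1 ?addr0// => j.
by rewrite !inE => /andP[/negPf-> _]; rewrite scale0r.
Qed.

Lemma subcone_inj J K : exposed J -> exposed K -> subcone J = subcone K -> J = K.
Proof.
move=> eJ eK JK; apply/setP => i; apply/idP/idP => /subcone_gen.
  by rewrite JK; apply: exposed_subcone_gen.
by rewrite -JK; apply: exposed_subcone_gen.
Qed.

Local Notation spanJ J := <<[seq x i | i in J]>>%VS.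

Lemma mem_span_seq (s : seq 'I_m) v : uniq s -> v \in <<[seq x i | i <- s]>>%VS ->
  exists l : 'I_m -> R, v = \sum_(i <- s) l i *: x i.
Proof.
elim: s v => [|i s IH] v /=.
  by rewrite span_nil memv0 => _ /eqP->; exists (fun=> 0); rewrite big_nil.
move=> /andP[ins us]; rewrite span_cons => /memv_addP[_ /vlineP[a ->]].
move=> [v' /(IH _ us)[l ->] ->].
exists (fun j => if j == i then a else l j); rewrite big_cons eqxx; congr (_ + _).
by apply: eq_big_seq => j js; case: eqVneq => // ji; rewrite -ji js in ins.
Qed.

Lemma mem_spanP J v :
  v \in spanJ J <-> exists l : 'I_m -> R, v = \sum_(i in J) l i *: x i.
Proof.
split=> [/(mem_span_seq (enum_uniq J))[l ->]|[l ->]].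
  by exists l; rewrite big_enum.
by apply: memv_suml => i iJ; rewrite memvZ// memv_span// fintype.image_f.
Qed.

Lemma linhull_subcone J : linhull (subcone J) = [set` spanJ J].
Proof.
apply/seteqP; split.
  apply: smallest_sub; first by exists (spanJ J).
  by move=> v [l _ ->]; apply/mem_spanP; exists l.
move=> v /= /mem_spanP[l ->] A [[V ->] sub].
apply: memv_suml => i iJ; rewrite memvZ//.
exact/sub/subcone_gen.
Qed.

Lemma has_dim_subcone J j : has_dim (subcone J) j <-> \dim (spanJ J) = j.
Proof.
rewrite /has_dim linhull_subcone; split=> [[V VE <-]|]; last by exists (spanJ J).
congr (\dim _); apply/vspaceP => v.
have h : is_true (v \in spanJ J) = is_true (v \in V) := congr1 (@^~ v) VE.
by apply/idP/idP; rewrite h.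
Qed.

Lemma sum_enum (J : {set 'I_m}) i0 (F : 'I_m -> 'rV[R]_d) N : N = size (enum J) ->
  \sum_(i in J) F i = \sum_(k < N) F (nth i0 (enum J) k).
Proof.
by move=> ->; rewrite -[LHS]big_enum [LHS](big_nth i0) [LHS]big_mkord.
Qed.

Lemma free_indep J : free [seq x i | i in J] <-> indep x J.
Proof.
split=> [fJ l l0 i iJ|xJ].
  have := fJ; rewrite -[[seq x i | i in J]]/(tval (in_tuple _)).
  move=> /freeP/(_ (fun k => l (nth i (enum J) k))).
  have sz : size [seq x i | i in J] = size (enum J) by rewrite size_map.
  have big0 : \sum_(k < size [seq x i | i in J])
      l (nth i (enum J) k) *: (in_tuple [seq x i | i in J])`_k = 0.
    rewrite -[RHS]l0 (sum_enum i _ sz).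
    by apply: eq_bigr => k _; rewrite /= (nth_map i)// -sz.
  move=> /(_ big0); have iJ' : (index i (enum J) < size [seq x i | i in J])%N.
    by rewrite sz index_mem mem_enum.
  by move=> /(_ (Ordinal iJ')) /=; rewrite nth_index// mem_enum.
rewrite -[[seq x i | i in J]]/(tval (in_tuple _)).
apply/freeP => k k0 a.
have sz : size [seq x i | i in J] = size (enum J) by rewrite size_map.
have a_lt : (a < size (enum J))%N by rewrite -sz.
have [i0 _] : exists i0 : 'I_m, true.
  by case: (enum J) a_lt => // i0 s _; exists i0.
pose l (i : 'I_m) := if insub (index i (enum J)) is Some b then k b else 0.
have lE (b : 'I_(size [seq x i | i in J])) : l (nth i0 (enum J) b) = k b.
  have b_lt : (b < size (enum J))%N by rewrite -sz.
  by rewrite /l index_uniq ?enum_uniq// valK.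
rewrite -lE; apply: xJ; last by rewrite -mem_enum mem_nth.
rewrite (sum_enum i0 _ sz) -[RHS]k0.
apply: eq_bigr => b _; rewrite lE; congr (_ *: _).
by rewrite /= (nth_map i0)// -sz.
Qed.

End Faces.

Section GeneralPosition.
Context {R : realType} {d m : nat} (x : 'I_m -> 'rV[R]_d).
Implicit Types (v w z p : 'rV[R]_d) (J K : {set 'I_m}).
Hypothesis dm : (d <= m)%N.
Hypothesis gp : forall J, #|J| = d -> indep x J.

Lemma exists_notin J : (#|J| < m)%N -> exists i, i \notin J.
Proof.
move=> Jm; apply: contrapT => nex; move: Jm.
suff -> : J = [set: 'I_m]%SET by rewrite cardsT card_ord ltnn.
by apply/setP => i; rewrite inE; apply/negPn/negP => iJ; apply: nex; exists i.
Qed.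

Lemma set_extension J : (#|J| <= d)%N -> exists2 K : {set 'I_m}, J \subset K & #|K| = d.
Proof.
move=> Jd; move: {-1}(d - #|J|)%N (erefl (d - #|J|)%N) => k; elim: k J Jd => [|k IH] J Jd.
  by move/eqP; rewrite subn_eq0 => dJ; exists J => //; apply/eqP; rewrite eqn_leq Jd.
move=> kE; have Jlt : (#|J| < d)%N by rewrite -subn_gt0 kE.
  have [i iJ] : exists i, i \notin J by apply: exists_notin; apply: leq_trans dm.
have [||K JK Kd] := IH (i |: J)%SET.
- by rewrite cardsU1 iJ.
- by rewrite cardsU1 iJ add1n subnS kE.
by exists K => //; apply: fintype.subset_trans JK; apply: finset.subsetUr.
Qed.

Lemma gp_indep J : (#|J| <= d)%N -> indep x J.
Proof. by move=> /set_extension[K JK /gp]; apply: indep_sub. Qed.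

Local Notation spanJ J := <<[seq x i | i in J]>>%VS.

Lemma dim_small J : (#|J| <= d)%N -> \dim (spanJ J) = #|J|.
Proof.
by move=> /gp_indep/free_indep; rewrite /free => /eqP->; rewrite size_image.
Qed.

Lemma span_full J : (d <= #|J|)%N -> spanJ J = fullv.
Proof.
move=> dJ; apply/eqP; rewrite eqEdim subvf dimvf /dim/= mul1n.
have [K KJ Kd] : exists2 K : {set 'I_m}, K \subset J & #|K| = d.
  have [s sJ ds] : exists2 s, s = take d (enum J) & size s = d.
    by exists (take d (enum J)) => //; rewrite size_takel// -cardE.
  exists [set i in s]%SET.
    apply/fintype.subsetP => i; rewrite inE sJ => /mem_take.
    by rewrite mem_enum.
  by rewrite cardsE -ds; apply/card_uniqP; rewrite sJ take_uniq ?enum_uniq.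
rewrite -{1}Kd -(dim_small (J := K)) ?Kd//; apply: dimvS; apply: sub_span.
move=> _ /fintype.imageP[i iK ->]; apply: fintype.image_f; exact: (fintype.subsetP KJ).
Qed.

Lemma orthogonal_eq0 J u : (d <= #|J|)%N ->
  (forall i, i \in J -> dot u (x i) = 0) -> u = 0.
Proof.
move=> dJ uJ; apply: dot_eq0P.
have /mem_spanP[l uE] : u \in spanJ J by rewrite span_full// memvf.
by rewrite {2}uE dot_sumr big1// => i iJ; rewrite dotZr uJ// mulr0.
Qed.

(** A functional vanishing on d generators is zero, so a proper face contains fewer
than d generators; these are independent and determine its dimension. *)
Lemma faces_low j : (j < d)%N -> faces j (pos x) =
  subcone x @` [set J : {set 'I_m} | #|J| = j /\ exposed x J].
Proof.
move=> jd; apply/seteqP; split=> F /=.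
  move=> [/is_face_subcone[w w0 ->] /has_dim_subcone].
  set J := [set i | _]%SET => dimJ; exists J => //.
  have Jd : (#|J| < d)%N.
    rewrite ltnNge; apply/negP => dJ; move: dimJ; rewrite span_full// dimvf /dim/= mul1n.
    by move=> dj; rewrite -dj ltnn in jd.
  split; first by rewrite -dimJ dim_small// ltnW.
  exists w; split=> i; rewrite inE; [by move/eqP|move=> wi].
  by rewrite lt_def wi w0.
move=> [J [Jj [w [wJ wnJ]]] <-].
have Jd : (#|J| < d)%N by rewrite Jj.
have JE : J = [set i | dot w (x i) == 0]%SET.
  apply/setP => i; rewrite inE; have [iJ|iJ] := boolP (i \in J).
    by rewrite wJ// eqxx.
  by rewrite gt_eqF// wnJ.
split; last by apply/has_dim_subcone; rewrite dim_small// ltnW.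
rewrite JE; apply: subcone_is_face => [|i]; last first.
  by have [/wJ->//|/wnJ/ltW] := boolP (i \in J).
apply/eqP => w0; have [i iJ] : exists i, i \notin J by apply: exists_notin; apply: leq_trans dm.
by have := wnJ i iJ; rewrite w0 dot0l ltxx.
Qed.

Lemma pos_subconeT : pos x = subcone x [set: 'I_m]%SET.
Proof.
apply/seteqP; split=> v [l l0 ->]; exists l => //.
- by apply: eq_bigl => i; rewrite inE.
- by move=> i; apply: l0; rewrite inE.
- by apply: eq_bigl => i; rewrite inE.
Qed.

Lemma faces_top : faces d (pos x) = [set pos x].
Proof.
have dimT : \dim (spanJ [set: 'I_m]%SET) = d.
  by rewrite span_full ?dimvf /dim/= ?mul1n// cardsT card_ord.
apply/seteqP; split=> F /= => [|->]; last first.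
  split; first exact: pos_is_face.
  by rewrite pos_subconeT; apply/has_dim_subcone.
move=> [/is_face_subcone[w w0 ->] /has_dim_subcone].
set J := [set i | _]%SET => dimJ.
have dJ : (d <= #|J|)%N.
  rewrite leqNgt; apply/negP => Jd.
  by move: (Jd); rewrite -(dim_small (ltnW Jd)) dimJ ltnn.
have wz : w = 0.
  by apply: (orthogonal_eq0 dJ) => i; rewrite inE => /eqP.
rewrite pos_subconeT; congr subcone; apply/setP => i.
by rewrite !inE wz dot0l eqxx.
Qed.

(** Independence makes the coefficients coordinates on the linear hull, so interior
points are those whose coordinates are all positive. *)
Lemma relint_subcone J v : indep x J -> relint (subcone x J) v <->
  exists2 l : 'I_m -> R, forall i, i \in J -> 0 < l i & v = \sum_(i in J) l i *: x i.
Proof.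
move=> xJ; rewrite /relint linhull_subcone; split=> [[[l l0 vE] wit]|[l l0 vE]].
  exists l => // i iJ; rewrite lt_def l0// andbT; apply/eqP => li0.
  have [t t0] := nbhs_ray (- x i) wit.
  have vh : [set` spanJ J] (v + t *: - x i).
    rewrite /=; apply/mem_spanP; exists (fun k => l k - t * (k == i)%:R).
    rewrite vE (big_setD1 i iJ)/= [in RHS](big_setD1 i iJ)/= eqxx mulr1.
    rewrite scalerBl scalerN addrAC; congr (_ + _).
    by apply: eq_bigr => k; rewrite !inE => /andP[/negPf-> _]; rewrite mulr0 subr0.
  move=> /(_ vh)[k k0 kE].
  have := xJ (fun a => k a - (l a - t * (a == i)%:R)) _ i iJ.
  rewrite eqxx mulr1 li0 sub0r opprK => h.
  have := k0 i iJ; suff : k i + t = 0 by lra.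
  apply: h; under eq_bigr do rewrite scalerBl; rewrite sumrB -kE vE.
  rewrite scalerN; apply/eqP; rewrite subr_eq0; apply/eqP.
  rewrite (big_setD1 i iJ)/= [in RHS](big_setD1 i iJ)/= eqxx mulr1.
  rewrite scalerBl addrAC; congr (_ + _).
  by apply: eq_bigr => a; rewrite !inE => /andP[/negPf-> _]; rewrite mulr0 subr0.
split; first by exists l => // i /l0/ltW.
have [b [coef _]] := indep_coordinates xJ.
have : nbhs v [set y | forall i : 'I_m, i \in J -> 0 < dot (b i) y].
  apply: (@filter_forall _ _ (fun i => [set y | i \in J -> 0 < dot (b i) y])
    _ (nbhs_filter v)).
  move=> i; have [iJ|iJ] := boolP (i \in J); last first.
    by apply: filterE => y //.
  have : nbhs v [set y | 0 < dot (b i) y].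
    by apply: nbhs_halfspace; rewrite vE coef// l0.
  by apply: filterS => y yb _.
apply: filterS => y yb /= /mem_spanP[k yE]; exists k => // i iJ.
by have := yb i iJ; rewrite yE coef// => /ltW.
Qed.

Lemma relint_pos v : relint (pos x) v <->
  pos x v /\ forall w, w != 0 -> (forall i, 0 <= dot w (x i)) -> 0 < dot w v.
Proof.
have hullT : linhull (pos x) = setT.
  rewrite pos_subconeT linhull_subcone span_full ?cardsT ?card_ord//.
  by apply/seteqP; split => // y _; apply: memvf.
rewrite /relint hullT; split=> [[xv wit]|[xv vw]]; split=> //.
  move=> w wn0 w0; have [t t0] := nbhs_ray (- w) wit => /(_ I) h.
  have := pos_dot_ge0 w0 h; rewrite dotDr dotZr dotNr.
  by have := dot_gt0 w; rewrite wn0 => ?; nra.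
have [k [u [un0 posE]]] := pos_halfspaces x.
have posP y : pos x y <-> forall i, 0 <= dot (u i) y by rewrite posE.
have : nbhs v [set y | forall i, 0 < dot (u i) y].
  apply: (@filter_forall _ _ (fun i => [set y | 0 < dot (u i) y])
    _ (nbhs_filter v)) => i.
  apply: nbhs_halfspace; apply: vw => // j.
  by move/posP : (pos_gen x j) => /(_ i).
by apply: filterS => y yu _; apply/posP => i; rewrite ltW.
Qed.

End GeneralPosition.

(** * The Gaussian measure *)

Section GaussianMeasure.
Context {R : realType}.
Local Open Scope ereal_scope.
Local Notation RT := (measurableTypeR R).

Lemma gauss_is_probability d :
  exists mu : probability (d.-tuple RT) R, @gauss R d = mu.
Proof.
elim: d => [|d [mu muE]].
  by exists (\d_ ([tuple] : 0.-tuple RT) : probability _ R).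
pose f (p : RT * d.-tuple RT) : d.+1.-tuple RT := [the d.+1.-tuple RT of p.1 :: p.2].
have mf : measurable_fun setT f by apply: measurable_cons.
pose mix := isMeasurableFun.Build _ _ _ _ f mf.
pose F : {mfun _ >-> _} := HB.pack f mix.
exists (distribution (normal_prob (0%R : R) 1%R \x mu : probability _ R) F).
by rewrite /= muE.
Qed.

Lemma gauss_measure0 d : @gauss R d set0 = 0.
Proof. by have [mu ->] := gauss_is_probability d; exact: measure0. Qed.

Lemma gauss_measure_ge0 d A : 0 <= @gauss R d A.
Proof. by have [mu ->] := gauss_is_probability d; exact: measure_ge0. Qed.

Lemma gauss_sigma_additive d : semi_sigma_additive (@gauss R d).
Proof.
by have [mu ->] := gauss_is_probability d; exact: measure_semi_sigma_additive.
Qed.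

HB.instance Definition _ d := isMeasure.Build _ _ _ (@gauss R d)
  (gauss_measure0 d) (@gauss_measure_ge0 d) (@gauss_sigma_additive d).

Lemma gauss_setT d : @gauss R d setT = 1.
Proof. by have [mu ->] := gauss_is_probability d; exact: probability_setT. Qed.

HB.instance Definition _ d := Measure_isProbability.Build _ _ _
  (@gauss R d) (gauss_setT d).

Lemma measurable_coord_sum d (c : 'I_d -> R) :
  measurable_fun setT (fun x : d.-tuple RT => (\sum_k c k * tnth x k)%R : RT).
Proof.
apply: measurable_sum => k; apply: measurable_funM; first exact: measurable_cst.
exact: measurable_tnth.
Qed.

Lemma measurable_level d (c : 'I_d -> R) (t : R) :
  measurable [set x : d.-tuple RT | (\sum_k c k * tnth x k)%R = t].
Proof.
have := measurable_coord_sum c measurableT (measurable_set1 t).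
by rewrite setTI.
Qed.

(** Fubini on the first coordinate: either another coordinate occurs, and almost all
sections are levels of the same kind, or the level is a point times the rest. *)
Lemma gauss_level d (c : 'I_d -> R) (t : R) k0 : c k0 != 0%R ->
  gauss [set x : d.-tuple RT | (\sum_k c k * tnth x k)%R = t] = 0.
Proof.
elim: d c t k0 => [|d IH] c t k0 ck0; first by case: k0 ck0.
rewrite /= /pushforward.
have -> : ((fun p : RT * d.-tuple RT => [the d.+1.-tuple RT of p.1 :: p.2]) @^-1`
    [set x | (\sum_k c k * tnth x k)%R = t]) =
    [set p | (c ord0 * p.1 + \sum_k c (lift ord0 k) * tnth p.2 k)%R = t].
  by apply/seteqP; split=> p /=; rewrite big_ord_recl => h; rewrite -h;
    congr (_ + _)%R; apply: eq_bigr => k _; rewrite tnthS.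
have [[k ck]|all0] := pselect (exists k, c (lift ord0 k) != 0%R).
  rewrite /product_measure1 integral0_eq// => y _ /=.
  have -> : xsection [set p : RT * d.-tuple RT |
      (c ord0 * p.1 + \sum_k c (lift ord0 k) * tnth p.2 k)%R = t] y =
      [set x | (\sum_k c (lift ord0 k) * tnth x k)%R = (t - c ord0 * y)%R].
    rewrite /xsection; apply/seteqP; split=> x /=; rewrite inE /=.
      by move=> <-; rewrite addrC addKr.
    by move=> ->; rewrite addrC subrK.
  exact: IH ck.
have cl k : c (lift ord0 k) = 0%R.
  by apply/eqP; apply: contrapT => /negP ck; apply: all0; exists k.
have c0 : c ord0 != 0%R.
  by case: (unliftP ord0 k0) ck0 => [j ->|-> //]; rewrite cl eqxx.
have -> : [set p : RT * d.-tuple RT |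
    (c ord0 * p.1 + \sum_k c (lift ord0 k) * tnth p.2 k)%R = t] =
    [set (t / c ord0)%R] `*` setT.
  apply/seteqP; split=> p /=; rewrite big1 ?addr0//.
  - by move=> <-; split=> //; rewrite mulrC mulKf.
  - by move=> k _; rewrite cl mul0r.
  - by move=> [-> _]; rewrite mulrC divfK.
  - by move=> k _; rewrite cl mul0r.
rewrite product_measure1E; first last.
- exact: measurableT.
- exact: (@measurable_set1 R).
have /null_content_dominatesP dom := @normal_prob_dominates R 0%R 1%R.
have null : normal_prob 0%R 1%R [set (t / c ord0)%R] = 0.
  by apply: dom; [exact: (@measurable_set1 R)|exact: lebesgue_measure_set1].
by rewrite [X in X * _]null mul0e.
Qed.

Lemma dot_row_of_tuple d (a : 'rV[R]_d) (x : d.-tuple RT) :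
  dot a (row_of_tuple x) = (\sum_k a 0 k * tnth x k)%R.
Proof. by apply: eq_bigr => k _; rewrite mxE. Qed.

Lemma measurable_dot_row d (a : 'rV[R]_d) :
  measurable_fun setT (fun x : d.-tuple RT => dot a (row_of_tuple x) : RT).
Proof.
have := measurable_coord_sum (fun k => a 0%R k).
by apply: eq_measurable_fun => x _; rewrite dot_row_of_tuple.
Qed.

Lemma gauss_generic d (Q : 'rV[R]_d -> Prop) : generic Q ->
  exists N, [/\ measurable N, gauss N = 0 & forall x, ~ N x -> Q (row_of_tuple x)].
Proof.
move=> [s s0 sQ].
pose N := \big[setU/set0]_(a <- s)
  [set x : d.-tuple RT | (\sum_k a 0 k * tnth x k)%R = 0%R].
have mN (a : 'rV[R]_d) : measurable
    [set x : d.-tuple RT | (\sum_k a 0 k * tnth x k)%R = 0%R].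
  exact: measurable_level.
have mNs : measurable N by apply: bigsetU_measurable => a _.
exists N; split => //.
  rewrite /N; elim: s s0 {sQ N mNs} => [|a s IH] s0; first by rewrite big_nil gauss_measure0.
  move: s0; rewrite inE negb_or => /andP[a0 s0]; rewrite big_cons measureU0//.
  - have [k ak] : exists k, a 0%R k != 0%R.
      apply: contrapT => nk; move/eqP: a0; apply; apply/rowP => k; rewrite mxE.
      by apply/esym/eqP; apply: contrapT => /negP ak; apply: nk; exists k.
    exact: gauss_level ak.
  - by apply: bigsetU_measurable.
  - exact: IH.
move=> x nN; apply: sQ => a a_s; apply/eqP => ax; apply: nN.
rewrite /N -bigcup_seq; exists a => //=.
by rewrite -dot_row_of_tuple.
Qed.

Lemma gauss_eq_generic d (A B : set (d.-tuple RT)) (Q : 'rV[R]_d -> Prop) :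
  measurable A -> measurable B -> generic Q ->
  (forall x, Q (row_of_tuple x) -> (A x <-> B x)) -> gauss A = gauss B.
Proof.
move=> mA mB /gauss_generic[N [mN N0 NQ]] AB.
have out (C : set (d.-tuple RT)) : measurable C -> gauss C = gauss (C `\` N).
  move=> mC; rewrite measureD//=; last by rewrite -ge0_fin_numE// fin_num_measure.
  suff -> : @gauss R d (C `&` N) = 0 by rewrite sube0.
  by apply: (subset_measure0 (B := N)) => //; exact: measurableI.
rewrite (out A)// (out B)//; congr gauss.
by apply/seteqP; split=> x [Cx Nx]; split => //; apply/(AB x (NQ x Nx)).
Qed.

End GaussianMeasure.

(** * Measurability in the generators *)

Section HitsPolynomial.
Context {R : realType} {d m : nat} (x : 'I_m -> 'rV[R]_d) (J : {set 'I_m}).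

Definition masked_rows : 'M[R]_(m, d) := \matrix_i (if i \in J then x i else 0).

(** The Gram matrix of the family indexed by J, completed by ones on the diagonal
outside J so that its size does not depend on J. *)
Definition masked_gram : 'M[R]_m :=
  masked_rows *m masked_rows^T + diag_mx (\row_i (i \notin J)%:R).

Definition cramer (z : 'rV[R]_d) : 'rV[R]_m :=
  z *m masked_rows^T *m \adj masked_gram.

Lemma masked_rows_sum (l : 'rV[R]_m) :
  l *m masked_rows = \sum_(i in J) l 0 i *: x i.
Proof.
rewrite mulmx_sum_row [RHS]big_mkcond; apply: eq_bigr => i _; rewrite rowK.
by case: ifP => // _; rewrite scaler0.
Qed.

Lemma mul_masked_tr (y : 'rV[R]_d) i :
  (y *m masked_rows^T) 0 i = if i \in J then dot y (x i) else 0.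
Proof.
have -> : (y *m masked_rows^T) 0 i = dot y (row i masked_rows).
  by rewrite mxE; apply: eq_bigr => k _; rewrite !mxE.
by rewrite rowK; case: ifP => // _; rewrite dot0r.
Qed.

Lemma mul_masked_gram (l : 'rV[R]_m) i : (l *m masked_gram) 0 i =
  if i \in J then dot (\sum_(k in J) l 0 k *: x k) (x i) else l 0 i.
Proof.
rewrite mulmxDr mxE mulmxA mul_masked_tr masked_rows_sum mul_mx_diag !mxE.
by case: ifP => _; rewrite /= ?mulr0 ?addr0 ?mulr1 ?add0r.
Qed.

Lemma masked_gram_det : indep x J -> \det masked_gram != 0.
Proof.
move=> xJ; apply/negP => /det0P[v v0 vG]; move/negP: v0; apply; apply/eqP.
have vE i : (v *m masked_gram) 0 i = 0 by rewrite vG mxE.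
have p0 : \sum_(k in J) v 0 k *: x k = 0.
  apply: dot_eq0P; rewrite [X in dot _ X]/= dot_sumr big1// => i iJ.
  by have := vE i; rewrite mul_masked_gram iJ dotZr => ->; rewrite mulr0.
apply/rowP => i; rewrite mxE; have [iJ|iJ] := boolP (i \in J).
  exact: xJ (fun k => v 0 k) p0 i iJ.
by have := vE i; rewrite mul_masked_gram (negPf iJ).
Qed.

(** Cramer's rule for the normal equations of the projection to span J. *)
Lemma cramer_coefficients z (l : 'I_m -> R) :
  (forall i, i \in J -> dot (z - \sum_(i in J) l i *: x i) (x i) = 0) ->
  cramer z = \det masked_gram *: \row_i (if i \in J then l i else 0).
Proof.
move=> zl; set lv := \row_i _.
have lvE : \sum_(k in J) lv 0 k *: x k = \sum_(k in J) l k *: x k.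
  by apply: eq_bigr => k kJ; rewrite mxE kJ.
have -> : cramer z = lv *m masked_gram *m \adj masked_gram.
  congr (_ *m _); apply/rowP => i; rewrite mul_masked_tr mul_masked_gram lvE mxE.
  case: ifP => // iJ; apply/eqP; rewrite -subr_eq0 -dotBl zl//.
by rewrite -mulmxA mul_mx_adj mul_mx_scalar.
Qed.

Definition hits_polynomial z : bool := [forall i,
  if i \in J then 0 < \det masked_gram * cramer z 0 i
  else \det masked_gram * dot (\det masked_gram *: z - cramer z *m masked_rows) (x i) < 0].

(** For an independent family the cell of J is cut out by polynomial inequalities
in the generators and in z jointly, hence is jointly measurable. *)
Lemma hits_polynomialP z : indep x J -> hits x J z <-> hits_polynomial z.
Proof.
move=> xJ; have D0 := masked_gram_det xJ; set D := \det masked_gram in D0.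
have DD : 0 < D * D by rewrite -expr2 exprn_even_gt0.
have key (l : 'I_m -> R) :
    (forall i, i \in J -> dot (z - \sum_(i in J) l i *: x i) (x i) = 0) ->
    (forall i, i \in J -> D * cramer z 0 i = D * D * l i) /\
    (forall i, D * dot (D *: z - cramer z *m masked_rows) (x i) =
               D * D * dot (z - \sum_(i in J) l i *: x i) (x i)).
  move=> /cramer_coefficients ->; rewrite -/D; split=> [i iJ|i].
    by rewrite !mxE iJ mulrA.
  rewrite -scalemxAl masked_rows_sum -scalerBr dotZl mulrA; congr (_ * dot (_ - _) _).
  by apply: eq_bigr => k kJ; rewrite mxE kJ.
split=> [[l l0 [lJ lnJ]]|/forallP h].
  have [kJ kn] := key l lJ; apply/forallP => i; rewrite -/D.
  case: ifPn => iJ; first by rewrite kJ// mulr_gt0// l0.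
  by rewrite kn pmulr_rlt0// lnJ.
have [l lJ] := span_projection x J z; have [kJ kn] := key l lJ.
exists l => [i iJ|]; first by have := h i; rewrite iJ kJ// pmulr_rgt0.
split=> // i iJ; have := h i; rewrite (negPf iJ) kn pmulr_rlt0//.
Qed.

End HitsPolynomial.

Section MeasurableMatrices.
Context {R : realType} {disp : measure_display} {T : measurableType disp}.
Local Notation RT := (measurableTypeR R).

Definition measurable_mx p q (F : T -> 'M[R]_(p, q)) : Prop :=
  forall i j, measurable_fun [set: T] (fun t => F t i j : RT).

Lemma measurable_mx_mul p q r (F : T -> 'M[R]_(p, q)) (G : T -> 'M[R]_(q, r)) :
  measurable_mx F -> measurable_mx G -> measurable_mx (fun t => F t *m G t).
Proof.
move=> mF mG i j; apply: (eq_measurable_fun (fun t => \sum_k F t i k * G t k j : RT)).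
  by move=> t _; rewrite mxE.
by apply: measurable_sum => k; apply: measurable_funM; [exact: mF|exact: mG].
Qed.

Lemma measurable_mx_tr p q (F : T -> 'M[R]_(p, q)) :
  measurable_mx F -> measurable_mx (fun t => (F t)^T).
Proof.
by move=> mF i j; apply: (eq_measurable_fun (fun t => F t j i : RT)) => // t _; rewrite mxE.
Qed.

Lemma measurable_mx_add p q (F G : T -> 'M[R]_(p, q)) :
  measurable_mx F -> measurable_mx G -> measurable_mx (fun t => F t + G t).
Proof.
move=> mF mG i j; apply: (eq_measurable_fun (fun t => F t i j + G t i j : RT)).
  by move=> t _; rewrite mxE.
by apply: measurable_funD; [exact: mF|exact: mG].
Qed.

Lemma measurable_mx_scale p q (a : T -> R) (F : T -> 'M[R]_(p, q)) :
  measurable_fun [set: T] (a : T -> RT) -> measurable_mx F ->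
  measurable_mx (fun t => a t *: F t).
Proof.
move=> ma mF i j; apply: (eq_measurable_fun (fun t => a t * F t i j : RT)).
  by move=> t _; rewrite mxE.
by apply: measurable_funM; [exact: ma|exact: mF].
Qed.

Lemma measurable_mx_cst p q (A : 'M[R]_(p, q)) : measurable_mx (fun=> A).
Proof. by move=> i j; exact: measurable_cst. Qed.

Lemma measurable_det p (F : T -> 'M[R]_p) :
  measurable_mx F -> measurable_fun [set: T] (fun t => \det (F t) : RT).
Proof.
move=> mF; apply: measurable_sum => s; apply: measurable_funM.
  exact: measurable_cst.
by apply: measurable_prod => i _; apply: mF.
Qed.

Lemma measurable_adj p (F : T -> 'M[R]_p) :
  measurable_mx F -> measurable_mx (fun t => \adj (F t)).
Proof.
move=> mF i j; apply: (eq_measurable_fun (fun t =>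
    (-1) ^+ (j + i) * \det (row' j (col' i (F t))) : RT)).
  by move=> t _; rewrite mxE.
apply: measurable_funM; first exact: measurable_cst.
apply: measurable_det => a b.
apply: (eq_measurable_fun (fun t => F t (lift j a) (lift i b) : RT)) => //.
by move=> t _; rewrite !mxE.
Qed.

Lemma measurable_dot d (y z : T -> 'rV[R]_d) : measurable_mx y -> measurable_mx z ->
  measurable_fun [set: T] (fun t => dot (y t) (z t) : RT).
Proof.
by move=> my mz; apply: measurable_sum => k; apply: measurable_funM; [apply: my|apply: mz].
Qed.

Lemma measurable_lt (f g : T -> R) : measurable_fun [set: T] (f : T -> RT) ->
  measurable_fun [set: T] (g : T -> RT) -> measurable [set t | f t < g t].
Proof.
move=> mf mg; have := @measurable_fun_ltr _ _ _ setT _ _ mf mg.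
by move=> /(_ measurableT [set true]); rewrite setTI; apply.
Qed.

Lemma measurable_forall (I : finType) (F : I -> set T) :
  (forall i, measurable (F i)) -> measurable [set t | forall i, F i t].
Proof.
move=> mF; have -> : [set t | forall i, F i t] = \bigcap_(i in [set: I]) F i.
  by apply/seteqP; split=> t /= h i; [move=> _; exact: h|exact: h].
by apply: fin_bigcap_measurable => [|i _]; [exact: finite_finset|exact: mF].
Qed.

Lemma measurable_exists (I : countType) (F : I -> set T) :
  (forall i, measurable (F i)) -> measurable [set t | exists i, F i t].
Proof.
move=> mF; have -> : [set t | exists i, F i t] = \bigcup_i F i.
  by apply/seteqP; split=> t /= [i]; [exists i|move=> _ ?; exists i].
by apply: countable_bigcupT_measurable => //; exact: countableP.
Qed.

Lemma measurable_mx_row_of_tuple d (f : T -> d.-tuple RT) :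
  measurable_fun setT f -> measurable_mx (fun t => row_of_tuple (f t)).
Proof.
move=> mf i k; apply: (eq_measurable_fun (fun t => tnth (f t) k : RT)).
  by move=> t _; rewrite mxE.
exact: measurableT_comp (measurable_tnth k) mf.
Qed.

Context {d m : nat} (x : T -> 'I_m -> 'rV[R]_d) (z : T -> 'rV[R]_d).
Hypothesis mx : forall i, measurable_mx (fun t => x t i).
Hypothesis mz : measurable_mx z.

Lemma measurable_hits_polynomial (J : {set 'I_m}) :
  measurable [set t | hits_polynomial (x t) J (z t)].
Proof.
have mA : measurable_mx (fun t => masked_rows (x t) J).
  move=> i k; case iJ: (i \in J).
    by apply: (eq_measurable_fun (fun t => x t i 0 k : RT)) => [t _|];
      [rewrite !mxE iJ|exact: mx].
  by apply: (eq_measurable_fun (fun=> 0 : RT)) => [t _|];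
      [rewrite !mxE iJ mxE|exact: measurable_cst].
have mG : measurable_mx (fun t => masked_gram (x t) J).
  apply: measurable_mx_add; last exact: measurable_mx_cst.
  by apply: measurable_mx_mul => //; apply: measurable_mx_tr.
have mD := measurable_det mG.
have mC : measurable_mx (fun t => cramer (x t) J (z t)).
  apply: measurable_mx_mul; last exact: measurable_adj.
  by apply: measurable_mx_mul => //; apply: measurable_mx_tr.
have -> : [set t | hits_polynomial (x t) J (z t)] = [set t | forall i,
  if i \in J then 0 < \det (masked_gram (x t) J) * cramer (x t) J (z t) 0 i
  else \det (masked_gram (x t) J) * dot (\det (masked_gram (x t) J) *: z t -
     cramer (x t) J (z t) *m masked_rows (x t) J) (x t i) < 0].
  by apply/seteqP; split=> t /= /forallP.
apply: (@measurable_forall _ (fun i => [set t |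
  if i \in J then 0 < \det (masked_gram (x t) J) * cramer (x t) J (z t) 0 i
  else \det (masked_gram (x t) J) * dot (\det (masked_gram (x t) J) *: z t -
     cramer (x t) J (z t) *m masked_rows (x t) J) (x t i) < 0])) => i.
case: (i \in J).
  by apply: measurable_lt; [exact: measurable_cst|apply: measurable_funM; [|exact: mC]].
apply: measurable_lt; last exact: measurable_cst.
apply: measurable_funM => //; apply: measurable_dot; last exact: mx.
apply: measurable_mx_add; first exact: measurable_mx_scale.
move=> i0 k; apply: (eq_measurable_fun (fun t =>
    -1 * (cramer (x t) J (z t) *m masked_rows (x t) J) i0 k : RT)).
  by move=> t _; rewrite mulN1r [RHS]mxE.
apply: measurable_funM; first exact: measurable_cst.
by apply: measurable_mx_mul.
Qed.

End MeasurableMatrices.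

(** * Intrinsic volumes as Gaussian measures of cells *)

Lemma sum_finType (R : realType) (I : finType) (P : pred I) (F : I -> \bar R) :
  (\sum_(i \in [set i | P i]) F i = \sum_(i | P i) F i)%E.
Proof.
rewrite (eq_fsbigr (fun i => if P i then F i else 0%E)) => [|i]; last first.
  by rewrite inE /= => ->.
rewrite (@fsbig_fwiden _ _ _ _ (index_enum I)).
- by rewrite [RHS]big_mkcond.
- by move=> i _ /=; rewrite mem_index_enum.
- exact: index_enum_uniq.
by move=> i [/= _ nP]; rewrite ifF//; apply/negP.
Qed.

Section ProjectionCells.
Context {R : realType} {d m : nat} (x : 'I_m -> 'rV[R]_d).
Implicit Types (v w z p : 'rV[R]_d) (J K : {set 'I_m}).

(** Without strictness off J this is exactly the condition in the definition of the
intrinsic volumes; it differs from hits by a null set. *)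
Definition touches J z : Prop :=
  exists2 l : 'I_m -> R, forall i, i \in J -> 0 < l i &
    let p := \sum_(i in J) l i *: x i in
    (forall i, i \in J -> dot (z - p) (x i) = 0) /\
    (forall i, i \notin J -> dot (z - p) (x i) <= 0).

Lemma hits_touches J z : hits x J z -> touches J z.
Proof. by move=> [l l0 [lJ lnJ]]; exists l => //; split=> // i /lnJ/ltW. Qed.

Lemma is_projection_sum J z (l : 'I_m -> R) :
  let p := \sum_(i in J) l i *: x i in
  (forall i, i \in J -> 0 < l i) ->
  (forall i, i \in J -> dot (z - p) (x i) = 0) ->
  (forall i, i \notin J -> dot (z - p) (x i) <= 0) -> is_projection x z p.
Proof.
move=> p l0 lJ lnJ; split.
- by apply: (@subcone_pos _ _ _ x J); exists l => // i /l0/ltW.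
- by move=> i; have [iJ|/lnJ//] := boolP (i \in J); rewrite lJ.
- by rewrite dot_sumr big1// => i iJ; rewrite dotZr lJ// mulr0.
Qed.

Lemma touches_projection J z : touches J z ->
  exists2 l : 'I_m -> R, forall i, i \in J -> 0 < l i &
    is_projection x z (\sum_(i in J) l i *: x i).
Proof. by move=> [l l0 [lJ lnJ]]; exists l => //; apply: is_projection_sum. Qed.

Lemma hits_projection J z : hits x J z -> exists p, [/\ is_projection x z p,
  forall i, i \in J -> dot (z - p) (x i) = 0 &
  forall i, i \notin J -> dot (z - p) (x i) < 0].
Proof.
move=> [l l0 [lJ lnJ]]; exists (\sum_(i in J) l i *: x i); split=> //.
by apply: is_projection_sum => // i /lnJ/ltW.
Qed.

Lemma projection_touches J z (l : 'I_m -> R) : (forall i, i \in J -> 0 < l i) ->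
  is_projection x z (\sum_(i in J) l i *: x i) -> touches J z.
Proof.
move=> l0 [_ ple /eqP]; rewrite dot_sumr -oppr_eq0 -sumrN psumr_eq0 => [/allP z0|i iJ].
  exists l => //; split=> [i iJ|i _]; last exact: ple.
  have := z0 i (mem_index_enum i); rewrite iJ/= oppr_eq0 dotZr mulf_eq0.
  by rewrite gt_eqF ?l0//= => /eqP.
by rewrite oppr_ge0 dotZr mulr_ge0_le0// ltW// l0.
Qed.

Lemma hits_exposed J z : hits x J z -> exposed x J.
Proof.
move=> /hits_projection[p [_ pJ pnJ]]; exists (- (z - p)).
by split=> i iJ; rewrite dotNl; [rewrite pJ ?oppr0|rewrite oppr_gt0 pnJ].
Qed.

Lemma hits_disjoint J K z : hits x J z -> hits x K z -> J = K.
Proof.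
move=> /hits_projection[p [zp pJ pnJ]] /hits_projection[q [zq]].
rewrite (is_projection_uniq zq zp) => pK pnK; apply/setP => i.
have zeroE (L : {set 'I_m}) : (forall i, i \in L -> dot (z - p) (x i) = 0) ->
    (forall i, i \notin L -> dot (z - p) (x i) < 0) ->
    (i \in L) = (dot (z - p) (x i) == 0).
  by move=> pL pnL; have [/pL->|/pnL/lt_eqF//] := boolP (i \in L); rewrite eqxx.
by rewrite (zeroE J)// (zeroE K).
Qed.

Lemma hits_notin J z : (#|J| < m)%N -> hits x J z -> pos x <> setT /\ ~ pos x z.
Proof.
move=> /exists_notin[i iJ] /hits_projection[p [zp pJ pnJ]]; have [xp ple pp] := zp.
have zp0 : z - p != 0.
  by apply: contraTneq (pnJ i iJ) => ->; rewrite dot0l ltxx.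
split; first by apply: (@pos_neqT _ _ _ _ (- (z - p))) => [|k];
  rewrite ?oppr_eq0// dotNl oppr_ge0.
move=> xz; move/eqP: zp0; apply; apply/eqP; rewrite subr_eq0.
apply/eqP; apply: is_projection_uniq zp; split => // [k|];
  by rewrite subrr dot0l.
Qed.

(** The coordinates are pairings with the dual basis, and the residual products are
pairings with the components of the x i orthogonal to the span. *)
Lemma projection_functionals J : indep x J -> exists b c : 'I_m -> 'rV[R]_d,
  [/\ forall z (l : 'I_m -> R),
      (forall i, i \in J -> dot (z - \sum_(i in J) l i *: x i) (x i) = 0) <->
      (forall i, i \in J -> l i = dot (b i) z),
    forall z (l : 'I_m -> R), (forall i, i \in J -> l i = dot (b i) z) ->
      forall i, dot (z - \sum_(i in J) l i *: x i) (x i) = dot (c i) z &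
    forall i, i \notin J -> indep x (i |: J)%SET -> c i != 0].
Proof.
move=> xJ.
have [b [coef bq]] := indep_coordinates xJ.
have /choice[q qP] z := span_projection x J z.
have lb z (l : 'I_m -> R) :
    (forall i, i \in J -> dot (z - \sum_(i in J) l i *: x i) (x i) = 0) ->
    forall i, i \in J -> l i = dot (b i) z.
  move=> zl i iJ; rewrite -[z](subrK (\sum_(i in J) l i *: x i)) dotDr coef//.
  have [k ->] := bq i iJ; rewrite dotC dot_sumr big1 ?add0r// => a aJ.
  by rewrite dotZr zl// mulr0.
have lin z (l : 'I_m -> R) : (forall i, i \in J -> l i = dot (b i) z) ->
    forall i, i \in J -> dot (z - \sum_(i in J) l i *: x i) (x i) = 0.
  move=> lE i iJ.
  have -> : \sum_(i in J) l i *: x i = \sum_(i in J) q z i *: x i.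
    by apply: eq_bigr => k kJ; rewrite lE// -(lb z (q z) (qP z)).
  exact: qP.
exists b, (fun i => x i - \sum_(k in J) q (x i) k *: x k); split.
- by move=> z l; split; [apply: lb|apply: lin].
- move=> z l lE i; have zl := lin z l lE.
  rewrite dotBl [RHS]dotC dotBr; set p := \sum_(k in J) l k *: _.
  set y := \sum_(k in J) _ *: x k.
  have py : dot (z - p) y = 0.
    by rewrite dot_sumr big1// => k kJ; rewrite dotZr zl// mulr0.
  have yp : dot (x i - y) p = 0.
    by rewrite dot_sumr big1// => k kJ; rewrite dotZr qP// mulr0.
  by move: py yp; rewrite !dotBl (dotC p) (dotC (x i) p) (dotC y p); lra.
move=> i iJ ind; apply/eqP => c0.
suff : (1 : R) = 0 by apply/eqP; rewrite oner_eq0.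
have := ind (fun k => if k == i then 1 else - q (x i) k) _ i (setU11 _ _).
rewrite eqxx; apply; rewrite big_setU1//= eqxx scale1r -[RHS]c0 -sumrN.
congr (_ + _); apply: eq_bigr => k kJ; case: eqVneq => [ki|_].
  by rewrite -ki kJ in iJ.
by rewrite scaleNr.
Qed.

Lemma hits_linear J : indep x J -> exists b c : 'I_m -> 'rV[R]_d,
  [/\ forall z, hits x J z <-> (forall i, if i \in J then 0 < dot (b i) z
        else dot (c i) z < 0),
    forall z, touches J z <-> (forall i, if i \in J then 0 < dot (b i) z
        else dot (c i) z <= 0) &
    forall i, i \notin J -> indep x (i |: J)%SET -> c i != 0].
Proof.
move=> xJ; have [b [c [bP cP c0]]] := projection_functionals xJ.
have key (Q : R -> bool) z : (exists2 l : 'I_m -> R, forall i, i \in J -> 0 < l i &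
      let p := \sum_(i in J) l i *: x i in
      (forall i, i \in J -> dot (z - p) (x i) = 0) /\
      (forall i, i \notin J -> Q (dot (z - p) (x i)))) <->
    (forall i, if i \in J then 0 < dot (b i) z else Q (dot (c i) z)).
  split=> [[l l0 [/bP lE lnJ]] i|h].
    by case: ifPn => iJ; [rewrite -lE ?l0|rewrite -(cP _ _ lE) lnJ].
  exists (fun i => dot (b i) z); first by move=> i iJ; have := h i; rewrite iJ.
  split=> [|i iJ]; first exact/bP.
  by rewrite (cP z (fun i => dot (b i) z))//; have := h i; rewrite (negPf iJ).
by exists b, c; split=> // z; [exact: (key (fun r => r < 0))|exact: (key (fun r => r <= 0))].
Qed.

End ProjectionCells.

Section IntrinsicVolumes.
Context {R : realType} {d m : nat} (x : 'I_m -> 'rV[R]_d).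
Implicit Types (v w z p : 'rV[R]_d) (J K : {set 'I_m}).
Hypothesis dm : (d <= m)%N.
Hypothesis gp : forall J, #|J| = d -> indep x J.
Local Notation RT := (measurableTypeR R).
Local Notation cell J := [set t : d.-tuple RT | hits x J (row_of_tuple t)].

Lemma generic_touches_hits J : (#|J| < d)%N ->
  generic (fun z => touches x J z -> hits x J z).
Proof.
move=> Jd; have [b [c [hP tP c0]]] := hits_linear (gp_indep dm gp (ltnW Jd)).
have gen : generic (fun z : 'rV[R]_d => forall i, i \notin J -> dot (c i) z != 0).
  apply: generic_forall => i; apply: generic_impl => iJ.
  apply: generic_hyperplane; apply: c0 => //; apply: (gp_indep dm gp).
  by rewrite cardsU1 iJ.
apply: generic_sub gen => z zc /tP tz; apply/hP => i; have := tz i.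
by case: ifPn => // iJ; rewrite lt_def eq_sym zc.
Qed.

(** When p is not interior to the cone it lies on the face supported by w, hence in
the relative interior of the subcone of the generators with positive coefficient. *)
Lemma face_touches z p w : is_projection x z p -> w != 0 ->
  (forall i, 0 <= dot w (x i)) -> dot w p = 0 ->
  exists2 J : {set 'I_m}, (#|J| < d)%N & touches x J z /\ forall i, i \in J -> dot w (x i) = 0.
Proof.
move=> zp wn0 w0 wp; have [xp _ _] := zp.
have [l l0 pE] := (pos_annihilated _ w0).1 (conj xp wp).
set J0 := [set i | dot w (x i) == 0]%SET in l0 pE.
have J0d : (#|J0| < d)%N.
  rewrite ltnNge; apply: contra wn0 => dJ; apply/eqP.
  by apply: (orthogonal_eq0 dm gp dJ) => i; rewrite inE => /eqP.
pose J := [set i in J0 | l i != 0]%SET.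
have JJ0 : J \subset J0 by apply/fintype.subsetP => i; rewrite inE => /andP[].
exists J; first exact: leq_ltn_trans (subset_leq_card JJ0) J0d.
split; last by move=> i /(fintype.subsetP JJ0); rewrite inE => /eqP.
apply: (@projection_touches _ _ _ _ _ _ l).
  by move=> i; rewrite inE => /andP[iJ li]; rewrite lt_def li l0.
suff -> : \sum_(i in J) l i *: x i = p by [].
rewrite pE [LHS]big_mkcond [RHS]big_mkcond; apply: eq_bigr => i _.
rewrite [i \in J]inE; case: ifP => [/andP[->//]|].
by case: (i \in J0) => //= /negbFE/eqP->; rewrite scale0r.
Qed.

(** If z is outside the cone, its residual z - p supports a face containing p. *)
Lemma generic_dichotomy :
  generic (fun z => pos x z \/ exists2 J : {set 'I_m}, (#|J| < d)%N & hits x J z).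
Proof.
have gen : generic (fun z => forall J : {set 'I_m}, (#|J| < d)%N -> touches x J z -> hits x J z).
  by apply: generic_forall => J; apply: generic_impl; apply: generic_touches_hits.
apply: generic_sub gen => z tz; have [p zp] := projection_exists x z.
have [xp ple pp] := zp.
have [zE|zp0] := eqVneq z p; first by left; rewrite zE.
right; have [| | |J Jd [tJ _]] := @face_touches z p (p - z) zp.
- by rewrite subr_eq0 eq_sym.
- by move=> i; rewrite -opprB dotNl oppr_ge0.
- by rewrite -opprB dotNl pp oppr0.
by exists J => //; apply: tz.
Qed.

Lemma relint_touches J z : indep x J ->
  relint (subcone x J) (cone_proj (pos x) z) <-> touches x J z.
Proof.
move=> xJ; split=> [/(relint_subcone _ xJ)[l l0 pE]|tJ].
  by apply: projection_touches l0 _; rewrite -pE; apply: cone_projP.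
have [l l0 lp] := touches_projection tJ; rewrite (cone_proj_eq lp).
by apply/relint_subcone => //; exists l.
Qed.

Lemma measurable_cell J : indep x J -> measurable (cell J).
Proof.
move=> xJ; have := @measurable_hits_polynomial _ _ (d.-tuple RT) _ _ (fun=> x) _
  (fun i => measurable_mx_cst (x i)) (measurable_mx_row_of_tuple (@measurable_id _ _ setT)) J.
by congr (measurable _); apply/seteqP; split=> t /(hits_polynomialP _ xJ).
Qed.

Lemma measurable_touches J : indep x J ->
  measurable [set t : d.-tuple RT | touches x J (row_of_tuple t)].
Proof.
move=> xJ; have [b [c [_ tP _]]] := hits_linear xJ.
have -> : [set t : d.-tuple RT | touches x J (row_of_tuple t)] =
  [set t : d.-tuple RT | forall i,
    if i \in J then 0 < dot (b i) (row_of_tuple t)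
    else dot (c i) (row_of_tuple t) <= 0].
  by apply/seteqP; split=> t /tP.
apply: (@measurable_forall _ _ _ (fun i => [set t : d.-tuple RT |
  if i \in J then 0 < dot (b i) (row_of_tuple t)
  else dot (c i) (row_of_tuple t) <= 0])) => i.
have mgt (u : 'rV[R]_d) : measurable [set t : d.-tuple RT | 0 < dot u (row_of_tuple t)].
  by apply: measurable_lt; [exact: measurable_cst|exact: measurable_dot_row].
case: (i \in J); first exact: mgt.
have := measurableC (mgt (c i)).
by congr (measurable _); apply/seteqP; split=> t /=; rewrite leNgt => /negP.
Qed.

Lemma gauss_touches J : (#|J| < d)%N ->
  gauss [set t : d.-tuple RT | touches x J (row_of_tuple t)] = gauss (cell J).
Proof.
move=> Jd; have xJ := gp_indep dm gp (ltnW Jd).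
apply: (gauss_eq_generic (measurable_touches xJ) (measurable_cell xJ)
  (generic_touches_hits Jd)) => t tz.
by split; [apply: tz|apply: hits_touches].
Qed.

(** The subcones of non-exposed J contribute nothing, as their cells are empty. *)
Lemma intrinsic_volume_low j : (j < d)%N ->
  intrinsic_volume j (pos x) = (\sum_(J : {set 'I_m} | #|J| == j) gauss (cell J))%E.
Proof.
move=> jd; rewrite /intrinsic_volume (faces_low dm gp jd) esum_image; last first.
  by move=> J K /set_mem[_ eJ] /set_mem[_ eK]; apply: subcone_inj.
pose a J := if `[< exposed x J >] then gauss (cell J) else 0%E.
rewrite (eq_esum (b := a)); last first.
  move=> J [Jj eJ]; rewrite /a asboolT// -gauss_touches ?Jj//; congr gauss.
  by apply/seteqP; split=> t /relint_touches; apply; apply: (gp_indep dm gp);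
    rewrite Jj ltnW.
rewrite esum_fset; first last.
- by move=> J _; rewrite /a; case: ifP.
- exact: finite_finset.
have -> : [set J : {set 'I_m} | #|J| = j /\ exposed x J] =
    [set J : {set 'I_m} | (#|J| == j) && `[< exposed x J >]].
  apply/seteqP; split=> J /=; first by move=> [-> eJ]; rewrite eqxx asboolT.
  by move=> /andP[/eqP Jj /asboolP].
rewrite sum_finType -big_mkcondr [LHS]big_mkcond [RHS]big_mkcond.
apply: eq_bigr => J _; rewrite /a; case: eqP => //= Jj.
case: asboolP => // neJ; suff -> : cell J = set0 by rewrite measure0.
by apply/seteqP; split=> // t /= /hits_exposed.
Qed.

(** The complement of the event for the interior is the union of the disjoint cells
of fewer than d generators, up to a null set. *)
Lemma intrinsic_volume_top : pos x <> setT ->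
  (intrinsic_volume d (pos x) +
    \sum_(J : {set 'I_m} | (#|J| < d)%N) gauss (cell J) = 1)%E.
Proof.
move=> xT; rewrite /intrinsic_volume (faces_top dm gp) esum_set1//.
set O := [set t | _].
pose wexp J := exists2 w, w != 0 & (forall i, 0 <= dot w (x i)) /\
  forall i, i \in J -> dot w (x i) = 0.
have OC : ~` O = \bigcup_(J in [set J : {set 'I_m} | (#|J| < d)%N /\ wexp J])
    [set t : d.-tuple RT | touches x J (row_of_tuple t)].
  apply/seteqP; split=> t /=.
    move=> nO; have zp := cone_projP x (row_of_tuple t); have [xp _ _] := zp.
    have [w wn0 [w0 wp]] : exists2 w, w != 0 &
        (forall i, 0 <= dot w (x i)) /\ dot w (cone_proj (pos x) (row_of_tuple t)) = 0.
      apply: contrapT => nw; apply: nO; apply/(relint_pos dm gp); split=> // w wn0 w0.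
      rewrite lt_def (pos_dot_ge0 w0)// andbT; apply/eqP => wp; apply: nw.
      by exists w.
    have [J Jd [tJ wJ]] := face_touches zp wn0 w0 wp.
    by exists J => //; split=> //; exists w.
  move=> [J [Jd [w wn0 [w0 wJ]]] tJ].
  have [l l0 lp] := touches_projection tJ; rewrite /O/= (cone_proj_eq lp).
  move=> /(relint_pos dm gp)[_ /(_ w wn0 w0)].
  by rewrite dot_sumr big1 ?ltxx// => i iJ; rewrite dotZr wJ// mulr0.
have mOC : measurable (~` O).
  rewrite OC; apply: fin_bigcup_measurable; first exact: finite_finset.
  by move=> J [Jd _]; apply: measurable_touches; apply: (gp_indep dm gp); apply: ltnW.
have mO : measurable O by rewrite -(setCK O); apply: measurableC.
pose U := \bigcup_(J in [set J : {set 'I_m} | (#|J| < d)%N]) cell J.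
have mcell J : (#|J| < d)%N -> measurable (cell J).
  by move=> Jd; apply: measurable_cell; apply: (gp_indep dm gp); apply: ltnW.
have mU : measurable U by apply: fin_bigcup_measurable => //; exact: finite_finset.
have gU : gauss U = (\sum_(J : {set 'I_m} | (#|J| < d)%N) gauss (cell J))%E.
  rewrite measure_fin_bigcup//; [|exact: finite_finset|].
    exact: sum_finType.
  by move=> J K _ _ [t [/= hJ hK]]; apply: hits_disjoint hJ hK.
have exp_w J t : (#|J| < d)%N -> hits x J (row_of_tuple t) -> wexp J.
  move=> Jd /hits_exposed[w [wJ wnJ]].
  have [i iJ] := exists_notin (leq_trans Jd dm).
  exists w; first by apply: contraTneq (wnJ i iJ) => ->; rewrite dot0l ltxx.
  by split=> // k; have [/wJ->//|/wnJ/ltW] := boolP (k \in J).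
have gen : generic (fun z => forall J : {set 'I_m}, (#|J| < d)%N -> touches x J z -> hits x J z).
  by apply: generic_forall => J; apply: generic_impl; apply: generic_touches_hits.
rewrite -gU -(gauss_eq_generic mOC mU gen) => [|t tz].
  rewrite -measureU//; last by rewrite setICr.
  by rewrite setUCr; exact: gauss_setT.
rewrite OC; split=> [[J [Jd _] tJ]|[J Jd hJ]].
  by exists J => //; apply: tz.
by exists J => /=; [split=> //; apply: exp_w Jd hJ|apply: hits_touches].
Qed.

End IntrinsicVolumes.

(** * Counting the proper cones *)

Section Quotient.
Context {R : realType} {k : nat} (z : 'rV[R]_k.+1).

(** C^T is the projection along z, in coordinates on the orthogonal complement. *)
Lemma orthogonal_basis : z != 0 -> exists C : 'M[R]_(k, k.+1), row_free C /\
  forall y : 'rV[R]_k.+1, dot y z = 0 <-> (y <= C)%MS.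
Proof.
move=> z0; have rk : \rank (kermx z^T) = k.
  by rewrite mxrank_ker mxrank_tr rank_rV z0 subn1.
have [C [Cfree CE]] : exists C : 'M[R]_(k, k.+1), row_free C /\ (C :=: kermx z^T)%MS.
  move: (row_base (kermx z^T)) (row_base_free (kermx z^T)) (eq_row_base (kermx z^T)).
  by rewrite rk => C Cfree CE; exists C.
exists C; split=> // y; rewrite CE; split=> [yz|/sub_kermxP yz].
  by apply/sub_kermxP/eqP; rewrite mulmx_tr_eq0 yz.
by move/eqP: yz; rewrite mulmx_tr_eq0 => /eqP.
Qed.

Lemma orthogonal_basis_kernel (C : 'M[R]_(k, k.+1)) (y : 'rV[R]_k.+1) : z != 0 ->
  (forall y : 'rV[R]_k.+1, dot y z = 0 <-> (y <= C)%MS) ->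
  y *m C^T = 0 -> exists a, y = a *: z.
Proof.
move=> z0 CP yC; exists (dot y z / dot z z); apply/eqP; rewrite -subr_eq0 -dot_eq0.
set w := y - _; have /CP/submxP[u uE] : dot w z = 0.
  by rewrite dotBl dotZl divfK ?dot_eq0// subrr.
have zC : z *m C^T = 0.
  apply/mulmx_tr0P => v; rewrite dotC; apply/CP; exact: submxMl.
rewrite {2}uE dotC dot_mulmx /w mulmxBl yC -scalemxAl zC scaler0 subrr.
by rewrite dot0r.
Qed.

End Quotient.

Section GenericSpans.
Context {R : realType} {d m : nat} (x : 'I_m -> 'rV[R]_d).

Lemma generic_opp (Q : 'rV[R]_d -> Prop) : generic Q -> generic (fun z => Q (- z)).
Proof.
move=> [s s0 sQ]; exists s => // z zs; apply: sQ => a /zs.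
by rewrite dotNr oppr_eq0.
Qed.

Lemma generic_notin_span (J : {set 'I_m}) : (#|J| < d)%N ->
  generic (fun z => forall l : 'I_m -> R, z <> \sum_(i in J) l i *: x i).
Proof.
move=> Jd; pose A : 'M[R]_(#|J|, d) := \matrix_(k < #|J|) x (enum_val k).
have gen := generic_notin (A := A) (leq_ltn_trans (rank_leq_row A) Jd).
apply: generic_sub gen => z /negP nz l zE; apply: nz; rewrite zE.
apply: summx_sub => i iJ; apply: scalemx_sub.
have -> : x i = row (enum_rank_in iJ i) A by rewrite rowK enum_rankK_in.
exact: row_sub.
Qed.

End GenericSpans.

Lemma card_asbool (T : finType) (P : T -> Prop) :
  #|[pred v | `[< P v >] ]| = (\sum_v `[< P v >])%N.
Proof.
by rewrite -sum1_card big_mkcond; apply: eq_bigr => v _; rewrite inE; case: asboolP.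
Qed.

Section ProperCones.
Context {R : realType} {n m : nat} {Om : finType}.
Context {M : Om -> 'M[R]_n} {alpha : Om -> 'I_m -> 'rV[R]_n}.
Hypothesis csM : chamber_system M alpha.

Definition rank_count j := #|[pred w | \rank (1%:M - M w) == j]|.

Definition general_position d (Y : 'M[R]_(n, d)) :=
  (d <= m)%N /\ forall v (J : {set 'I_m}), #|J| = d ->
    indep (fun i => alpha v i *m Y) J.

Lemma generic_cell_count d (Y : 'M[R]_(n, d)) : general_position Y ->
  generic (fun z => forall j, (j < d)%N ->
    #|[pred v | `[< exists2 J : {set 'I_m}, #|J| = j &
        hits (fun i => alpha v i *m Y) J z >] ]| = rank_count j).
Proof.
move=> [dm gp]; apply: (generic_face_count csM).
  by move=> v J Jd; apply: (gp_indep dm (gp v)); apply: ltnW.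
by apply: generic_forall => v; apply: generic_dichotomy dm (gp v).
Qed.

Lemma generic_low_count d (Y : 'M[R]_(n, d)) : general_position Y ->
  generic (fun z => 
    #|[pred v | `[< exists2 J : {set 'I_m}, (#|J| < d)%N &
        hits (fun i => alpha v i *m Y) J z >] ]| = (\sum_(j < d) rank_count j)%N).
Proof.
move=> gp; apply: generic_sub (generic_cell_count gp) => z zc.
under eq_bigr do rewrite -zc// card_asbool.
rewrite card_asbool exchange_big; apply: eq_bigr => v _; rewrite /=.
have [[J Jd hJ]|nJ] := asboolP (exists2 J : {set 'I_m}, (#|J| < d)%N &
  hits (fun i => alpha v i *m Y) J z).
  rewrite (bigD1 (Ordinal Jd))//= asboolT; last by exists J.
  rewrite big1 ?addn0// => i iJ; rewrite asboolF// => -[K Ki hK].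
  by move: iJ; rewrite -val_eqE/= -Ki (hits_disjoint hK hJ) eqxx.
by rewrite big1// => i _; rewrite asboolF// => -[K Ki hK]; case: nJ; exists K; rewrite ?Ki.
Qed.

(** Projecting along a generic z splits the proper cones: either the image stays
proper, or exactly one of z, - z lies in the cone. The proper cones containing z
are those of which no face of fewer than d generators catches z, and these faces
are counted by generic_low_count; the same holds with the opposite of z. *)
Lemma proper_count d (Y : 'M[R]_(n, d)) (D : nat -> nat) : general_position Y ->
  D 0%N = 0%N ->
  (forall k, (k < d)%N -> D k.+1 + D k = 2 * \sum_(j < k.+1) rank_count j)%N ->
  #|[pred v | `[< pos (fun i => alpha v i *m Y) <> setT >] ]| = D d.
Proof.
elim: d Y => [|k IH] Y gpY D0 DS.
  rewrite D0; apply: eq_card0 => v; rewrite inE; apply/asboolP; apply.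
  apply/seteqP; split => // y _; exists (fun=> 0) => //.
  by apply/rowP => -[].
have [dm gp] := gpY.
set X := fun v i => alpha v i *m Y.
have gl := generic_low_count gpY.
have gd : generic (fun z => forall v, pos (X v) z \/
    exists2 J : {set 'I_m}, (#|J| < k.+1)%N & hits (X v) J z).
  by apply: generic_forall => v; apply: generic_dichotomy dm (gp v).
have gs : generic (fun z => forall v (J : {set 'I_m}), (#|J| < k.+1)%N ->
    forall l : 'I_m -> R, z <> \sum_(i in J) l i *: X v i).
  apply: generic_forall => v; apply: generic_forall => J; apply: generic_impl.
  exact: generic_notin_span.
have gn : generic (fun z : 'rV[R]_k.+1 => z != 0).
  have d0 : delta_mx 0 0 != 0 :> 'rV[R]_k.+1.
    by apply/eqP => /rowP/(_ 0); rewrite !mxE !eqxx => /eqP; rewrite oner_eq0.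
  apply: generic_sub (generic_hyperplane d0) => z.
  by apply: contraNneq => ->; rewrite dot0r.
have [z [[low low'] [[dich dich'] [span z0]]]] := generic_ex
  (generic_and (generic_and gl (generic_opp gl))
    (generic_and (generic_and gd (generic_opp gd)) (generic_and gs gn))).
have in_facet v u y : u != 0 -> (forall i, 0 <= dot u (X v i)) -> dot u y = 0 ->
    pos (X v) y -> exists2 J : {set 'I_m}, (#|J| < k.+1)%N &
      exists l : 'I_m -> R, y = \sum_(i in J) l i *: X v i.
  move=> u0 uX uy Xy; have [l _ yE] := (pos_annihilated _ uX).1 (conj Xy uy).
  exists [set i | dot u (X v i) == 0]%SET; last by exists l.
  rewrite ltnNge; apply: contra u0 => dJ; apply/eqP.
  by apply: (orthogonal_eq0 dm (gp v) dJ) => i; rewrite inE => /eqP.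
(* If u supports the cone and kills z, then z in the cone would lie on the face of
   u, which has at most k generators; a generic z is in no such span. *)
have not_z v u : u != 0 -> (forall i, 0 <= dot u (X v i)) -> dot u z = 0 ->
    ~ pos (X v) z /\ ~ pos (X v) (- z).
  move=> u0 uX uz; split=> [/(in_facet v u _ u0 uX uz)[J Jd [l]]|]; first exact: span.
  have uz' : dot u (- z) = 0 by rewrite dotNr uz oppr0.
  move=> /(in_facet v u _ u0 uX uz')[J Jd [l zE]].
  apply: (span v J Jd (fun i => - l i)); rewrite -[z]opprK zE -sumrN.
  by apply: eq_bigr => i _; rewrite scaleNr.
have [C [Cfree CP]] := orthogonal_basis z0.
pose Y' := Y *m C^T.
have X'E v i : alpha v i *m Y' = X v i *m C^T by rewrite /Y' mulmxA.
have dotX' v i (u : 'rV[R]_k) : dot u (alpha v i *m Y') = dot (u *m C) (X v i).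
  by rewrite X'E dot_mulmx.
have gpY' : general_position Y'.
  split=> [|v J Jk l lJ]; first exact: ltnW.
  apply: (gp_indep dm (gp v) (J := J)); first by rewrite Jk.
  have : (\sum_(i in J) l i *: X v i) *m C^T = 0.
    by rewrite -[RHS]lJ mulmx_suml; apply: eq_bigr => i _; rewrite X'E scalemxAl.
  move=> /(orthogonal_basis_kernel z0 CP)[a aE].
  have [a0|a0] := eqVneq a 0; first by rewrite aE a0 scale0r.
  case: (span v J _ (fun i => a^-1 * l i)); first by rewrite Jk.
  transitivity (a^-1 *: \sum_(i in J) l i *: X v i).
    by rewrite aE scalerA mulVf ?scale1r.
  by rewrite scaler_sumr; apply: eq_bigr => i _; rewrite scalerA.
have proper'P v : pos (fun i => alpha v i *m Y') <> setT <->
    pos (X v) <> setT /\ ~ pos (X v) z /\ ~ pos (X v) (- z).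
  split=> [/supporting[u u0 uX']|[XT [nz nz']]].
    have uC0 : u *m C != 0.
      apply: contraNneq u0 => uC0; apply/eqP/(row_free_inj Cfree).
      by rewrite /= uC0 mul0mx.
    have uX i : 0 <= dot (u *m C) (X v i) by rewrite -dotX'.
    have uz : dot (u *m C) z = 0 by apply/CP; apply: submxMl.
    by split; [apply: pos_neqT uC0 uX|apply: not_z uC0 uX uz].
  (* The combination of functionals separating z and - z that vanishes on z. *)
have [u1 u1X u1z] := farkas nz; have [u2 u2X u2z] := farkas nz'.
  pose u := dot u2 z *: u1 - dot u1 z *: u2.
  have u2z' : 0 < dot u2 z by move: u2z; rewrite dotNr oppr_lt0.
  have uz : dot u z = 0 by rewrite dotBl !dotZl; ring.
  have uXE i : dot u (X v i) = dot u2 z * dot u1 (X v i) - dot u1 z * dot u2 (X v i).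
    by rewrite dotBl !dotZl.
  have uX i : 0 <= dot u (X v i).
    by rewrite uXE; have := u1X i; have := u2X i; nra.
  have u0 : u != 0.
    apply/eqP => u0; have u1X0 i : dot u1 (X v i) = 0.
      have := uXE i; rewrite u0 dot0l; have := u1X i; have := u2X i; nra.
    have u10 : u1 = 0.
      apply: (orthogonal_eq0 dm (gp v) (J := [set: 'I_m]%SET)) => [|i _].
        by rewrite cardsT card_ord.
      exact: u1X0.
    by move: u1z; rewrite u10 dot0l ltxx.
  have /CP/submxP[u' u'E] := uz.
  apply: (@pos_neqT _ _ _ _ u') => [|i]; last by rewrite dotX' -u'E.
  by apply: contraNneq u0 => u'0; rewrite u'E u'0 mul0mx.
have never v : pos (X v) <> setT -> pos (X v) z -> ~ pos (X v) (- z).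
  move=> /supporting[u u0 uX] Xz Xz'.
  have uz : dot u z = 0.
    apply/eqP; rewrite eq_le (pos_dot_ge0 uX Xz) andbT -oppr_ge0 -dotNr.
    exact: pos_dot_ge0 uX Xz'.
  by have [] := not_z v u u0 uX uz.
have {}IH := IH Y' gpY' D0 (fun a ak => DS a (leqW ak)).
have DSk := DS k (leqnn _).
have split_z y : (forall v, pos (X v) y \/
      exists2 J : {set 'I_m}, (#|J| < k.+1)%N & hits (X v) J y) ->
    (\sum_v `[< pos (X v) <> setT >])%N =
    (\sum_v `[< pos (X v) <> setT /\ pos (X v) y >] +
     \sum_v `[< exists2 J : {set 'I_m}, (#|J| < k.+1)%N & hits (X v) J y >])%N.
  move=> dy; rewrite -big_split; apply: eq_bigr => v _ /=.
  have hit_not (J : {set 'I_m}) : (#|J| < k.+1)%N -> hits (X v) J y ->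
      pos (X v) <> setT /\ ~ pos (X v) y.
    by move=> Jd; apply: hits_notin; apply: leq_trans Jd dm.
  case: asboolP => pT; case: asboolP => pz; case: asboolP => pJ => //; exfalso.
  - by have [J Jd hJ] := pJ; have [_] := hit_not J Jd hJ; apply; case: pz.
  - by have [yv|//] := dy v; apply: pz.
  - by case: pz.
  - by case: pz.
  - by have [J Jd hJ] := pJ; have [] := hit_not J Jd hJ.
have split_proj : (\sum_v `[< pos (X v) <> setT >])%N =
    (\sum_v `[< pos (X v) <> setT /\ pos (X v) z >] +
     (\sum_v `[< pos (X v) <> setT /\ pos (X v) (- z) >] +
     \sum_v `[< pos (fun i => alpha v i *m Y') <> setT >]))%N.
  rewrite -!big_split; apply: eq_bigr => v _ /=.
  have nv := never v; have p'v := proper'P v.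
  case: asboolP => pT; case: asboolP => pz; case: asboolP => pz';
    case: asboolP => pT' => //; exfalso; move: nv p'v pz pz' pT'; tauto.
rewrite !card_asbool in low low' IH *.
have e1 := split_z z dich; have e2 := split_z (- z) dich'.
rewrite [X in (_ + X)%N]low in e1; rewrite [X in (_ + X)%N]low' in e2.
rewrite [X in (_ + (_ + X))%N]IH in split_proj.
by rewrite -[LHS]/(\sum_v `[< pos (X v) <> setT >])%N; lia.
Qed.

End ProperCones.

(** * Permutations and signed permutations *)

Section SignedFrames.
Context {R : realType} {n : nat}.
Implicit Types (e : 'I_n -> bool) (s : 'S_n) (xi c : 'rV[R]_n).

Definition frame e s : 'I_n -> 'rV[R]_n := signed_perm (fun i => delta_mx 0 i) e s.

Definition signed_perm_mx e s : 'M[R]_n := \matrix_i frame e s i.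

Lemma frameE e s i : frame e s i = (-1) ^+ e i *: delta_mx 0 (s i).
Proof. by []. Qed.

Lemma row_signed_perm_mx e s i : row i (signed_perm_mx e s) = frame e s i.
Proof. exact: rowK. Qed.

Lemma dot_frame_coord e s i xi : dot xi (frame e s i) = (-1) ^+ e i * xi 0 (s i).
Proof. by rewrite frameE dotZr dot_delta. Qed.

Lemma signN_sqr (b : bool) : (-1) ^+ b * (-1) ^+ b = 1 :> R.
Proof. by rewrite -signr_addb addbb. Qed.

Lemma dot_frame e s i j : dot (frame e s i) (frame e s j) = (i == j)%:R.
Proof.
rewrite dot_frame_coord frameE !mxE eqxx /= (inj_eq perm_inj) eq_sym.
by case: eqVneq => [->|]; rewrite ?mulr1 ?signN_sqr// !mulr0.
Qed.

Lemma frame_mul e s e' s' i : frame e s i *m signed_perm_mx e' s' =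
  frame (fun i => e i (+) e' (s i)) (s * s')%g i.
Proof.
rewrite frameE -scalemxAl -rowE row_signed_perm_mx !frameE scalerA -signr_addb.
by rewrite permM.
Qed.

Lemma signed_perm_mxM e s e' s' : signed_perm_mx e s *m signed_perm_mx e' s' =
  signed_perm_mx (fun i => e i (+) e' (s i)) (s * s')%g.
Proof. by apply/row_matrixP => i; rewrite row_mul !row_signed_perm_mx frame_mul. Qed.

Lemma eq_signed_perm_mx e e' s : e =1 e' -> signed_perm_mx e s = signed_perm_mx e' s.
Proof.
by move=> ee'; apply/row_matrixP => i; rewrite !row_signed_perm_mx !frameE ee'.
Qed.

Lemma signed_perm_mx1 : signed_perm_mx (fun=> false) 1%g = 1%:M.
Proof.
apply/row_matrixP => i; rewrite row_signed_perm_mx frameE expr0 scale1r perm1.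
by rewrite row1.
Qed.

Lemma signed_perm_mx_orth e s : signed_perm_mx e s *m (signed_perm_mx e s)^T = 1%:M.
Proof.
apply/matrixP => i j; rewrite mxE [RHS]mxE -(dot_frame e s).
by apply: eq_bigr => k _; rewrite !mxE.
Qed.

Lemma signed_perm_mx_tr e s : (signed_perm_mx e s)^T =
  signed_perm_mx (fun i => e ((s^-1)%g i)) s^-1%g.
Proof.
rewrite -[LHS]mulmx1 -signed_perm_mx1 -(mulgV s).
have -> : signed_perm_mx (fun=> false) (s * s^-1)%g =
    signed_perm_mx e s *m signed_perm_mx (fun i => e ((s^-1)%g i)) s^-1%g.
  by rewrite signed_perm_mxM; apply: eq_signed_perm_mx => i; rewrite permK addbb.
by rewrite mulmxA (mulmx1C (signed_perm_mx_orth e s)) mul1mx.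
Qed.

Lemma frame_inj e s e' s' i j : frame e s i = frame e' s' j ->
  s i = s' j /\ e i = e' j.
Proof.
move=> /rowP/(_ (s i)); rewrite !frameE !mxE !eqxx /= mulr1.
case: eqVneq => [sE|_]; last by rewrite mulr0 => /eqP; rewrite signr_eq0.
by rewrite mulr1 => /signr_inj.
Qed.

Lemma frame_basis e s xi : (forall i, dot xi (frame e s i) = 0) -> xi = 0.
Proof.
move=> xif; apply/rowP => k; rewrite mxE; have := xif ((s^-1)%g k).
rewrite dot_frame_coord permKV => /eqP; rewrite mulf_eq0 signr_eq0.
by move=> /eqP.
Qed.

(** The fundamental weights, dual to the simple roots genB; the coefficient of a
simple root is a pairing with a weight, that is a partial sum of coordinates. *)
Definition weight e s (k : 'I_n) := \sum_(i < n | (i <= k)%N) frame e s i.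

Lemma dot_weight_frame e s k i : dot (weight e s k) (frame e s i) = (i <= k)%:R.
Proof.
rewrite dot_suml; have [ik|ik] := boolP (i <= k)%N.
  rewrite (bigD1 i)//= dot_frame eqxx big1 ?addr0// => j /andP[_ ji].
  by rewrite dot_frame (negPf ji).
rewrite big1// => j jk; rewrite dot_frame; case: eqVneq => // ji.
by rewrite -ji jk in ik.
Qed.

Lemma val_ordS (i : 'I_n) : i.+1 != n -> ordS i = i.+1 :> nat.
Proof.
by move=> ni; rewrite /= modn_small// ltn_neqAle ni /=.
Qed.

Lemma dot_weight_genB e s k i : dot (weight e s k) (genB (frame e s) i) = (i == k)%:R.
Proof.
rewrite /genB; case: eqVneq => [ni|ni]; last first.
  rewrite dotBr !dot_weight_frame val_ordS// -val_eqE/=.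
  by case: ltngtP => _; rewrite ?subr0 ?subrr.
have ki : (k <= i)%N by have := ltn_ord k; lia.
by rewrite dot_weight_frame -val_eqE/= eqn_leq ki andbT.
Qed.

Lemma genB_expansion e s c : c = \sum_k dot (weight e s k) c *: genB (frame e s) k.
Proof.
apply/eqP; rewrite -subr_eq0; apply/eqP; set r := _ - _.
have wr k : dot (weight e s k) r = 0.
  rewrite dotBr dot_sumr (bigD1 k)//= dotZr dot_weight_genB eqxx mulr1.
  rewrite big1 ?addr0 ?subrr// => j jk.
  by rewrite dotZr dot_weight_genB (negPf jk) mulr0.
apply: (@frame_basis e s) => i; rewrite dotC.
have weightS (k : 'I_n) : weight e s k =
    frame e s k + \sum_(j < n | (j < k)%N) frame e s j.
  rewrite /weight (bigD1 k)//=; congr (_ + _); apply: eq_bigl => j.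
  by rewrite -val_eqE/= ltn_neqAle andbC.
have [i0|i0] := posnP i.
  by rewrite -(wr i) weightS big1 ?addr0// => j; rewrite i0.
have i1 : (i.-1 < n)%N by apply: leq_ltn_trans (leq_pred _) (ltn_ord i).
have := wr i; rewrite weightS dotDl => <-; rewrite -[LHS]addr0; congr (_ + _).
rewrite -(wr (Ordinal i1)); congr (dot _ _); apply: eq_bigl => j /=.
by case: (val i) i0.
Qed.

(** w^-1 permutes the frame of v up to signs, by the conjugate of w^-1 by v. No sign
appears if v and w have none, and a trivial u forces w = 1. *)
Lemma frame_conjugate e s e' s' : exists u : ('I_n -> bool) * 'S_n,
  [/\ forall i, frame e s i *m (signed_perm_mx e' s')^T =
        (-1) ^+ u.1 i *: frame e s (u.2 i),
      (e =1 xpred0 -> e' =1 xpred0 -> u.1 =1 xpred0) &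
      (u.1 =1 xpred0 -> u.2 = 1%g -> signed_perm_mx e' s' = 1%:M)].
Proof.
set Mv := signed_perm_mx e s; set Mw := signed_perm_mx e' s'.
pose u2 := (s * s'^-1 * s^-1)%g.
pose u1 i := e i (+) e' ((s'^-1)%g (s i)) (+) e (u2 i).
have uE : signed_perm_mx u1 u2 = Mv *m Mw^T *m Mv^T.
  rewrite !signed_perm_mx_tr !signed_perm_mxM; apply: eq_signed_perm_mx => i.
  by rewrite /u1 /u2 !permM.
have VV : Mv^T *m Mv = 1%:M by apply/mulmx1C/signed_perm_mx_orth.
exists (u1, u2); split=> [i|e0 e0' i|u10 u20] /=.
- have -> : frame e s i *m Mw^T = row i (signed_perm_mx u1 u2 *m Mv).
    by rewrite uE -!mulmxA VV mulmx1 row_mul row_signed_perm_mx.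
  by rewrite row_mul row_signed_perm_mx frameE -scalemxAl -rowE row_signed_perm_mx.
- by rewrite /u1 !e0 e0'.
have : signed_perm_mx u1 u2 = 1%:M.
  by rewrite /= in u10 u20; rewrite u20 (eq_signed_perm_mx _ u10) signed_perm_mx1.
rewrite uE => /(congr1 (fun A => Mv^T *m A *m Mv)).
rewrite !mulmxA VV mul1mx -mulmxA VV !mulmx1.
rewrite VV => /(congr1 trmx); rewrite trmxK trmx1 //.
Qed.

End SignedFrames.

Section Rearrangement.
Context {R : realType} {n : nat}.

Lemma ord_decreasing (h : 'I_n -> R) :
  (forall i j : 'I_n, j = i.+1 :> nat -> h j < h i) ->
  forall i j : 'I_n, (i < j)%N -> h j < h i.
Proof.
move=> hS i j ij.
move: {-1}(j - i.+1)%N (erefl (j - i.+1)%N) => k.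
elim: k j ij => [|k IH] j ij kE.
  by apply: hS; apply/eqP; rewrite eqn_leq ij andbT -subn_eq0 kE.
have j1 : (j.-1 < n)%N by apply: leq_ltn_trans (leq_pred _) (ltn_ord j).
apply: (@lt_trans _ _ (h (Ordinal j1))); first by apply: hS => /=; lia.
by apply: IH => /=; lia.
Qed.

(** Among all sets of k+1 values of a decreasing sequence the first ones have the
largest sum: the exchanged terms are at most h k, those they replace at least. *)
Lemma partial_sum_perm (h : 'I_n -> R) (s : 'S_n) (k : 'I_n) :
  (forall i j : 'I_n, (i < j)%N -> h j < h i) ->
  \sum_(i < n | (i <= k)%N) h (s i) <= \sum_(i < n | (i <= k)%N) h i.
Proof.
move=> hd; pose g i := h i - h k.
have gs (f : 'I_n -> 'I_n) : \sum_(i < n | (i <= k)%N) h (f i) =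
    \sum_(i < n | (i <= k)%N) g (f i) + \sum_(i < n | (i <= k)%N) h k.
  by rewrite -big_split/=; apply: eq_bigr => i _; rewrite subrK.
rewrite (gs s) (gs id) lerD2r.
have g_pos (i : 'I_n) : (i <= k)%N -> 0 <= g i.
  by rewrite subr_ge0 leq_eqVlt => /orP[/eqP/val_inj->//|/hd/ltW].
have g_neg (i : 'I_n) : ~~ (i <= k)%N -> g i <= 0.
  by rewrite -ltnNge subr_le0 => /hd/ltW.
rewrite [leLHS](bigID (fun i => s i <= k)%N)/=.
apply: (@le_trans _ _ (\sum_(i < n | (i <= k)%N && (s i <= k)%N) g (s i))).
  by rewrite gerDl sumr_le0// => i /andP[_ /g_neg].
apply: (@le_trans _ _ (\sum_(i < n | (s i <= k)%N) g (s i))).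
  rewrite [leRHS](bigID (fun i : 'I_n => i <= k)%N)/=.
  under [X in _ <= X + _]eq_bigl do rewrite andbC.
  by rewrite lerDl sumr_ge0// => i /andP[/g_pos].
by rewrite [leRHS](reindex_inj (@perm_inj _ s)).
Qed.

Lemma full_sum_perm (h : 'I_n -> R) (s : 'S_n) : \sum_i h (s i) = \sum_i h i.
Proof. by rewrite [RHS](reindex_inj (@perm_inj _ s)). Qed.

End Rearrangement.

Section Labels.
Context {R : realType} {n : nat} {S : finType}.
Variables (sg : S -> bool) (addS : S -> S -> S).
Hypothesis sg_inj : injective sg.
Hypothesis sg_add : forall a b, sg (addS a b) = sg a (+) sg b.

(** S is unit in type A and bool in type B, and sg reads a sign from it. *)
Definition label := ({ffun 'I_n -> S} * 'S_n)%type.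
Implicit Types v w : label.

Definition label_frame v : 'I_n -> 'rV[R]_n := frame (sg \o v.1) v.2.
Definition label_mx v : 'M[R]_n := signed_perm_mx (sg \o v.1) v.2.

Lemma label_mx_inj : injective label_mx.
Proof.
move=> [e s] [e' s'] eqM.
have eqf i : frame (sg \o e) s i = frame (sg \o e') s' i :> 'rV[R]_n.
  by rewrite -!row_signed_perm_mx; congr row.
congr pair; last by apply/permP => i; have [] := frame_inj (eqf i).
by apply/ffunP => i; apply: sg_inj; have [] := frame_inj (eqf i).
Qed.

Lemma label_mx_mul v w : exists u, label_mx u = label_mx v *m label_mx w.
Proof.
exists ([ffun i => addS (v.1 i) (w.1 (v.2 i))], v.2 * w.2)%g.
rewrite /label_mx signed_perm_mxM; apply: eq_signed_perm_mx => i /=.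
by rewrite ffunE sg_add.
Qed.

Lemma label_mx_tr w : exists u, label_mx u = (label_mx w)^T.
Proof.
exists ([ffun i => w.1 ((w.2^-1)%g i)], w.2^-1)%g.
rewrite /label_mx signed_perm_mx_tr; apply: eq_signed_perm_mx => i /=.
by rewrite ffunE.
Qed.

Lemma label_mx_div v w : exists u, label_mx u = label_mx v *m (label_mx w)^T.
Proof. by have [u <-] := label_mx_tr w; apply: label_mx_mul. Qed.

(** Decreasing positive weights: swapping neighbours changes rho by a simple root,
and changing the sign of the last vector changes it by twice that vector. *)
Definition rho (f : 'I_n -> 'rV[R]_n) := \sum_(i < n) (n - i)%:R *: f i.

Lemma rho_swap (f : 'I_n -> 'rV[R]_n) (i j : 'I_n) : j = i.+1 :> nat ->
  rho (f \o tperm i j) = rho f - (f i - f j).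
Proof.
move=> ji; have ij : j != i by rewrite -val_eqE/= ji -addn1 -{2}[val i]addn0 eqn_add2l.
rewrite /rho (bigD1 i)//= [in RHS](bigD1 i)//= (bigD1 j)//= [in RHS](bigD1 j)//=.
rewrite tpermL tpermR (eq_bigr (fun k : 'I_n => (n - k)%:R *: f k)) => [|k /andP[ki kj]].
  have -> : (n - i)%N = (n - j).+1 by have := ltn_ord j; lia.
  rewrite -natr1 !scalerDl !scale1r.
  move: (_ *: f i) (_ *: f j) (\sum_(_ < _ | _) _) => a b c.
  by apply/rowP => k; rewrite !mxE; ring.
by rewrite tpermD// eq_sym.
Qed.

Lemma label_swap v (t : 'S_n) : exists u, label_frame u = label_frame v \o t.
Proof.
exists ([ffun k => v.1 (t k)], (t * v.2)%g); apply/funext => k.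
by rewrite /label_frame !frameE /= ffunE permM.
Qed.

Lemma genB_step (f : 'I_n -> 'rV[R]_n) (i j : 'I_n) : j = i.+1 :> nat ->
  genB f i = f i - f j.
Proof.
move=> ji; have ni : i.+1 != n by rewrite -ji neq_ltn ltn_ord.
by rewrite /genB (negPf ni); congr (_ - f _); apply: ord_inj; rewrite val_ordS// ji.
Qed.

Lemma genB_last (f : 'I_n -> 'rV[R]_n) (i : 'I_n) : i.+1 = n -> genB f i = f i.
Proof. by move=> ni; rewrite /genB ni eqxx. Qed.

Lemma genA_genB (f : 'I_n -> 'rV[R]_n) (i : 'I_n.-1) :
  genA f i = genB f (widen_ord (leq_pred n) i).
Proof.
rewrite /genA /genB ifF//; apply/negbTE; rewrite neq_ltn /=.
by have := ltn_ord i; lia.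
Qed.

(** A label maximising the pairing with rho sorts xi: a swap of neighbours that
are out of order would increase the pairing. *)
Lemma maximal_label (v0 : label) (xi : 'rV[R]_n) : exists v,
  (forall u, dot xi (rho (label_frame u)) <= dot xi (rho (label_frame v))) /\
  forall i j : 'I_n, j = i.+1 :> nat -> 0 <= dot xi (genB (label_frame v) i).
Proof.
have [v _ vmax] := @arg_maxP _ _ _ v0 xpredT
  (fun u => dot xi (rho (label_frame u))) isT.
exists v; split=> [u|i j ji]; first exact: (vmax u).
have [u uE] := label_swap v (tperm i j).
have := vmax u isT; rewrite uE (rho_swap _ ji) dotBr -(genB_step _ ji).
by rewrite /= gerBl.
Qed.

Lemma dominant_decreasing v xi :
  (forall i j : 'I_n, j = i.+1 :> nat -> 0 < dot xi (genB (label_frame v) i)) ->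
  forall i j : 'I_n, (i < j)%N -> dot xi (label_frame v j) < dot xi (label_frame v i).
Proof.
move=> xid; apply: ord_decreasing => i j ji.
by have := xid i j ji; rewrite (genB_step _ ji) dotBr subr_gt0.
Qed.

(** The pairing of a weight with xi w is a partial sum of permuted and signed
coordinates of xi, which is largest for the identity when xi is dominant. *)
Lemma weight_descent v w xi k :
  (forall i j : 'I_n, (i < j)%N -> dot xi (label_frame v j) < dot xi (label_frame v i)) ->
  (forall a : S, sg a = false) \/ (forall i, 0 <= dot xi (label_frame v i)) ->
  0 <= dot (weight (sg \o v.1) v.2 k) (xi - xi *m label_mx w).
Proof.
set h := fun i => dot xi (label_frame v i) => hd pos_or.
have [[e s] /= [uE u0 _]] := @frame_conjugate R n (sg \o v.1) v.2 (sg \o w.1) w.2.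
have fh i : dot (label_frame v i) xi = h i by rewrite dotC.
rewrite dotBr subr_ge0 !dot_suml.
apply: (@le_trans _ _ (\sum_(i < n | (i <= k)%N) h (s i))); last first.
  by under [leRHS]eq_bigr do rewrite fh; apply: partial_sum_perm.
apply: ler_sum => i _; rewrite dotC dot_mulmx uE dotZr -/(label_frame v _).
rewrite -/(h (s i)); have [S0|h0] := pos_or.
  by rewrite u0 ?expr0 ?mul1r// => a; rewrite /= S0.
case: (e i); rewrite ?expr0 ?mul1r// expr1 mulN1r.
by apply: (@le_trans _ _ 0); rewrite ?oppr_le0; apply: h0.
Qed.

Lemma regular_label v w xi :
  (forall i j : 'I_n, (i < j)%N -> dot xi (label_frame v j) < dot xi (label_frame v i)) ->
  (forall a : S, sg a = false) \/ (forall i, 0 < dot xi (label_frame v i)) ->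
  xi *m label_mx w = xi -> label_mx w = 1%:M.
Proof.
set h := fun i => dot xi (label_frame v i) => hd pos_or xiw.
have [[e s] /= [uE u0 u1]] := @frame_conjugate R n (sg \o v.1) v.2 (sg \o w.1) w.2.
have hE i : h i = (-1) ^+ e i * h (s i).
  rewrite {1}/h -[in LHS]xiw dot_mulmx uE dotZr //.
have e0 : e =1 xpred0.
  have [S0|h0] := pos_or; first by apply: u0 => a; rewrite /= S0.
  move=> i; apply/negbTE/negP => ei; have := hE i; rewrite ei expr1 mulN1r.
  by have := h0 i; have := h0 (s i); rewrite -/(h i) -/(h (s i)); lra.
apply: u1 => //; apply/permP => i; rewrite perm1.
have := hE i; rewrite e0 expr0 mul1r => hs.
case: (ltngtP (s i) i) => [/hd|/hd|/val_inj//]; rewrite -/(h i) -/(h (s i)) hs.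
  by rewrite ltxx.
by rewrite ltxx.
Qed.

End Labels.

Section TypeB.
Context {R : realType} {n : nat}.
Local Notation lab := (@label n bool).
Local Notation lframe := (label_frame (R := R) (n := n) (@id bool)).

Definition rootB (v : lab) (i : 'I_n) : 'rV[R]_n := genB (lframe v) i.

Lemma label_flip (v : lab) (i : 'I_n) : exists u : lab, forall k,
  lframe u k = if k == i then - lframe v k else lframe v k.
Proof.
exists ([ffun k => if k == i then ~~ v.1 k else v.1 k], v.2) => k.
rewrite /label_frame !frameE /= ffunE; case: eqP => // _.
by case: (v.1 k); rewrite /= ?expr0 ?expr1 ?scaleN1r ?opprK ?scale1r.
Qed.

Lemma rootB_positive (v : lab) xi : (forall i, 0 < dot xi (rootB v i)) ->
  (forall i j : 'I_n, (i < j)%N -> dot xi (lframe v j) < dot xi (lframe v i)) /\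
  forall i, 0 < dot xi (lframe v i).
Proof.
move=> xid.
have dec := dominant_decreasing (v := v) (xi := xi) (sg := @id bool) (fun i j _ => xid i).
split=> // i; have n0 : (n.-1 < n)%N by have := ltn_ord i; lia.
have last_gt0 : 0 < dot xi (lframe v (Ordinal n0)).
  have := xid (Ordinal n0); rewrite /rootB genB_last//=.
  by have := ltn_ord i; lia.
have [ilt|ige] := ltnP i n.-1; first exact: lt_trans last_gt0 (dec i (Ordinal n0) ilt).
have -> : i = Ordinal n0 by apply: val_inj => /=; have := ltn_ord i; lia.
by [].
Qed.

Lemma chamber_systemB : chamber_system (label_mx (R := R) (@id bool)) rootB.
Proof.
split.
- by move=> w; apply: signed_perm_mx_orth.
- exact: label_mx_inj.
- exact: (label_mx_div (addS := addb)).
- move=> v l l0 k.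
  have := congr1 (fun c => dot (weight (id \o v.1) v.2 k) c) l0.
  rewrite dot0r dot_sumr (bigD1 k)//= dotZr dot_weight_genB eqxx mulr1.
  rewrite big1 ?addr0// => j jk.
  by rewrite dotZr dot_weight_genB (negPf jk) mulr0.
- move=> xi reg; have [v [vmax vge]] := maximal_label (@id bool)
    ([ffun=> false], 1%g) xi.
  exists v => i; rewrite lt_def reg /=.
  have [ni|ni] := eqVneq i.+1 n; last first.
    have ji : (i.+1 < n)%N by rewrite ltn_neqAle ni ltn_ord.
    exact: (vge i (Ordinal ji)).
  rewrite /rootB genB_last//; have [u uE] := label_flip v i.
  have := vmax u; rewrite /rho !dot_sumr (bigD1 i)//= [in leRHS](bigD1 i)//=.
  rewrite (eq_bigr (fun k : 'I_n => dot xi ((n - k)%:R *: lframe v k))) => [|k ki].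
    have -> : (n - i)%N = 1%N by lia.
    by rewrite lerD2r uE eqxx !scale1r dotNr; lra.
  by rewrite uE (negPf ki).
- move=> v w xi xid; have [dec pos] := rootB_positive xid.
  exists (fun k => dot (weight (id \o v.1) v.2 k) (xi - xi *m label_mx id w)).
    move=> k; apply: weight_descent => //; right => i; exact: ltW.
  exact: genB_expansion.
- move=> v w xi xid; have [dec pos] := rootB_positive xid.
  by apply: (regular_label (v := v)) => //; right.
Qed.

End TypeB.

Lemma sum_widen_pred (V : nmodType) n (F : 'I_n -> V) :
  (forall k : 'I_n, k.+1 = n -> F k = 0) ->
  \sum_k F k = \sum_(k < n.-1) F (widen_ord (leq_pred n) k).
Proof.
case: n F => [|n] F F0; first by rewrite !big_ord0.
rewrite big_ord_recr/= F0// addr0; apply: eq_bigr => i _.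
by congr F; apply: val_inj.
Qed.

Section TypeA.
Context {R : realType} {n : nat}.
Local Notation lab := (@label n unit).
Local Notation sgu := (fun _ : unit => false).
Local Notation lframe := (label_frame (R := R) (n := n) sgu).

Definition rootA (v : lab) (i : 'I_n.-1) : 'rV[R]_n := genA (lframe v) i.

Lemma rootA_genB v (i j : 'I_n) : j = i.+1 :> nat ->
  exists i', genB (lframe v) i = rootA v i'.
Proof.
move=> ji; have i' : (i < n.-1)%N by have := ltn_ord j; lia.
exists (Ordinal i'); rewrite /rootA genA_genB; congr genB; exact: val_inj.
Qed.

Lemma chamber_systemA : chamber_system (label_mx (R := R) sgu) rootA.
Proof.
have decr v xi : (forall i, 0 < dot xi (rootA v i)) ->
    forall i j : 'I_n, (i < j)%N -> dot xi (lframe v j) < dot xi (lframe v i).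
  move=> xid; apply: dominant_decreasing => i j ji.
  by have [i' ->] := rootA_genB v ji.
split.
- by move=> w; apply: signed_perm_mx_orth.
- by apply: label_mx_inj => -[] [].
- by apply: (label_mx_div (addS := fun _ _ => tt)).
- move=> v l l0 k.
  have := congr1 (fun c => dot (weight (sgu \o v.1) v.2 (widen_ord (leq_pred n) k)) c) l0.
  rewrite dot0r dot_sumr (bigD1 k)//= dotZr /rootA genA_genB dot_weight_genB eqxx mulr1.
  rewrite big1 ?addr0// => j jk; rewrite dotZr genA_genB dot_weight_genB.
  by rewrite -val_eqE/= val_eqE (negPf jk) mulr0.
- move=> xi reg; have [v [vmax vge]] := maximal_label sgu
    ([ffun=> tt], 1%g) xi.
  exists v => i; rewrite lt_def reg /= /rootA genA_genB.
  have ji : (i.+1 < n)%N by have := ltn_ord i; lia.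
  exact: (vge _ (Ordinal ji)).
- move=> v w xi /decr dec.
  pose l k := dot (weight (sgu \o v.1) v.2 k) (xi - xi *m label_mx sgu w).
  exists (fun k => l (widen_ord (leq_pred n) k)).
    by move=> k; apply: weight_descent => //; left.
  transitivity (\sum_k l k *: genB (lframe v) k); first exact: genB_expansion.
  (* The full sum of a frame is fixed by w, so the last of the n coefficients
     vanishes and n - 1 simple roots suffice. *)
  have l_last (k : 'I_n) : k.+1 = n -> l k = 0.
    move=> kn; rewrite /l dotBr; apply/eqP; rewrite subr_eq0; apply/eqP.
    have [[e s] /= [uE u0 _]] :=
      @frame_conjugate R n (sgu \o v.1) v.2 (sgu \o w.1) w.2.
    have wE : weight (sgu \o v.1) v.2 k = \sum_i lframe v i.
      by apply: eq_bigl => i; have := ltn_ord i; rewrite -[in X in (_ < X)%N]kn ltnS.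
    rewrite wE !dot_suml -(full_sum_perm _ s); apply: eq_bigr => i _.
    by rewrite [RHS]dotC [RHS]dot_mulmx uE u0// expr0 scale1r dotC.
  rewrite sum_widen_pred => [|k /l_last->]; last by rewrite scale0r.
  by apply: eq_bigr => i _; rewrite /rootA genA_genB.
- move=> v w xi /decr dec; apply: (regular_label (v := v)) => //; by left.
Qed.

End TypeA.

(** * Counting ranks *)

(** The root a is not in im (1 - W), since e is fixed by W and not orthogonal to a;
and e (1 - W (1 - k a^T a)) is a multiple of a, so the factor 1 - k a^T a adds
exactly a to the image. *)
Lemma rank_reflection (R : realType) N (W : 'M[R]_N) (e a : 'rV[R]_N) k :
  e *m W = e -> W *m e^T = e^T -> k != 0 -> dot a e != 0 ->
  \rank (1%:M - W *m (1%:M - k *: (a^T *m a))) = (\rank (1%:M - W)).+1.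
Proof.
move=> eW We k0 ae; set B := 1%:M - _.
have BE : B = (1%:M - W) + (k *: (W *m a^T)) *m a.
  rewrite /B mulmxBr mulmx1 opprB addrA -scalemxAr mulmxA -scalemxAl.
  by rewrite addrAC [RHS]addrC addrA addrAC [_ + 1%:M]addrC.
have aB : (a <= B)%MS.
  have -> : a = (k * dot e a)^-1 *: (e *m B).
    have -> : e *m B = (k * dot e a) *: a.
      rewrite BE mulmxDr mulmxBr mulmx1 eW subrr add0r mulmxA -scalemxAr mulmxA eW.
      rewrite -scalemxAl -scalerA; congr (k *: _).
      have -> : e *m a^T = (dot e a)%:M.
        by apply/rowP => i; rewrite ord1 -dotE mxE eqxx mulr1n.
      by rewrite mul_scalar_mx.
    by rewrite scalerA mulVf ?scale1r// mulf_neq0// dotC.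
  by rewrite scalemx_sub// submxMl.
have BD : (B :=: (1%:M - W) + a)%MS.
  apply/eqmxP/andP; split.
    by rewrite BE addmx_sub_adds// ?submx_refl ?submxMl.
  rewrite addsmx_sub aB andbT.
  have -> : 1%:M - W = B - (k *: (W *m a^T)) *m a by rewrite BE addrK.
  by rewrite addmx_sub ?submx_refl// eqmx_opp (submx_trans (submxMl _ _) aB).
have anW : ~~ (a <= 1%:M - W)%MS.
  apply/negP => /submxP[z aE]; move: ae; rewrite aE dotE -mulmxA mulmxBl mul1mx We.
  by rewrite subrr mulmx0 mxE eqxx.
have a0 : a != 0 by apply: contraNneq anW => ->; apply: sub0mx.
rewrite BD; have := mxrank_sum_cap (1%:M - W) a; rewrite rank_rV a0 addn1 => <-.
suff -> : \rank ((1%:M - W) :&: a)%MS = 0%N by rewrite addn0.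
apply/eqP; rewrite -leqn0 -ltnS ltn_neqAle; apply/andP; split; last first.
  by have := mxrankS (capmxSr (1%:M - W) a); rewrite rank_rV a0.
apply: contra anW => /eqP r1.
have /mxrank_leqif_eq := capmxSr (1%:M - W) a.
rewrite rank_rV a0 r1 => -[_]; rewrite eqxx => /esym/eqmxP aE.
by rewrite -aE capmxSl.
Qed.

Section RankCounts.
Context {R : realType} {S : finType}.
Variables (s0 : S) (sg : S -> bool) (addS : S -> S -> S).
Hypothesis sg_inj : injective sg.
Hypothesis sg0 : sg s0 = false.
Hypothesis sg_add : forall a b, sg (addS a b) = sg a (+) sg b.

Local Notation mx v := (label_mx (R := R) sg v).

(** Embeds the smaller group as the stabiliser of the last basis vector. *)
Definition lift_label n (v : @label n S) : @label n.+1 S :=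
  ([ffun j => if unlift ord_max j is Some k then v.1 k else s0],
   lift_perm ord_max ord_max v.2).

(** Coset representatives: swap_label (i, b) sends the last basis vector to the i-th
one up to the sign of b. *)
Definition swap_label n (p : 'I_n.+1 * S) : @label n.+1 S :=
  ([ffun j => if (j == p.1) || (j == ord_max) then p.2 else s0],
   tperm p.1 ord_max).

Lemma frame_lift_max n (v : @label n S) :
  label_frame sg (lift_label v) ord_max = delta_mx 0 ord_max :> 'rV[R]_n.+1.
Proof.
rewrite /label_frame frameE /= ffunE unlift_none sg0 expr0 scale1r.
by rewrite lift_perm_id.
Qed.

Lemma frame_lift n (v : @label n S) i :
  label_frame sg (lift_label v) (lift ord_max i) =
  (-1) ^+ sg (v.1 i) *: delta_mx 0 (lift ord_max (v.2 i)) :> 'rV[R]_n.+1.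
Proof. by rewrite /label_frame frameE /= ffunE liftK lift_perm_lift. Qed.

Lemma rank_lift n (v : @label n S) :
  \rank (1%:M - mx (lift_label v)) = \rank (1%:M - mx v)%R.
Proof.
pose E : 'M[R]_(n, n.+1) := \matrix_i delta_mx 0 (lift ord_max i).
have dE (i : 'I_n) : delta_mx 0 i *m E = delta_mx 0 (lift ord_max i) :> 'rV[R]_n.+1.
  by rewrite -rowE rowK.
have dET (i : 'I_n) : delta_mx 0 (lift ord_max i) *m E^T = delta_mx 0 i :> 'rV[R]_n.
  apply/rowP => j; rewrite -rowE !mxE eqxx /= eq_sym.
  by rewrite (inj_eq lift_inj) eq_sym.
have dmax : delta_mx 0 ord_max *m E^T = 0 :> 'rV[R]_n.
  by apply/rowP => j; rewrite -rowE !mxE eqxx /= eq_liftF.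
have EE : E *m E^T = 1%:M.
  by apply/row_matrixP => i; rewrite row_mul rowK dET row1.
have -> : 1%:M - mx (lift_label v) = E^T *m (1%:M - mx v) *m E.
  apply/row_matrixP => j; rewrite [RHS]rowE !mulmxA raddfB/= row1 row_signed_perm_mx.
  rewrite -/(label_frame sg (lift_label v)).
  case: (unliftP ord_max j) => [i ->|->].
    rewrite frame_lift dET mulmxBr mulmx1 mulmxBl dE; congr (_ - _).
    by rewrite -rowE row_signed_perm_mx frameE -scalemxAl dE.
  by rewrite frame_lift_max dmax !mul0mx subrr.
have Efree : row_free E by apply/row_freeP; exists E^T.
rewrite mxrankMfree// -mxrank_tr trmx_mul trmxK mxrankMfree// mxrank_tr //.
Qed.

Lemma frame_swap_max n (p : 'I_n.+1 * S) :
  label_frame sg (swap_label p) ord_max = (-1) ^+ sg p.2 *: delta_mx 0 p.1 :> 'rV[R]_n.+1.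
Proof. by rewrite /label_frame frameE /= ffunE eqxx orbT tpermR. Qed.

Lemma swap_label_id n : mx (swap_label (ord_max : 'I_n.+1, s0)) = 1%:M.
Proof.
rewrite /label_mx /= tperm1 -signed_perm_mx1; apply: eq_signed_perm_mx => i /=.
by rewrite ffunE; case: ifP.
Qed.

Lemma swap_label_reflection n (p : 'I_n.+1 * S) : p != (ord_max, s0) ->
  exists k (a : 'rV[R]_n.+1), [/\ k != 0, dot a (delta_mx 0 ord_max) != 0 &
    mx (swap_label p) = 1%:M - k *: (a^T *m a)].
Proof.
case: p => i b pid.
have rowE' k (a : 'rV[R]_n.+1) j :
    row j (1%:M - k *: (a^T *m a)) = delta_mx 0 j - (k * a 0 j) *: a.
  rewrite raddfB/= row1 linearZ/= row_mul -scalerA; congr (_ - k *: _).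
  have -> : row j a^T = (a 0 j)%:M.
    by apply/rowP => c; rewrite ord1 !mxE eqxx mulr1n.
  by rewrite mul_scalar_mx.
have [iM|iM] := eqVneq i ord_max.
  have sb : sg b = true.
    apply/negPn/negP => /negbTE sbF; move/eqP: pid; apply; congr pair => //.
    by apply: sg_inj; rewrite sg0.
  exists 2, (delta_mx 0 ord_max); split.
  - by rewrite pnatr_eq0.
  - by rewrite dot_delta mxE !eqxx oner_neq0.
  apply/row_matrixP => j; rewrite rowE' row_signed_perm_mx frameE /= ffunE iM tperm1.
  rewrite perm1 orbb mxE eqxx /=; case: eqVneq => [->|_]; last first.
    by rewrite sg0 expr0 scale1r mulr0 scale0r subr0.
  by rewrite sb expr1 mulr1 scaler_nat mulr2n opprD addrA subrr add0r scaleN1r.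
pose t : R := (-1) ^+ sg b; have tt : t * t = 1 by apply: signN_sqr.
exists 1, (delta_mx 0 i - t *: delta_mx 0 ord_max); split.
- by rewrite oner_neq0.
- rewrite dot_delta !mxE !eqxx (eq_sym ord_max) (negPf iM) /= mulr1 sub0r oppr_eq0.
  by rewrite signr_eq0.
apply/row_matrixP => j; rewrite rowE' row_signed_perm_mx frameE /= ffunE mul1r.
rewrite !mxE !eqxx /=.
have [->|ji] := eqVneq j i.
  rewrite /= tpermL (negPf iM) mulr0 subr0 scale1r opprB addrCA subrr addr0.
  by [].
have [->|jM] := eqVneq j ord_max.
  rewrite /= tpermR mulr1 sub0r scaleNr opprK scalerBr scalerA tt scale1r.
  by rewrite addrCA subrr addr0.
by rewrite /= sg0 expr0 scale1r mulr0 subr0 scale0r subr0 tpermD// eq_sym.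
Qed.

Lemma rank_lift_swap n (v : @label n S) (p : 'I_n.+1 * S) :
  \rank (1%:M - mx (lift_label v) *m mx (swap_label p)) =
  (\rank (1%:M - mx v)%R + (p != (ord_max, s0)))%N.
Proof.
have [->|pid] := eqVneq p (ord_max, s0).
  by rewrite swap_label_id mulmx1 rank_lift addn0.
have [k [a [k0 a0 ->]]] := swap_label_reflection pid.
have eW : delta_mx 0 ord_max *m mx (lift_label v) = delta_mx 0 ord_max :> 'rV[R]_n.+1.
  by rewrite -rowE row_signed_perm_mx; apply: frame_lift_max.
rewrite addn1 -rank_lift; apply: (rank_reflection eW _ k0 a0).
rewrite -[LHS]trmxK trmx_mul trmxK; congr trmx.
by rewrite -[in LHS]eW -mulmxA signed_perm_mx_orth mulmx1.
Qed.

Definition label_rank_count n j := #|[pred v : @label n S | \rank (1%:M - mx v)%R == j]|.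

Lemma sum_pred_card (T : finType) (P : pred T) : #|[pred x | P x]| = (\sum_x P x)%N.
Proof.
by rewrite -sum1_card big_mkcond; apply: eq_bigr => x _; rewrite inE; case: (P x).
Qed.

(** Every label factors uniquely as a lifted label times one of the (n+1)|S|
coset representatives, all of which but the trivial one raise the rank. *)
Lemma label_rank_countS n j : label_rank_count n.+1 j =
  (label_rank_count n j +
   (#|S| * n.+1 - 1) * (if j is j'.+1 then label_rank_count n j' else 0))%N.
Proof.
have /choice[Phi PhiE] (q : @label n S * ('I_n.+1 * S)) : exists u : @label n.+1 S,
    mx u = mx (lift_label q.1) *m mx (swap_label q.2).
  exact: (label_mx_mul sg_add).
have Phi_inj : injective Phi.
  move=> [v p] [v' p'] eqP; have := PhiE (v, p); rewrite eqP PhiE /= => eqM.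
  have rowmax (u : @label n S) r : row ord_max (mx (lift_label u) *m mx (swap_label r)) =
      (-1) ^+ sg r.2 *: delta_mx 0 r.1.
    rewrite row_mul row_signed_perm_mx -/(label_frame sg (lift_label u)) frame_lift_max.
    by rewrite -rowE row_signed_perm_mx -/(label_frame sg (swap_label r)) frame_swap_max.
  have pp : p = p'.
    have := rowmax v p; rewrite -eqM rowmax.
    have -> : (-1) ^+ sg p.2 *: delta_mx 0 p.1 =
        frame (fun=> sg p.2) (tperm ord_max p.1) ord_max :> 'rV[R]_n.+1.
      by rewrite frameE tpermL.
    have -> : (-1) ^+ sg p'.2 *: delta_mx 0 p'.1 =
        frame (fun=> sg p'.2) (tperm ord_max p'.1) ord_max :> 'rV[R]_n.+1.
      by rewrite frameE tpermL.
    move=> /frame_inj[]; rewrite !tpermL => p1 /sg_inj p2.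
    by case: p p' p1 p2 {eqM eqP} => ? ? [? ?] /= -> ->.
  rewrite -{}pp in eqM *; congr pair.
  have {}eqM : mx (lift_label v) = mx (lift_label v').
    have := congr1 (mulmx^~ (mx (swap_label p))^T) eqM.
    by rewrite /= -!mulmxA signed_perm_mx_orth !mulmx1.
  have := label_mx_inj sg_inj eqM; case: v v' {eqM eqP} => [e s] [e' s'] [/ffunP ee ss].
  congr pair.
    by apply/ffunP => i; have := ee (lift ord_max i); rewrite !ffunE liftK.
  apply/permP => i; have := congr1 (fun t : 'S_n.+1 => t (lift ord_max i)) ss.
  by rewrite !lift_perm_lift => /lift_inj.
have Phi_bij : bijective Phi.
  apply: inj_card_bij Phi_inj _.
  rewrite !card_prod !card_ffun !card_ord !card_Sn factS expnS.
  by apply: eq_leq; ring.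
have rankPhi q : \rank (1%:M - mx (Phi q)) =
    (\rank (1%:M - mx q.1)%R + (q.2 != (ord_max, s0)))%N.
  by rewrite PhiE rank_lift_swap.
move KE : (#|S| * n.+1 - 1)%N => K.
rewrite /label_rank_count !sum_pred_card (reindex Phi)/=; last exact: onW_bij.
under eq_bigr do rewrite rankPhi.
rewrite -(pair_bigA _ (fun v p => nat_of_bool
  ((\rank (1%:M - mx v)%R + (p != (ord_max, s0)))%N == j)))/=.
have cardp : (\sum_(p : 'I_n.+1 * S | p != (ord_max, s0)) 1 = K)%N.
  have total : (\sum_(p : 'I_n.+1 * S) 1 = #|S| * n.+1)%N.
    by rewrite sum_nat_const muln1 card_prod card_ord mulnC.
  by rewrite -KE -total [in RHS](bigD1 (ord_max, s0))//= addKn.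
transitivity (\sum_(v : @label n S) ((\rank (1%:M - mx v)%R == j) +
    K * ((\rank (1%:M - mx v)%R).+1 == j)))%N.
  apply: eq_bigr => v _; rewrite (bigD1 (ord_max, s0))//= eqxx addn0; congr addn.
  rewrite -cardp big_distrl/=; apply: eq_bigr => p pid.
  by rewrite pid addn1 mul1n.
rewrite big_split -big_distrr/=; congr (_ + _ * _)%N.
case: j => [|j]; first by rewrite big1.
by rewrite sum_pred_card; apply: eq_bigr => v _; rewrite eqSS.
Qed.

Lemma label_rank_count0 j : label_rank_count 0 j = (j == 0%N).
Proof.
rewrite /label_rank_count sum_pred_card.
have r0 (v : @label 0 S) : \rank (1%:M - mx v)%R = 0%N.
  by apply/eqP; rewrite -leqn0 rank_leq_row.
under eq_bigr do rewrite r0.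
by rewrite sum_nat_const !card_prod card_ffun card_ord expn0 card_Sn !mul1n eq_sym.
Qed.

(** By induction: label_rank_countS multiplies the generating polynomial of the
coranks by X + |S| (n+1) - 1. *)
Lemma label_rank_count_coef n j : (j <= n)%N -> label_rank_count n j =
  (\prod_(i < n) ('X + (#|S| * i.+1 - 1)%N%:P) : {poly nat})`_(n - j).
Proof.
pose p k : {poly nat} := \prod_(i < k) ('X + (#|S| * i.+1 - 1)%N%:P).
have pS k : p k.+1 = p k * ('X + (#|S| * k.+1 - 1)%N%:P) by rewrite /p big_ord_recr.
pose c k a : nat := (p k)`_a.
have c0 a : c 0%N a = (a == 0%N).
  by rewrite /c /p big_ord0 coef1; case: eqP.
have coefS k a : c k.+1 a = ((if a is a'.+1 then c k a' else 0) +
    c k a * (#|S| * k.+1 - 1))%N.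
  rewrite /c pS mulrDr coefD coefMX coefMC; by case: a.
have high k a : (k < a)%N -> c k a = 0%N.
  elim: k a => [|k IH] [|a]; rewrite ?c0// coefS => ka.
  by rewrite !IH// (leq_trans _ ka).
have top k a : (k < a)%N -> label_rank_count k a = 0%N.
  move=> ka; apply: eq_card0 => v; rewrite inE; apply/negbTE.
  by rewrite neq_ltn (leq_ltn_trans (rank_leq_row _) ka).
rewrite -/(p n) -/(c n (n - j)%N); elim: n j => [|n IH] [|j] // jn.
- by rewrite label_rank_count0 c0.
- by rewrite label_rank_countS muln0 addn0 IH// !subn0 coefS (high n n.+1)// mul0n addn0.
rewrite label_rank_countS subSS coefS mulnC (IH j)// [RHS]addnC.
have [jn'|jn'] := ltnP j n; last first.
  have -> : j = n by apply/eqP; rewrite eqn_leq jn' -ltnS jn.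
  by rewrite top// subnn addn0 add0n mulnC.
by rewrite (IH j.+1)// -(subnSK jn') addnC mulnC.
Qed.

End RankCounts.

(** * Stirling numbers and their alternate sums *)

Section AlternateSums.
Variables (c : nat -> nat) (m : nat).
Hypothesis c_high : forall k, (m < k)%N -> c k = 0%N.

(** Common form of DA and DB, with c the Stirling numbers of the type. *)
Definition alternate_sum k := (2 * \sum_(i < m.+1) c (m.+1 - k + i.*2))%N.

Lemma alternate_sum0 : alternate_sum 0 = 0%N.
Proof.
rewrite /alternate_sum big1// => i _; apply: c_high; rewrite subn0.
by rewrite ltn_addr.
Qed.

Lemma sum_even_odd (f : nat -> nat) N :
  (\sum_(i < N) (f i.*2 + f i.*2.+1) = \sum_(a < N.*2) f a)%N.
Proof.
elim: N => [|N IH]; first by rewrite !big_ord0.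
by rewrite big_ord_recr/= IH doubleS !big_ord_recr/= addnA.
Qed.

(** The two sums interlace: together their indices run once through all a >= m - k. *)
Lemma alternate_sumS k : (k <= m)%N ->
  (alternate_sum k.+1 + alternate_sum k = 2 * \sum_(j < k.+1) c (m - j))%N.
Proof.
move=> km; rewrite /alternate_sum -mulnDr -big_split/=; congr muln.
pose f a := c (m - k + a)%N.
rewrite (eq_bigr (fun i : 'I_m.+1 => f i.*2 + f i.*2.+1)%N) => [|i _]; last first.
  by rewrite /f subSS addnS -addSn subSn.
rewrite sum_even_odd.
transitivity (\sum_(0 <= a < k.+1) f a + \sum_(k.+1 <= a < m.+1.*2) f a)%N.
  by rewrite -big_cat_nat//=; [rewrite big_mkord|rewrite -addnn; lia].
rewrite [X in (_ + X)%N]big_nat_cond [X in (_ + X)%N]big1 => [|a /andP[/andP[ka _] _]].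
  rewrite addn0 big_mkord (reindex_inj rev_ord_inj)/=; apply: eq_bigr => j _.
  by rewrite /f; congr c; have := ltn_ord j; lia.
by apply: c_high; lia.
Qed.

End AlternateSums.

Lemma polyA_labels n :
  polyA n = \prod_(i < n) ('X + (#|{: unit}| * i.+1 - 1)%N%:P).
Proof. by apply: eq_bigr => i _; rewrite card_unit mul1n subn1. Qed.

Lemma polyB_labels n :
  polyB n = \prod_(i < n) ('X + (#|{: bool}| * i.+1 - 1)%N%:P).
Proof.
apply: eq_bigr => i _; rewrite card_bool; congr (_ + _%:P).
by rewrite -addnn; lia.
Qed.

Lemma size_prod_linear n (a : 'I_n -> nat) k : (n < k)%N ->
  (\prod_(i < n) ('X + (a i)%:P) : {poly nat})`_k = 0%N.
Proof.
elim: n a k => [|n IH] a [|k]// nk; first by rewrite big_ord0 coef1.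
rewrite big_ord_recr/= mulrDr coefD coefMX coefMC /=.
by rewrite !IH// ltnW.
Qed.

Lemma stirlingA_high n k : (n < k)%N -> stirlingA n k = 0%N.
Proof. exact: size_prod_linear. Qed.

Lemma stirlingB_high n k : (n < k)%N -> stirlingB n k = 0%N.
Proof. exact: size_prod_linear. Qed.

(** * Measurability of properness *)

Section ProperCone.
Context {R : realType} {d m : nat}.
Implicit Types x : 'I_m -> 'rV[R]_d.

Definition signed_axis (b : bool) (k : 'I_d) : 'rV[R]_d := (-1) ^+ b *: delta_mx 0 k.

Definition nearly_generates x (b : bool) (k : 'I_d) (l : {ffun 'I_m -> nat}) (N : nat) :=
  forall a : 'I_d, 2 * d%:R *
    `|(\sum_i (l i)%:R *: x i - N%:R *: signed_axis b k) 0 a| < N%:R.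

(** Rounding the coefficients down costs an error independent of N. *)
Lemma nearly_generates_full x : pos x = setT ->
  forall b k, exists l N, nearly_generates x b k l N.
Proof.
move=> xT b k; have [l l0 lE] : pos x (signed_axis b k) by rewrite xT.
pose S := \sum_i \sum_a `|x i 0 a|.
pose N := (Num.truncn (2 * d%:R * S)).+1.
have SN : 2 * d%:R * S < N%:R.
  have S0 : 0 <= 2 * d%:R * S.
    by rewrite mulr_ge0// ?mulr_ge0// sumr_ge0// => i _; rewrite sumr_ge0.
  by have /andP[] := truncn_itv S0.
have Nl i : 0 <= N%:R * l i by rewrite mulr_ge0.
exists [ffun i => Num.truncn (N%:R * l i)], N => a.
apply: le_lt_trans SN; apply: ler_wpM2l; first by rewrite mulr_ge0.
rewrite lE scaler_sumr -sumrB summxE; apply: le_trans (ler_norm_sum _ _ _) _.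
apply: ler_sum => i _; rewrite scalerA -scalerBl mxE normrM.
apply: (@le_trans _ _ `|x i 0 a|); last first.
  by rewrite (bigD1 a)//= lerDl sumr_ge0.
rewrite ler_piMl// ffunE distrC ger0_norm ?subr_ge0; last first.
  by have /andP[] := truncn_itv (Nl i).
have /andP[_ /ltW] := truncn_itv (Nl i).
by rewrite -natr1 lerBlDl.
Qed.

(** A supporting vector u is refuted in the direction opposite to its largest
coordinate, where an error below N / (2 d) per coordinate cannot make up for N. *)
Lemma full_nearly_generates x :
  (forall b k, exists l N, nearly_generates x b k l N) -> pos x = setT.
Proof.
move=> near_x; apply: contrapT => /supporting[u u0 ux].
have [k0 _] : exists k0 : 'I_d, u 0 k0 != 0.
  apply: contrapT => nk; move/eqP: u0; apply; apply/rowP => k; rewrite mxE.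
  by apply/eqP; apply: contrapT => /negP uk; apply: nk; exists k.
have [k _ umax] := @Order.TotalTheory.arg_maxP _ _ _ k0 xpredT (fun k => `|u 0 k|) isT.
have uk : 0 < `|u 0 k|.
  rewrite lt_def normr_ge0 andbT; apply: contra u0 => /eqP uk.
  by apply/eqP/rowP => a; rewrite mxE; apply/eqP; rewrite -normr_le0 -uk; exact: umax.
have [l [N lN]] := near_x (0 <= u 0 k) k.
rewrite /nearly_generates in lN; have d0 : (0 < d)%N by apply: leq_ltn_trans (ltn_ord k0).
set v := \sum_i _ in lN; set e := N%:R *: _ in lN.
have N0 : (0 : R) < N%:R.
  by apply: le_lt_trans (lN k); rewrite mulr_ge0// mulr_ge0.
have uv : 0 <= dot u v.
  by rewrite dot_sumr sumr_ge0// => i _; rewrite dotZr mulr_ge0.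
have ue : dot u e = - (N%:R * `|u 0 k|).
  rewrite !dotZr dot_delta -mulrN; congr (_ * _); case: (lerP 0 (u 0 k)) => h.
    by rewrite expr1 mulN1r (ger0_norm h).
  by rewrite expr0 mul1r (ltr0_norm h) opprK.
have : d%:R * (2 * dot u (v - e)) <= d%:R * (N%:R * `|u 0 k|).
  rewrite mulrCA mulrA; apply: le_trans (_ : \sum_(a < d) N%:R * `|u 0 k| <= _); last first.
    by rewrite sumr_const card_ord [leRHS]mulr_natl.
  rewrite /dot mulr_sumr; apply: ler_sum => a _.
  rewrite mulrCA mulrC; apply: le_trans (ler_norm _) _.
  rewrite normrM [`|2 * _ * _|]normrM (ger0_norm (_ : 0 <= 2 * d%:R))//.
  by apply: ler_pM; rewrite ?mulr_ge0//; [exact: ltW|exact: umax].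
rewrite ler_pM2l ?ltr0n// dotBr ue opprK => h.
have : 0 < N%:R * `|u 0 k| by rewrite mulr_gt0.
by lra.
Qed.

(** Whether a cone is the whole space is decided by countably many strict
inequalities: approximate multiples of the signed coordinate directions by natural
combinations of the generators. *)
Lemma measurable_proper {disp : measure_display} {T : measurableType disp}
    (x : T -> 'I_m -> 'rV[R]_d) : (forall i, measurable_mx (fun t => x t i)) ->
  measurable [set t | pos (x t) <> setT].
Proof.
move=> mx; have -> : [set t | pos (x t) <> setT] = ~` [set t | forall bk : bool * 'I_d,
    exists lN : {ffun 'I_m -> nat} * nat, nearly_generates (x t) bk.1 bk.2 lN.1 lN.2].
  apply/seteqP; split=> t /= xt h; apply: xt.
    by apply: full_nearly_generates => b k; have [[l N] lN] := h (b, k); exists l, N.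
  move=> [b k]; have [l [N lN]] := nearly_generates_full h b k.
  by exists (l, N).
apply: measurableC; apply: (@measurable_forall _ _ _ (fun bk => [set t |
  exists lN : {ffun 'I_m -> nat} * nat, nearly_generates (x t) bk.1 bk.2 lN.1 lN.2])).
move=> [b k]; apply: (@measurable_exists _ _ _ (fun lN => [set t |
  nearly_generates (x t) b k lN.1 lN.2])) => -[l N] /=.
apply: (@measurable_forall _ _ _ (fun a => [set t |
  2 * d%:R * `|(\sum_i (l i)%:R *: x t i - N%:R *: signed_axis b k) 0 a| < N%:R])).
move=> a; apply: measurable_lt; last exact: measurable_cst.
apply: measurable_funM; first exact: measurable_cst.
apply: measurableT_comp; first exact: normr_measurable.
apply: (@measurable_mx_add _ _ _ _ _ (fun t => \sum_i (l i)%:R *: x t i)).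
  move=> i0 c; apply: (eq_measurable_fun (fun t => \sum_i (l i)%:R * x t i i0 c)).
    by move=> t _; rewrite summxE; apply: eq_bigr => i _; rewrite mxE.
  apply: measurable_sum => i; apply: measurable_funM; last exact: mx.
  exact: measurable_cst.
exact: measurable_mx_cst.
Qed.

End ProperCone.

(** * Averaging over the group *)

Section IntegralLemmas.
Context {disp : measure_display} {T : measurableType disp} {R : realType}.
Local Open Scope ereal_scope.
Import HBNNSimple.

(** The intrinsic volume of a random cone is only known to agree almost everywhere
with a measurable function; for nonnegative integrands that is enough. *)
Lemma integral_ae_measurable (nu : {measure set T -> \bar R}) (N : set T)
    (f g : T -> \bar R) : measurable N -> nu N = 0 ->
  measurable_fun setT g -> (forall t, 0 <= f t) -> (forall t, 0 <= g t) ->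
  (forall t, ~ N t -> f t = g t) -> \int[nu]_t f t = \int[nu]_t g t.
Proof.
move=> mN N0 mg f0 g0 fg; apply/le_anti/andP; split.
  rewrite ge0_integralE//; apply: ge_ereal_sup => _ [h hf <-].
  rewrite -integralT_nnsfun.
  have mh : measurable_fun setT (EFin \o h) by exact/measurable_EFinP.
  have h0 t : 0 <= (EFin \o h) t by rewrite lee_fin.
  have mNC : measurable (setT `\` N) by exact: measurableD.
  rewrite (ge0_negligible_integral mN)//; last by move=> t _; exact: h0.
  apply: (@le_trans _ _ (\int[nu]_(t in setT `\` N) g t)); last first.
    exact: ge0_subset_integral.
  apply: ge0_le_integral => //.
  - by move=> t _; exact: h0.
  - exact: measurable_funTS.
  - exact: measurable_funTS.
  by move=> t [_ Nt]; rewrite -fg//; have := hf t; rewrite patch_setT.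
rewrite (ge0_negligible_integral mN)//.
rewrite integral_mkcond 2?ge0_integralE//; last first.
  by move=> t _; apply: erestrict_ge0.
apply: ereal_sup_le => h [h' hg <-].
exists h' => // t; apply: le_trans (hg t) _; rewrite !patch_setT/= patchE.
by case: ifPn => // /set_mem[_ Nt]; rewrite -fg.
Qed.

Lemma integral_mrestr (P : {measure set T -> \bar R}) (E : set T)
    (mE : measurable E) (g : T -> \bar R) : measurable_fun setT g ->
  (forall t, 0 <= g t) -> \int[mrestr P mE]_t g t = \int[P]_(t in E) g t.
Proof.
move=> mg g0; have mEC : measurable (~` E) by exact: measurableC.
have E0 : mrestr P mE (~` E) = 0 by rewrite /mrestr setICl measure0.
rewrite [LHS](ge0_negligible_integral mEC _ _ _ E0)//.
rewrite setTD setCK; apply: eq_measure_integral => A mA AE.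
by rewrite /mrestr; congr (P _); apply/setIidl.
Qed.

Lemma integral_cond_prob (P : probability T R) (E N : set T) (f g : T -> \bar R) :
  measurable E -> measurable N -> P N = 0 -> measurable_fun setT g ->
  (forall t, 0 <= f t) -> (forall t, 0 <= g t) ->
  (forall t, E t -> ~ N t -> f t = g t) ->
  \int[cond_prob P E]_t f t = (fine (P E))^-1%:E * \int[P]_(t in E) g t.
Proof.
move=> mE mN PN mg f0 g0 fg.
have k0 : (0 <= (fine (P E))^-1)%R by rewrite invr_ge0 fine_ge0.
have -> : cond_prob P E = mscale (NngNum k0) (mrestr P mE).
  by apply/funext => A; rewrite /cond_prob /mscale /mrestr muleC.
have mNE : measurable (N `|` ~` E) by apply: measurableU => //; exact: measurableC.
have NE0 : mscale (NngNum k0) (mrestr P mE) (N `|` ~` E) = 0.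
  change (((fine (P E))^-1)%:E * P ((N `|` ~` E) `&` E) = 0).
  rewrite setIUl setICl setU0.
  rewrite (_ : P (N `&` E) = 0) ?mule0//; apply: (subset_measure0 (B := N)) => //.
  exact: measurableI.
rewrite (integral_ae_measurable mNE NE0 mg)//.
  by rewrite ge0_integral_mscale// integral_mrestr.
by move=> t /not_orP[Nt /contrapT Et]; apply: fg.
Qed.

(** Double counting: the left side is the integral of the number of events that
occur. *)
Lemma sum_measure_count (P : probability T R) (I : finType) (A : I -> set T)
    (N : set T) c : (forall i, measurable (A i)) -> measurable N -> P N = 0 ->
  (forall t, ~ N t -> #|[pred i | `[< A i t >]]| = c) ->
  \sum_i P (A i) = c%:R%:E.
Proof.
move=> mA mN PN cA.
transitivity (\int[P]_t \sum_(i : I) (\1_(A i) t)%:E).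
  rewrite ge0_integral_sum//.
  - by apply: eq_bigr => i _; rewrite integral_indic// setIT.
  - by move=> i; apply/measurable_EFinP; exact: measurable_indic.
transitivity (\int[P]_t (cst c%:R%:E) t).
  apply: integral_ae_measurable PN _ _ _ _ => //.
  - by move=> t; apply: sume_ge0 => i _; rewrite lee_fin.
  - by move=> t; rewrite lee_fin.
  move=> t /cA <-; rewrite sumEFin -sum1_card natr_sum; congr (_%:E).
  rewrite [RHS]big_mkcond/=.
  apply: eq_bigr => i _; rewrite indicE inE/=.
  by case: asboolP => At; [rewrite mem_set|rewrite memNset].
transitivity (c%:R%:E * P setT); first exact: integral_cst.
by rewrite probability_setT mule1.
Qed.

Lemma ae_exists (P : probability T R) (Q : T -> Prop) :
  {ae P, forall w, Q w} -> exists w, Q w.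
Proof.
move=> [N [mN N0 QN]]; apply: contrapT => nQ.
have : P setT = 0.
  rewrite -N0; congr (P _); apply/seteqP; split=> // w _; apply: QN => Qw.
  by apply: nQ; exists w.
by rewrite probability_setT => /eqP; rewrite onee_eq0.
Qed.

Lemma integral_same_pushforward {disp' : measure_display}
    {U : measurableType disp'} (P : {measure set T -> \bar R}) (X Y : T -> U)
    (g : U -> \bar R) : measurable_fun setT X -> measurable_fun setT Y ->
  (forall A, measurable A -> P (X @^-1` A) = P (Y @^-1` A)) ->
  measurable_fun setT g -> (forall u, 0 <= g u) ->
  \int[P]_t g (X t) = \int[P]_t g (Y t).
Proof.
move=> mX mY XY mg g0.
have := ge0_integral_pushforward mX P measurableT mg.
rewrite preimage_setT => <- => [|u _]; last exact: g0.
have := ge0_integral_pushforward mY P measurableT mg.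
rewrite preimage_setT => <- => [|u _]; last exact: g0.
by apply: eq_measure_integral => A mA _; exact: XY.
Qed.

End IntegralLemmas.

Section LowFaces.
Context {R : realType} {d m : nat} (x : 'I_m -> 'rV[R]_d).
Hypothesis dm : (d <= m)%N.
Hypothesis gp : forall J : {set 'I_m}, #|J| = d -> indep x J.
Local Notation RT := (measurableTypeR R).
Local Notation cell J := [set t : d.-tuple RT | hits x J (row_of_tuple t)].

Lemma gauss_low_cells (Q : pred nat) : (forall j, Q j -> (j < d)%N) ->
  (\sum_(J : {set 'I_m} | Q #|J|) gauss (cell J))%E =
  gauss [set t : d.-tuple RT | exists2 J : {set 'I_m}, Q #|J| & hits x J (row_of_tuple t)].
Proof.
move=> Qd; have mcell (J : {set 'I_m}) : Q #|J| -> measurable (cell J).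
  by move=> /Qd Jd; apply: measurable_cell; apply: (gp_indep dm gp); apply: ltnW.
rewrite -sum_finType -measure_fin_bigcup//; first exact: finite_finset.
by move=> J K _ _ [t [/= hJ hK]]; apply: hits_disjoint hJ hK.
Qed.

Lemma intrinsic_volume_cells j : (j < d)%N -> intrinsic_volume j (pos x) =
  gauss [set t : d.-tuple RT | exists2 J : {set 'I_m}, #|J| == j & hits x J (row_of_tuple t)].
Proof.
move=> jd; rewrite (intrinsic_volume_low dm gp jd) (@gauss_low_cells (pred1 j))//.
by move=> i /eqP->.
Qed.

(** Stated with the condition that the cone is proper inside the event, so that the
event can be counted over a family of cones some of which are not. *)
Lemma intrinsic_volume_interior : pos x <> setT -> intrinsic_volume d (pos x) =
  gauss [set t : d.-tuple RT | pos x <> setT /\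
    ~ exists2 J : {set 'I_m}, (#|J| < d)%N & hits x J (row_of_tuple t)].
Proof.
move=> xT; have := intrinsic_volume_top dm gp xT.
rewrite (@gauss_low_cells (fun j => j < d)%N)//; set U := [set t | _].
have mU : measurable U.
  rewrite (_ : U = \bigcup_(J in [set J : {set 'I_m} | (#|J| < d)%N]) cell J)//.
  apply: fin_bigcup_measurable => [|J Jd]; first exact: finite_finset.
  by apply: measurable_cell; apply: (gp_indep dm gp); apply: ltnW.
move=> vU; have -> : [set t : d.-tuple RT | pos x <> setT /\
    ~ exists2 J : {set 'I_m}, (#|J| < d)%N & hits x J (row_of_tuple t)] = ~` U.
  by apply/seteqP; split=> t /=; [case|split].
have -> : gauss (~` U) = (1 - gauss U)%E by exact: probability_setC.
have Ufin : gauss U \is a fin_num by exact: fin_num_measure.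
by rewrite -vU addeK.
Qed.

End LowFaces.

Lemma ereal_average (R : realType) (I : finType) (i0 : I) (a : \bar R) (c : R) :
  (0 <= a -> \sum_(i : I) a = c%:E -> a = (c / #|I|%:R)%:E)%E.
Proof.
have I0 : #|I|%:R != 0 :> R.
  by rewrite pnatr_eq0 -lt0n; apply/card_gt0P; exists i0.
case: a => [a _|_|//].
  by rewrite sumEFin sumr_const => -[<-]; rewrite -[a *+ _]mulr_natr mulfK.
rewrite (bigD1 i0)//= addye// gt_eqF// (lt_le_trans ltNy0)//.
by apply: sume_ge0 => i _; exact: leey.
Qed.

Section Exchangeability.
Context {disp : measure_display} {T : measurableType disp} {R : realType}.
Context (P : probability T R) {d m : nat} {Om : finType} (v0 : Om).
Context (Z : Om -> T -> 'I_m -> 'rV[R]_d) (good : T -> Prop).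
Local Notation RT := (measurableTypeR R).
Local Notation tuples := (m.-tuple (d.-tuple RT)).
Hypothesis mZ : forall v, random_vectors (Z v).
Hypothesis dist : forall v, same_distribution P (Z v) (Z v0).
Hypothesis good_ae : {ae P, forall w, good w}.

Definition tuple_family (y : tuples) (i : 'I_m) : 'rV[R]_d := row_of_tuple (tnth y i).

Lemma tuple_family_joint X (w : T) : tuple_family (joint_tuple X w) = X w.
Proof. by apply/funext => i; apply/rowP => k; rewrite mxE !tnth_mktuple. Qed.

Lemma measurable_joint_tuple X : random_vectors X ->
  measurable_fun [set: T] (@joint_tuple _ T R d m X).
Proof.
move=> mX; apply/measurable_fun_tnthP => i; apply/measurable_fun_tnthP => k.
by apply: (eq_measurable_fun (fun w => X w i ord0 k : RT)) => // w _ /=;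
  rewrite !tnth_mktuple.
Qed.

Lemma average_transfer (g : tuples -> \bar R) c : measurable_fun setT g ->
  (forall y, 0 <= g y)%E ->
  (forall w, good w -> (\sum_v g (joint_tuple (Z v) w) = c%:R%:E)%E) ->
  (\int[P]_w g (joint_tuple (Z v0) w) = (c%:R / #|Om|%:R)%:E)%E.
Proof.
move=> mg g0 gc; apply: (ereal_average v0); first exact: integral_ge0.
have [N [mN N0 goodN]] := good_ae.
have mgZ v : measurable_fun setT (fun w => g (joint_tuple (Z v) w)).
  by apply: measurableT_comp => //; exact: measurable_joint_tuple.
transitivity (\sum_(v : Om) \int[P]_w g (joint_tuple (Z v) w))%E.
  apply: eq_bigr => v _; apply: integral_same_pushforward => //.
  - exact: measurable_joint_tuple.
  - exact: measurable_joint_tuple.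
  by move=> A mA; apply: esym; exact: dist.
rewrite -ge0_integral_sum//.
transitivity (\int[P]_w (cst c%:R%:E) w)%E.
  apply: integral_ae_measurable mN N0 _ _ _ _ => //.
  - by move=> w; apply: sume_ge0.
  - by move=> w; rewrite lee_fin.
  by move=> w Nw; rewrite gc//; apply: contrapT => nw; apply: Nw; apply: goodN.
transitivity (c%:R%:E * P setT)%E; first exact: integral_cst.
by rewrite probability_setT mule1.
Qed.

Lemma probability_transfer (A : set tuples) c : measurable A ->
  (forall w, good w -> #|[pred v | `[< A (joint_tuple (Z v) w) >]]| = c) ->
  P (joint_tuple (Z v0) @^-1` A) = (c%:R / #|Om|%:R)%:E.
Proof.
move=> mA cA; have mj := measurable_joint_tuple (mZ v0).
have mjA : measurable (joint_tuple (Z v0) @^-1` A).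
  by rewrite -[X in measurable X]setTI; apply: mj.
transitivity (\int[P]_w (\1_(joint_tuple (Z v0) @^-1` A) w)%:E)%E.
  by rewrite integral_indic// setIT.
apply: (@average_transfer (fun y => (\1_A y)%:E)).
- by apply/measurable_EFinP; exact: measurable_indic.
- by move=> y; rewrite lee_fin.
by move=> w /cA <-; rewrite card_asbool sumEFin natr_sum; congr (_%:E).
Qed.

Lemma measurable_tuple_family i : measurable_mx (fun y : tuples => tuple_family y i).
Proof. by apply: measurable_mx_row_of_tuple; exact: measurable_tnth. Qed.

Section Event.
Variables (e : ('I_m -> 'rV[R]_d) -> 'rV[R]_d -> Prop) (E : set (tuples * d.-tuple RT)).
Variables (j N c : nat).
Hypothesis mE : measurable E.
Hypothesis eE : forall w v t, good w ->
  e (Z v w) (row_of_tuple t) <-> E (joint_tuple (Z v) w, t).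
Hypothesis e_proper : forall w v z, good w -> e (Z v w) z -> pos (Z v w) <> setT.
Hypothesis e_volume : forall w v, good w -> pos (Z v w) <> setT ->
  intrinsic_volume j (pos (Z v w)) =
  gauss [set t : d.-tuple RT | e (Z v w) (row_of_tuple t)].
Hypothesis e_count : forall w, good w ->
  generic (fun z => #|[pred v | `[< e (Z v w) z >]]| = c).
Hypothesis N_count : forall w, good w ->
  #|[pred v | `[< pos (Z v w) <> setT >]]| = N.

(** All the cones Z v w have the same law, so the expectation for one of them is
the average over v of the integrand, which is a constant count for each w. *)
Lemma expected_volume_count :
  expected_volume_proper P (fun w => pos (Z v0 w)) j = (c%:R / N%:R)%:E.
Proof.
pose h (y : tuples) := gauss (xsection E y).
have mh : measurable_fun setT h by exact: measurable_fun_xsection.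
have h0 y : (0 <= h y)%E by exact: measure_ge0.
have hE w v : good w -> h (joint_tuple (Z v) w) =
    gauss [set t : d.-tuple RT | e (Z v w) (row_of_tuple t)].
  move=> gw; congr gauss; apply/seteqP; split=> t /=.
    by move=> /set_mem/(eE _ _ gw).
  by move=> /(eE _ _ gw) ?; apply/mem_set.
have mproper : measurable [set y : tuples | pos (tuple_family y) <> setT].
  exact: measurable_proper measurable_tuple_family.
have mj := measurable_joint_tuple (mZ v0).
pose F := [set w | pos (Z v0 w) <> setT].
have FE : F = joint_tuple (Z v0) @^-1` [set y : tuples | pos (tuple_family y) <> setT].
  by apply/seteqP; split=> w; rewrite /F /= tuple_family_joint.
have mF : measurable F by rewrite FE -[X in measurable X]setTI; apply: mj.
have PF : P F = (N%:R / #|Om|%:R)%:E.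
  rewrite FE; apply: probability_transfer => // w gw; rewrite -(N_count gw).
  by apply: eq_card => v; rewrite !inE /= tuple_family_joint.
have avg : (\int[P]_w h (joint_tuple (Z v0) w) = (c%:R / #|Om|%:R)%:E)%E.
  apply: average_transfer => // w gw.
  have [B [mB B0 cB]] := gauss_generic (e_count gw).
  apply: (sum_measure_count _ mB B0) => [v|t /cB <-]; first exact: measurable_xsection.
  apply: eq_card => v; rewrite !inE; apply: asbool_equiv_eq; split.
    by move=> /set_mem/(eE _ _ gw).
  by move=> /(eE _ _ gw) ?; apply/mem_set.
have [B [mB B0 goodB]] := good_ae.
have gB w : ~ B w -> good w.
  by move=> Bw; apply: contrapT => nw; apply: Bw; apply: goodB.
have mhj : measurable_fun setT (fun w => h (joint_tuple (Z v0) w)).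
  exact: measurableT_comp mh mj.
rewrite /expected_volume_proper.
rewrite (integral_cond_prob (g := fun w => h (joint_tuple (Z v0) w)) mF mB)//; first last.
- by move=> w Fw /gB gw; rewrite e_volume// hE.
- by move=> w; apply: esum_ge0 => A _; exact: measure_ge0.
rewrite integral_mkcond [X in (_ * X)%E](integral_ae_measurable mB B0 mhj)//; first last.
- move=> w /gB gw; rewrite patchE; case: ifPn => // nF.
  rewrite hE// (_ : [set t | _] = set0) ?measure0//.
  apply/seteqP; split=> // t /= /(e_proper gw) pT.
  by move/negP: nF; apply; apply/mem_set.
- by move=> w; apply: erestrict_ge0.
rewrite avg PF/= -EFinM; congr (_%:E); rewrite invf_div mulrC mulrA divfK//.
by rewrite pnatr_eq0 -lt0n; apply/card_gt0P; exists v0.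
Qed.

End Event.

End Exchangeability.

Section ChamberCones.
Context {disp : measure_display} {T : measurableType disp} {R : realType}.
Context (P : probability T R) {n m d : nat} {Om : finType} (v0 : Om).
Context {M : Om -> 'M[R]_n} {alpha : Om -> 'I_m -> 'rV[R]_n}.
Hypothesis csM : chamber_system M alpha.
Context (Y : T -> 'M[R]_(n, d)) (D : nat -> nat).
Local Notation RT := (measurableTypeR R).
Local Notation tuples := (m.-tuple (d.-tuple RT)).
Local Notation Z v w := (fun i => alpha v i *m Y w).
Local Notation good w := (general_position (m := m) (alpha := alpha) (Y w)).
Local Notation rk := (rank_count (M := M)).
Hypothesis mZ : forall v, random_vectors (fun w => Z v w).
Hypothesis dist : forall v, same_distribution P (fun w => Z v w) (fun w => Z v0 w).
Hypothesis good_ae : {ae P, forall w, good w}.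
Hypothesis D0 : D 0%N = 0%N.
Hypothesis DS : forall k, (k < d)%N -> (D k.+1 + D k = 2 * \sum_(j < k.+1) rk j)%N.

Local Notation hits_event Q := [set p : tuples * d.-tuple RT |
  exists J : {set 'I_m}, Q #|J| /\ hits_polynomial (tuple_family p.1) J (row_of_tuple p.2)].

Let measurable_family i :
  measurable_mx (fun p : tuples * d.-tuple RT => tuple_family p.1 i).
Proof.
by move=> a k; apply: (measurableT_comp (measurable_tuple_family i a k)); exact: measurable_fst.
Qed.

Lemma measurable_hits_event (Q : pred nat) : measurable (hits_event Q).
Proof.
have := @measurable_exists _ (tuples * d.-tuple RT)%type {set 'I_m} (fun J =>
  [set p : tuples * d.-tuple RT |
    Q #|J| /\ hits_polynomial (tuple_family p.1) J (row_of_tuple p.2)]).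
apply => J.
have [QJ|nQ] := boolP (Q #|J|); last first.
  rewrite (_ : [set p | _] = set0)//.
  by apply/seteqP; split=> // p [].
have mrow : measurable_mx (fun p : tuples * d.-tuple RT => row_of_tuple p.2).
  by apply: measurable_mx_row_of_tuple; exact: measurable_snd.
have := measurable_hits_polynomial measurable_family mrow J.
by congr (measurable _); apply/seteqP; split=> p //= [].
Qed.

Lemma hits_eventE (Q : pred nat) w v t : (forall j, Q j -> (j <= d)%N) -> good w ->
  (exists2 J : {set 'I_m}, Q #|J| & hits (Z v w) J (row_of_tuple t)) <->
  hits_event Q (joint_tuple (fun w => Z v w) w, t).
Proof.
move=> Qd [dm gp]; rewrite /= tuple_family_joint.
have indJ (J : {set 'I_m}) : Q #|J| -> indep (Z v w) J.
  by move=> /Qd; apply: (gp_indep dm (gp v)).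
split=> [[J QJ hJ]|[J [QJ hJ]]]; exists J => //.
  by split=> //; apply/(hits_polynomialP _ (indJ J QJ)).
exact/(hits_polynomialP _ (indJ J QJ)).
Qed.

Let hits_proper w v (J : {set 'I_m}) z : good w -> (#|J| < d)%N -> hits (Z v w) J z ->
  pos (Z v w) <> setT.
Proof. by move=> [dm _] Jd /hits_notin; case=> //; apply: leq_trans dm. Qed.

Let proper w : good w -> #|[pred v | `[< pos (Z v w) <> setT >]]| = D d.
Proof. by move=> gw; exact: (proper_count csM gw D0 DS). Qed.

Lemma expected_volume_low j : (j < d)%N ->
  expected_volume_proper P (fun w => pos (Z v0 w)) j = ((rk j)%:R / (D d)%:R)%:E.
Proof.
move=> jd; have Qd i : pred1 j i -> (i <= d)%N by move=> /eqP->; apply: ltnW.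
apply: (@expected_volume_count _ _ _ P _ _ _ v0 (fun v w => Z v w) (fun w => good w)
  mZ dist good_ae
  (fun x z => exists2 J : {set 'I_m}, #|J| == j & hits x J z) (hits_event (pred1 j))).
- exact: measurable_hits_event.
- by move=> w v t; apply: hits_eventE.
- by move=> w v z gw [J /eqP Jj] hJ; apply: (hits_proper gw _ hJ); rewrite Jj.
- by move=> w v [dm gp] _; exact: (intrinsic_volume_cells dm (gp v) jd).
- move=> w /(generic_cell_count csM); apply: generic_sub => z /(_ j jd) <-.
  apply: eq_card => v; rewrite !inE; apply: asbool_equiv_eq.
  by split=> -[J /eqP Jj hJ]; exists J => //; apply/eqP.
- exact: proper.
Qed.

(** A cone with a lower face catching z is proper, so the proper cones split into
those with and those without such a face. *)
Let top_count w : good w -> generic (fun z =>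
  #|[pred v | `[< pos (Z v w) <> setT /\
    ~ exists2 J : {set 'I_m}, (#|J| < d)%N & hits (Z v w) J z >]]| +
  \sum_(j < d) rk j = D d)%N.
Proof.
move=> gw; apply: generic_sub (generic_low_count csM gw) => z.
rewrite -(proper gw) => <-; rewrite !card_asbool -big_split; apply: eq_bigr => v _ /=.
have low : (exists2 J : {set 'I_m}, (#|J| < d)%N & hits (Z v w) J z) ->
    pos (Z v w) <> setT by move=> [J Jd]; apply: (hits_proper gw Jd).
by case: asboolP => a; case: asboolP => b; case: asboolP => c //; exfalso; tauto.
Qed.

Let low_le_proper : (\sum_(j < d) rk j <= D d)%N.
Proof.
have [w /top_count/generic_ex[z <-]] := ae_exists good_ae; exact: leq_addl.
Qed.

(** By the recurrence D d minus the sum of the c_j is half of D d - D d.-1. *)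
Lemma expected_volume_top : (0 < d)%N ->
  expected_volume_proper P (fun w => pos (Z v0 w)) d =
    (((D d)%:R - (D d.-1)%:R) / (2 * (D d)%:R))%:E.
Proof.
move=> d0; have -> : ((D d)%:R - (D d.-1)%:R) / (2 * (D d)%:R) =
    (D d - \sum_(j < d) rk j)%N%:R / (D d)%:R :> R.
  have dd : (d.-1 < d)%N by rewrite ltn_predL.
  have := DS dd; rewrite prednK// => /(congr1 (fun k => k%:R : R)).
  rewrite (natrB _ low_le_proper) natrD natrM => e; rewrite invfM mulrA; congr (_ / _).
  by apply: (mulIf (_ : (2 : R) != 0)) => //; rewrite divfK//; lra.
apply: (@expected_volume_count _ _ _ P _ _ _ v0 (fun v w => Z v w) (fun w => good w)
  mZ dist good_ae
  (fun x z => pos x <> setT /\ ~ exists2 J : {set 'I_m}, (#|J| < d)%N & hits x J z)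
  ([set p | pos (tuple_family p.1) <> setT] `\` hits_event (fun j => j < d)%N)).
- apply: measurableD; last exact: (measurable_hits_event (fun j => j < d)%N).
  exact: (measurable_proper (x := fun p : tuples * d.-tuple RT => tuple_family p.1)
    measurable_family).
- move=> w v t gw; have := @hits_eventE (fun j => j < d)%N w v t _ gw.
  move=> /(_ (fun j => @ltnW _ _)) h; split=> -[pT low].
    by split=> [|/h//]; rewrite /= tuple_family_joint.
  by split=> [|/h//]; move: pT; rewrite /= tuple_family_joint.
- by move=> w v z _ [].
- by move=> w v [dm gp]; exact: (intrinsic_volume_interior dm (gp v)).
- move=> w /top_count; apply: generic_sub => z <-.
  by rewrite addnK.
- exact: proper.
Qed.

End ChamberCones.

(** * The two types *)

Section RandomGenerators.
Context {R : realType} {d n : nat}.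
Local Notation RT := (measurableTypeR R).

Lemma random_vectors_genA {disp} {T : measurableType disp} (X : T -> 'I_n -> 'rV[R]_d) :
  random_vectors X -> random_vectors (fun w => genA (X w)).
Proof.
move=> mX i k; rewrite /genA; apply: (eq_measurable_fun (fun w =>
  X w (widen_ord (leq_pred n) i) ord0 k - X w (ordS (widen_ord (leq_pred n) i)) ord0 k : RT)).
  by move=> w _; rewrite !mxE.
by apply: measurable_funB; apply: mX.
Qed.

Lemma random_vectors_genB {disp} {T : measurableType disp} (X : T -> 'I_n -> 'rV[R]_d) :
  random_vectors X -> random_vectors (fun w => genB (X w)).
Proof.
move=> mX i k; rewrite /genB; case: eqP => _; first exact: mX.
apply: (eq_measurable_fun (fun w => X w i ord0 k - X w (ordS i) ord0 k : RT)).
  by move=> w _; rewrite !mxE.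
by apply: measurable_funB; apply: mX.
Qed.

Lemma random_vectors_signed {disp} {T : measurableType disp} (X : T -> 'I_n -> 'rV[R]_d)
    e s : random_vectors X -> random_vectors (fun w => signed_perm (X w) e s).
Proof.
move=> mX i k; apply: (eq_measurable_fun (fun w => (-1) ^+ e i * X w (s i) ord0 k : RT)).
  by move=> w _; rewrite mxE.
by apply: measurable_funM; [exact: measurable_cst|exact: mX].
Qed.

Lemma genA_mulmx p (f : 'I_n -> 'rV[R]_p) (A : 'M[R]_(p, d)) i :
  genA f i *m A = genA (fun k => f k *m A) i.
Proof. by rewrite mulmxBl. Qed.

Lemma genB_mulmx p (f : 'I_n -> 'rV[R]_p) (A : 'M[R]_(p, d)) i :
  genB f i *m A = genB (fun k => f k *m A) i.
Proof. by rewrite /genB; case: ifP; rewrite ?mulmxBl. Qed.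

Lemma label_frame_mulmx (S : finType) (sg : S -> bool) (v : @label n S)
    (y : 'I_n -> 'rV[R]_d) k :
  label_frame sg v k *m \matrix_i y i = signed_perm y (sg \o v.1) v.2 k.
Proof. by rewrite /label_frame frameE -scalemxAl -rowE rowK. Qed.

(** The tuple of generators is a measurable function of the tuple of vectors. *)
Lemma same_distribution_map {disp} {T : measurableType disp} (P : probability T R)
    m p (g : ('I_n -> 'rV[R]_d) -> 'I_m -> 'rV[R]_p) (X X' : T -> 'I_n -> 'rV[R]_d) :
  random_vectors (fun y : n.-tuple (d.-tuple RT) => g (tuple_family y)) ->
  same_distribution P X X' ->
  same_distribution P (fun w => g (X w)) (fun w => g (X' w)).
Proof.
move=> mg XX' A mA; have mG := measurable_joint_tuple mg.
have GE (V : T -> 'I_n -> 'rV[R]_d) : joint_tuple (fun w => g (V w)) @^-1` A =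
    joint_tuple V @^-1` (joint_tuple (fun y => g (tuple_family y)) @^-1` A).
  apply/seteqP; split=> w /=; rewrite /joint_tuple /= -/(joint_tuple V w);
    by rewrite tuple_family_joint.
rewrite !GE; apply: XX'; rewrite -[X in measurable X]setTI; exact: mG.
Qed.

Lemma random_vectors_family :
  random_vectors (fun y : n.-tuple (d.-tuple RT) => tuple_family y).
Proof. by move=> i k; apply: measurable_tuple_family. Qed.

End RandomGenerators.

(** Common form of the two types: gen builds the generators from n vectors, and the
signs are read from S through sg. *)
Section DualWeylCones.
Context {disp : measure_display} {T : measurableType disp} {R : realType}.
Context (P : probability T R) {n m d : nat} {S : finType} (sg : S -> bool) (s0 : S).
Variable gen : forall p, ('I_n -> 'rV[R]_p) -> 'I_m -> 'rV[R]_p.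
Variables (c : nat -> nat) (Y : T -> 'I_n -> 'rV[R]_d).
Local Notation RT := (measurableTypeR R).
Local Notation Z v w := (gen (signed_perm (Y w) (sg \o v.1) v.2)).
Hypothesis sg0 : sg s0 = false.
Hypothesis csM : chamber_system (label_mx (R := R) sg)
  (fun v : @label n S => gen (label_frame sg v)).
Hypothesis gen_mulmx : forall p (f : 'I_n -> 'rV[R]_p) (A : 'M[R]_(p, d)) i,
  gen f i *m A = gen (fun k => f k *m A) i.
Hypothesis measurable_gen : forall disp (U : measurableType disp)
  (X : U -> 'I_n -> 'rV[R]_d), random_vectors X -> random_vectors (fun w => gen (X w)).
Hypothesis c_high : forall k, (n < k)%N -> c k = 0%N.
Hypothesis rank_c : forall j, (j <= n)%N -> label_rank_count (R := R) sg n j = c (n - j).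
Hypothesis mY : random_vectors Y.
Hypothesis exchY : forall v : @label n S,
  same_distribution P Y (fun w => signed_perm (Y w) (sg \o v.1) v.2).
Hypothesis posY : {ae P, forall w, [/\ (d <= n)%N, (d <= m)%N &
  forall v : @label n S, any_d_free (Z v w)]}.

Let v0 : @label n S := ([ffun=> s0], 1%g).

Let Z0 w : Z v0 w = gen (Y w).
Proof.
congr gen; apply/funext => i.
by rewrite /signed_perm /= ffunE sg0 expr0 scale1r perm1.
Qed.

Let ZE w (v : @label n S) : Z v w = fun i => gen (label_frame sg v) i *m \matrix_i Y w i.
Proof.
apply/funext => i; rewrite gen_mulmx; congr gen; apply/funext => k.
by rewrite label_frame_mulmx.
Qed.

Let ZfE (v : @label n S) :
  (fun w => Z v w) = (fun w i => gen (label_frame sg v) i *m \matrix_i Y w i).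
Proof. by apply/funext => w; exact: ZE. Qed.

Let Z0fE : (fun w => gen (Y w)) =
  (fun w i => gen (label_frame sg v0) i *m \matrix_i Y w i).
Proof. by rewrite -ZfE; apply/funext => w; rewrite Z0. Qed.

Let mZ (v : @label n S) :
  random_vectors (fun w i => gen (label_frame sg v) i *m \matrix_i Y w i).
Proof.
rewrite -ZfE.
by apply: measurable_gen; apply: random_vectors_signed.
Qed.

Let dist (v : @label n S) :
  same_distribution P (fun w i => gen (label_frame sg v) i *m \matrix_i Y w i)
    (fun w i => gen (label_frame sg v0) i *m \matrix_i Y w i).
Proof.
rewrite -ZfE -Z0fE.
apply: same_distribution_map => [|A mA]; last exact/esym/exchY.
by apply: measurable_gen; apply: random_vectors_family.
Qed.

Let dn : (d <= n)%N.
Proof. by have [w []] := ae_exists posY. Qed.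

Let good_ae : {ae P, forall w, general_position (m := m)
  (alpha := fun v : @label n S => gen (label_frame sg v)) (\matrix_i Y w i)}.
Proof.
apply: filterS posY => w [_ dm free_Z]; split=> // v J Jd.
by rewrite -ZE; apply/free_indep; apply: free_Z.
Qed.

Let recurrence k : (k < d)%N -> (alternate_sum c n k.+1 + alternate_sum c n k =
  2 * \sum_(j < k.+1) rank_count (M := label_mx (R := R) (n := n) sg) j)%N.
Proof.
move=> kd; have kn := leq_trans (ltnW kd) dn.
rewrite alternate_sumS//; congr (_ * _)%N; apply: eq_bigr => j _.
by rewrite -rank_c// (leq_trans _ kn)// -ltnS.
Qed.

Lemma expected_volume_dual_weyl : (0 < d)%N ->
  expected_volume_proper P (fun w => pos (gen (Y w))) d =
    (((alternate_sum c n d)%:R - (alternate_sum c n d.-1)%:R) /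
      (2 * (alternate_sum c n d)%:R))%:E /\
  forall j, (j < d)%N -> expected_volume_proper P (fun w => pos (gen (Y w))) j =
    ((c (n - j))%:R / (alternate_sum c n d)%:R)%:E.
Proof.
move=> d0; have -> : (fun w => pos (gen (Y w))) =
    (fun w => pos (fun i => gen (label_frame sg v0) i *m \matrix_i Y w i)).
  by apply/funext => w; rewrite -Z0 ZE.
split=> [|j jd].
  by have := expected_volume_top csM mZ dist good_ae (alternate_sum0 c_high) recurrence d0.
rewrite -rank_c; last exact: ltnW (leq_trans jd dn).
by have := expected_volume_low csM mZ dist good_ae (alternate_sum0 c_high) recurrence jd.
Qed.

End DualWeylCones.

Theorem corollary1p17 (R : realType) (d : nat) (hd : (2 <= d)%N) :
  (forall (disp : measure_display) (T : measurableType disp)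
     (P : probability T R) (n : nat) (Y : T -> 'I_n -> 'rV[R]_d),
     random_vectors Y ->
     exchangeable P Y ->
     {ae P, forall w, gen_posA (Y w)} ->
     E_volume_A P Y d
       = (((DA n d)%:R - (DA n d.-1)%:R) / (2 * (DA n d)%:R))%:E
     /\ forall j : nat, (j < d)%N ->
        E_volume_A P Y j = ((stirlingA n (n - j))%:R / (DA n d)%:R)%:E)
  /\
  (forall (disp : measure_display) (T : measurableType disp)
     (P : probability T R) (n : nat) (Y : T -> 'I_n -> 'rV[R]_d),
     random_vectors Y ->
     symmetrically_exchangeable P Y ->
     {ae P, forall w, gen_posB (Y w)} ->
     E_volume_B P Y d
       = (((DB n d)%:R - (DB n d.-1)%:R) / (2 * (DB n d)%:R))%:E
     /\ forall j : nat, (j < d)%N ->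
        E_volume_B P Y j = ((stirlingB n (n - j))%:R / (DB n d)%:R)%:E).
Proof.
split=> disp T P n Y mY exY posY.
- pose sgu (_ : unit) := false.
  have sgu_inj : injective sgu by case; case.
  have rank_c j : (j <= n)%N -> label_rank_count (R := R) sgu n j = stirlingA n (n - j).
    by move=> jn; rewrite /stirlingA polyA_labels (@label_rank_count_coef _ _ tt _ (fun _ _ => tt)).
  have signE (y : 'I_n -> 'rV[R]_d) (v : @label n unit) : signed_perm y (sgu \o v.1) v.2 = y \o v.2.
    by apply/funext => i; rewrite /signed_perm expr0 scale1r.
  have exY' (v : @label n unit) :
      same_distribution P Y (fun w => signed_perm (Y w) (sgu \o v.1) v.2).
    rewrite (_ : (fun w => _) = fun w => Y w \o v.2); first exact: exY.
    by apply/funext => w; exact: signE.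
  have posY' : {ae P, forall w, [/\ (d <= n)%N, (d <= n.-1)%N & forall v : @label n unit,
      any_d_free (genA (signed_perm (Y w) (sgu \o v.1) v.2))]}.
    apply: filterS posY => w [dn free_Y]; split=> [||v]; [exact: ltnW|lia|].
    by rewrite signE; apply: free_Y.
  exact: (expected_volume_dual_weyl (s0 := tt) (gen := fun p => @genA R p n)
    erefl chamber_systemA (@genA_mulmx R d n) (@random_vectors_genA R d n)
    (@stirlingA_high n) rank_c mY exY' posY' (ltnW hd)).
- have rank_c j : (j <= n)%N -> label_rank_count (R := R) id n j = stirlingB n (n - j).
    by move=> jn; rewrite /stirlingB polyB_labels (@label_rank_count_coef _ _ false _ addb).
  have exY' (v : @label n bool) :
      same_distribution P Y (fun w => signed_perm (Y w) (id \o v.1) v.2) by exact: exY.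
  have posY' : {ae P, forall w, [/\ (d <= n)%N, (d <= n)%N & forall v : @label n bool,
      any_d_free (genB (signed_perm (Y w) (id \o v.1) v.2))]}.
    by apply: filterS posY => w [dn free_Y]; split=> // v; apply: free_Y.
  exact: (expected_volume_dual_weyl (s0 := false) (gen := fun p => @genB R p n)
    erefl chamber_systemB (@genB_mulmx R d n) (@random_vectors_genB R d n)
    (@stirlingB_high n) rank_c mY exY' posY' (ltnW hd)).
Qed.
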